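(* Let $d\ge 2$, let $A$ be a fixed non-degenerate real $d\times d$ matrix, let $\boldsymbol B(t)=(B_1(t),\dots,B_d(t))^\top$ be a $d$-dimensional Brownian motion with independent (standard) components, put $\boldsymbol W(t)=A\boldsymbol B(t)$, and let $\boldsymbol\eta$ be an $\mathbb R^d$-valued random vector independent of $\boldsymbol B$ such that $\mathbb P\{\boldsymbol K_1\le\boldsymbol\eta\le\boldsymbol K_2\}=1$ for some fixed $\boldsymbol K_1,\boldsymbol K_2\in\mathbb R^d$. Let $\boldsymbol a\in\mathbb R^d\setminus(-\infty,0]^d$, and let $\Sigma$, $\widetilde{\boldsymbol a}$, $I$ be as defined in the context. Then $$\mathbb P\{\exists\, t\in[0,1]:\ \boldsymbol W(t)-\boldsymbol\eta t>\boldsymbol a u\}\ \sim\ \Big(\prod_{i\in I}\lambda_i\Big)\, I_a\ \mathbb P\{\boldsymbol W(1)>\boldsymbol a u+\boldsymbol\eta\},\qquad u\to\infty,$$ where $\boldsymbol\lambda=\Sigma^{-1}\widetilde{\boldsymbol a}$ and $$I_a=\int_{\mathbb R^{|I|}}\mathbb P\{\exists\, t\ge 0:\ \boldsymbol W_I(t)-\boldsymbol a_I t>\boldsymbol x_I\}\,e^{\langle\boldsymbol\lambda_I,\boldsymbol x_I\rangle}\,d\boldsymbol x_I\in(0,\infty).$$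
   Context: All relations and operations between vectors are componentwise; $\langle\cdot,\cdot\rangle$ is the standard scalar product; $f(u)\sim g(u)$ means $f(u)/g(u)\to1$ as $u\to\infty$. For an index set $F\subseteq\{1,\dots,d\}$, $\boldsymbol x_F$ is the subvector of $\boldsymbol x$ with indices in $F$, and $\Sigma_{F_1F_2}$ is the submatrix of $\Sigma$ with rows in $F_1$ and columns in $F_2$. $\Sigma=AA^\top$ is the covariance matrix of $\boldsymbol W(1)$. Quadratic programming problem: for positive definite $\Sigma$ and $\boldsymbol a\in\mathbb R^d\setminus(-\infty,0]^d$, $\widetilde{\boldsymbol a}$ denotes the unique minimizer of $\boldsymbol x^\top\Sigma^{-1}\boldsymbol x$ over $\{\boldsymbol x\in\mathbb R^d:\boldsymbol x\ge\boldsymbol a\}$, and $I\subseteq\{1,\dots,d\}$ denotes the unique nonempty index set such that $\widetilde{\boldsymbol a}_I=\boldsymbol a_I$, $(\Sigma_{II})^{-1}\boldsymbol a_I>\boldsymbol 0_I$, and, if $I^c=\{1,\dots,d\}\setminus I\ne\emptyset$, $\widetilde{\boldsymbol a}_{I^c}=\Sigma_{I^cI}(\Sigma_{II})^{-1}\boldsymbol a_I\ge\boldsymbol a_{I^c}$ (existence and uniqueness of $\widetilde{\boldsymbol a}$ and $I$ is a known fact). *)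

(* Defs.v *)
From HB Require Import structures.
From mathcomp Require Import all_boot all_order all_algebra.
From mathcomp Require Import all_classical all_reals all_analysis.
Set Implicit Arguments.
Unset Strict Implicit.
Unset Printing Implicit Defensive.
Import Order.TTheory GRing.Theory Num.Theory.
Import numFieldNormedType.Exports.
Local Open Scope classical_set_scope.
Local Open Scope ring_scope.

Section lebesgue_tuple.
Context {R : realType}.

Section step.
Variables (n : nat) (mu : {sigma_finite_measure set (n.-tuple R) -> \bar R}).

Let tcons (p : R * n.-tuple R) : n.+1.-tuple R := [tuple of p.1 :: p.2].

Definition lebesgue_step : set (n.+1.-tuple R) -> \bar R :=
  pushforward (@lebesgue_measure R \x mu)%E tcons.

Let mtcons : measurable_fun setT tcons.
Proof. exact: measurable_cons. Qed.

Let step0 : lebesgue_step set0 = 0%E.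
Proof. by rewrite /lebesgue_step /pushforward preimage_set0 measure0. Qed.

Let step_ge0 A : (0 <= lebesgue_step A)%E.
Proof. exact: measure_ge0. Qed.

Let step_sigma_additive : semi_sigma_additive lebesgue_step.
Proof.
move=> F mF tF mUF; rewrite /lebesgue_step /pushforward preimage_bigcup.
apply: (@measure_semi_sigma_additive _ _ _ (@lebesgue_measure R \x mu)%E).
- by move=> k; rewrite -[X in measurable X]setTI; exact: mtcons.
- apply/trivIsetP => /= i j _ _ ij; rewrite -preimage_setI.
  by move/trivIsetP : tF => /(_ i j Logic.I Logic.I ij) ->; rewrite preimage_set0.
- rewrite -preimage_bigcup -[X in measurable X]setTI.
  exact: mtcons.
Qed.

HB.instance Definition _ := isMeasure.Build _ _ _ lebesgue_step
  step0 step_ge0 step_sigma_additive.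

Let step_sigma_finite : sigma_finite setT lebesgue_step.
Proof.
have /sigma_finiteP[F [FT ndF Foo]] := sigma_finiteT (@lebesgue_measure R).
have /sigma_finiteP[G [GT ndG Goo]] := sigma_finiteT mu.
pose tl (t : n.+1.-tuple R) : n.-tuple R := [tuple of behead t].
have tconsK (A : set (measurableTypeR R)) (B : set (n.-tuple R)) :
    tcons @^-1` ((@thead n R) @^-1` A `&` tl @^-1` B)
    = A `*` B.
  apply/seteqP; split=> -[x t] /= [Ax Bt]; split=> //; move: Bt;
    by congr (B _); exact/val_inj.
exists (fun k => (@thead n R) @^-1` F k `&`
    tl @^-1` G k).
  apply/seteqP; split=> // t _.
  have : setT (thead t : measurableTypeR R) by [].
  have : setT (tl t) by [].
  rewrite {1}GT {1}FT => -[j _ Gj] [i _ Fi]; exists (maxn i j) => //; split.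
  - by have /subsetPset := ndF _ _ (leq_maxl i j); apply.
  - by have /subsetPset := ndG _ _ (leq_maxr i j); apply.
move=> k; have [mF Fk] := Foo k; have [mG Gk] := Goo k; split.
  apply: measurableI; rewrite -[X in measurable X]setTI.
  - exact: (@measurable_tnth _ R).
  - exact: measurable_behead.
rewrite /lebesgue_step /pushforward tconsK product_measure1E//.
by rewrite lte_mul_pinfty// ge0_fin_numE.
Qed.

HB.instance Definition _ := Measure_isSigmaFinite.Build _ _ _ lebesgue_step
  step_sigma_finite.

End step.

(* Iterated product of Borel-Lebesgue measures; lebesgue_tupleX below gives the
   volume of boxes, which determines it. *)
Fixpoint lebesgue_tuple (n : nat) :
    {sigma_finite_measure set (n.-tuple R) -> \bar R} :=
  if n is m.+1 then lebesgue_step (lebesgue_tuple m) else \d_[tuple].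

End lebesgue_tuple.

Lemma lebesgue_tupleX (R : realType) (n : nat) (A : 'I_n -> set R) :
  (forall i, measurable (A i)) ->
  lebesgue_tuple n [set t | forall i, A i (tnth t i)] =
  (\prod_(i < n) lebesgue_measure (A i : set (measurableTypeR R)))%E.
Proof.
elim: n A => [|n IHn] A mA.
  by rewrite big_ord0 /= diracE mem_set// => -[].
rewrite big_ord_recl -(IHn (fun i => A (lift ord0 i)))//= /lebesgue_step.
rewrite /pushforward.
pose B := [set t : n.-tuple R | forall i, A (lift ord0 i) (tnth t i)].
have mB : measurable B.
  rewrite (_ : B = \bigcap_(i in [set: 'I_n])
      ((fun t : n.-tuple R => tnth t i) @^-1` A (lift ord0 i))); last first.
    by apply/seteqP; split=> [t Bt i _|t Bt i]; [exact: Bt|exact: Bt].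
  apply: fin_bigcap_measurable; first exact: finite_finset.
  move=> i _; rewrite -[X in measurable X]setTI; exact: (@measurable_tnth _ R).
transitivity ((@lebesgue_measure R \x lebesgue_tuple n)%E ((A ord0 : set (measurableTypeR R)) `*` B)); last first.
  by rewrite product_measure1E//; exact: (mA ord0).
congr (product_measure1 _ _ _).
apply/seteqP; split=> -[x t] /= => [At|[At Bt] i].
  by split=> [|i]; [exact: (At ord0)|have := At (lift ord0 i); rewrite tnthS].
by case: (unliftP ord0 i) => [j ->|-> //]; rewrite tnthS; exact: Bt.
Qed.

Section vectors.
Context {R : realType}.

Definition vle n (x y : 'cV[R]_n) := forall i, x i 0 <= y i 0.
Definition vlt n (x y : 'cV[R]_n) := forall i, x i 0 < y i 0.

Definition dot n (x y : 'cV[R]_n) : R := \sum_i x i 0 * y i 0.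

Definition col_of_tuple n (x : n.-tuple R) : 'cV[R]_n := \col_i tnth x i.

(* The positions in F are numbered increasingly by enum_val : 'I_#|F| -> 'I_d. *)
Definition subv d (F : {set 'I_d}) (x : 'cV[R]_d) : 'cV[R]_#|F| :=
  \col_k x (enum_val k) 0.

Definition submatrix d (F1 F2 : {set 'I_d}) (M : 'M[R]_d) : 'M[R]_(#|F1|, #|F2|) :=
  \matrix_(k, l) M (enum_val k) (enum_val l).

Definition qp_minimizer d (Sigma : 'M[R]_d) (a atil : 'cV[R]_d) :=
  let q (x : 'cV[R]_d) := (x^T *m invmx Sigma *m x) 0 0 in
  vle a atil /\ forall x, vle a x -> q atil <= q x.

Definition qp_index d (Sigma : 'M[R]_d) (a atil : 'cV[R]_d) (I : {set 'I_d}) :=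
  let v := invmx (submatrix I I Sigma) *m subv I a in
  [/\ I != finset.set0,
      subv I atil = subv I a,
      vlt 0 v &
      ~: I != finset.set0 ->
        subv (~: I) atil = submatrix (~: I) I Sigma *m v /\
        vle (subv (~: I) a) (subv (~: I) atil)].

End vectors.

Section independence.
Context {dsp : measure_display} {Omega : measurableType dsp} {R : realType}.
Variable P : probability Omega R.

Definition sigma_generated J d (T : measurableType d) (D : set J)
    (X : J -> Omega -> T) : set (set Omega) :=
  <<s \bigcup_(j in D) preimage_set_system [set: Omega] (X j) measurable >>.

Definition mutually_independent n (F : 'I_n -> set (set Omega)) :=
  forall (S : {set 'I_n}) (E : 'I_n -> set Omega),
    (forall i, F i (E i)) ->
    P (\bigcap_(i in [set` S]) E i) = (\prod_(i in S) P (E i))%E.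

Definition independent (F G : set (set Omega)) :=
  forall E E', F E -> G E' -> P (E `&` E') = (P E * P E')%E.

End independence.

Section brownian.
Context {dsp : measure_display} {Omega : measurableType dsp} {R : realType}.
Variable P : probability Omega R.

(* The time set is [0, +oo[ : the values X t for t < 0 are unconstrained.
   Since normal_prob is parameterized by the standard deviation, the variance
   of X t - X s is t - s. All paths are continuous, not just almost all of
   them, so that events such as "X t > x for some t" are measurable. *)
Definition brownian_motion (X : R -> {RV P >-> R}) :=
  [/\ {ae P, forall w, X 0 w = 0},
      forall (n : nat) (t : nat -> R), 0 <= t 0%N ->
        (forall k, t k <= t k.+1) ->
        mutually_independent P (fun k : 'I_n =>
          preimage_set_system [set: Omega]
            (fun w => X (t k.+1) w - X (t k) w) (measurable : set (set R))),
      forall s t, 0 <= s -> s < t -> forall U : set R, measurable U ->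
        P ((fun w => X t w - X s w) @^-1` U) =
        normal_prob 0 (Num.sqrt (t - s)) U &
      forall w, {within `[0, +oo[, continuous (fun t => X t w)}].

Definition brownian_motion_indep d (B : 'I_d -> R -> {RV P >-> R}) :=
  (forall i, brownian_motion (B i)) /\
  mutually_independent P (fun i =>
    sigma_generated [set t | 0 <= t] (fun t => B i t : Omega -> R)).

Definition independent_of_process d (eta : {RV P >-> d.-tuple R})
    (B : 'I_d -> R -> {RV P >-> R}) :=
  independent P
    (preimage_set_system [set: Omega] eta measurable)
    (sigma_generated [set p : 'I_d * R | 0 <= p.2]
       (fun p => B p.1 p.2 : Omega -> R)).

Definition linear_image d (A : 'M[R]_d) (B : 'I_d -> R -> {RV P >-> R})
    (t : R) (w : Omega) : 'cV[R]_d :=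
  A *m \col_i B i t w.

End brownian.

Definition asymp_equiv (R : realType) (f g : R -> R) :=
  f u / g u @[u --> +oo%R] --> (1 : R).

(* Main.v *)
(* Write W = A X with X a Brownian motion started at 0, and let
   H u = P (W 1 > a u + eta). With t = 1 / (1 + s / u^2), time inversion expresses
   W t, for finitely many t, through W 1 and an independent copy W' of W: the
   event W t - eta t > a u becomes u (a u + eta - W 1) < W' s - a s. For a fixed
   path of W' this says that the vector G = u (a u + eta - W 1) lies in a finite
   union of lower orthants. By the Cameron-Martin formula,
   P (G < m) / H u -> exp <lambda, m>, and by inclusion-exclusion the probability
   of a union of orthants, divided by H u, tends to the product of the lambda_i
   times the integral of exp <lambda_I, x> over the union. Fatou's lemma in W'
   turns this into the lower bound. For the upper bound, a first-passage argument
   replaces the times t close to 1 by a coarse finite grid, at the price of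
   lowering the level by delta / u, and bounds the contribution of the times with
   s > T by that of the single time s = T, which is small. On the coarse grid one
   integrates in W' by Pratt's lemma: the union bound is a majorant, and the limit
   of its integral is known by Brownian scaling. *)

Require Import Defs.
From HB Require Import structures.
From mathcomp Require Import all_boot all_order all_algebra.
From mathcomp Require Import all_classical all_reals all_analysis.
From mathcomp Require Import measurable_realfun.
From mathcomp Require Import ring lra.
Set Implicit Arguments.
Unset Strict Implicit.
Unset Printing Implicit Defensive.
Import Order.TTheory GRing.Theory Num.Theory.
Import numFieldNormedType.Exports.
Local Open Scope classical_set_scope.
Local Open Scope ring_scope.

(** * Laws of finite families *)

(** Only times with 1 - t of order 1 / u^2 matter; [inverted_time] is the chart in which they fill
    the half-line. P (G < m) / H u converges to the distribution function of an infinite measure, so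
    finite unions of orthants are used: [hit_prob] and [exp_volume] obey the same recursion, and
    coordinates outside I drop out because their multiplier vanishes. The obstacle in the upper
    bound is that the pointwise limit in W' comes without an integrable majorant uniform in u. The
    union bound is a majorant in the sense of Pratt because, for a single time, inversion can be
    read backwards: the limit of the integrals and the integral of the limit are both exp (c sum
    lambda - s q / 2), q being the minimal value of the quadratic programme. The same exponential
    makes large s negligible. I_a is finite because first passage bounds every grid probability by a
    constant times H u, and positive because the event at time 1 alone has probability H u. With
    mesh delta^4 in s and lowering delta / u, the first-passage factor is bounded below uniformly in
    u >= 1 by a quantity that tends to 1 as delta tends to 0. *)

(* Finite families indexed by J are measured on tuples of length #|J|, the
   J-indexed power of R carrying no measurable structure in the library. *)
Definition untuple {R : Type} {J : finType} (t : #|J|.-tuple R) (j : J) : R :=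
  tnth t (enum_rank j).

Section law_unique.
Context {R : realType} {J : finType}.

Lemma measurable_untuple (j : J) :
  measurable_fun [set: #|J|.-tuple R] (fun t => untuple t j).
Proof. exact: measurable_tnth. Qed.

Lemma measurable_retuple {d} {T : measurableType d} (X : J -> T -> R) :
  (forall j, measurable_fun setT (X j)) ->
  measurable_fun setT (fun w => [tuple X (enum_val i) w | i < #|J|]).
Proof.
move=> mX; apply/measurable_fun_tnthP => i.
by apply: eq_measurable_fun (mX (enum_val i)) => w _; rewrite /= tnth_mktuple.
Qed.

Lemma untuple_retuple {T : Type} (X : J -> T -> R) w :
  untuple [tuple X (enum_val i) w | i < #|J|] = X^~ w.
Proof. by apply/funext => j; rewrite /untuple tnth_mktuple enum_rankK. Qed.

Lemma measurable_tuple_rect (U : 'I_#|J| -> set R) :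
  (forall i, measurable (U i)) ->
  measurable [set t : #|J|.-tuple R | forall i, U i (tnth t i)].
Proof.
move=> mU; rewrite (_ : mkset _ =
    \bigcap_(i in [set: 'I_#|J|]) ((fun t : #|J|.-tuple R => tnth t i) @^-1` U i)).
  apply: fin_bigcap_measurable => // i _.
  rewrite -[X in measurable X]setTI; exact: (@measurable_tnth _ R).
by apply/seteqP; split=> t Bt i; [move=> _|]; exact: Bt.
Qed.

Context {d1 d2 : measure_display} {T1 : measurableType d1} {T2 : measurableType d2}.
Variables (P1 : probability T1 R) (P2 : probability T2 R).
Variables (X1 : J -> T1 -> R) (X2 : J -> T2 -> R).
Hypotheses (mX1 : forall j, measurable_fun setT (X1 j))
  (mX2 : forall j, measurable_fun setT (X2 j)).
Hypothesis rect : forall U : J -> set R, (forall j, measurable (U j)) ->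
  P1 [set w | forall j, U j (X1 j w)] = P2 [set w | forall j, U j (X2 j w)].

Let Y1 w := [tuple X1 (enum_val i) w | i < #|J|].
Let Y2 w := [tuple X2 (enum_val i) w | i < #|J|].
Let mY1 : measurable_fun setT Y1. Proof. exact: measurable_retuple. Qed.
Let mY2 : measurable_fun setT Y2. Proof. exact: measurable_retuple. Qed.

(** Rectangles form a pi-system that generates the sigma-algebra of tuples, so the equality [rect]
    extends to all measurable sets by uniqueness of measures. *)
Let push_eq A : measurable A ->
  pushforward P1 Y1 A = pushforward P2 Y2 A.
Proof.
move=> mA.
pose G : set (set (#|J|.-tuple R)) := [set A | exists2 U : 'I_#|J| -> set R,
   (forall i, measurable (U i)) & A = [set t | forall i, U i (tnth t i)]].
apply: (measure_unique G (fun _ => setT)) => //.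
- apply/seteqP; split; apply: smallest_sub.
  + exact: smallest_sigma_algebra.
  + move=> C /=; rewrite -bigcup_seq => -[i _ [B mB <-]]; rewrite setTI.
    apply: sub_sigma_algebra; exists (fun k => if k == i then B else setT).
      by move=> k; case: ifP.
    apply/seteqP; split=> [t Bt k|t /(_ i)]; last by rewrite eqxx.
    by case: eqP => // ->.
  + exact: sigma_algebra_measurable.
  + by move=> _ [U mU ->]; exact: measurable_tuple_rect.
- move=> _ _ [U mU ->] [V mV ->]; exists (fun i => U i `&` V i).
    by move=> i; exact: measurableI.
  apply/seteqP; split=> [t [Ut Vt] i|t UVt]; first by split.
  by split=> i; have [] := UVt i.
- by move=> _; exists (fun _ => setT) => //; apply/seteqP; split.
- by rewrite bigcup_const//; exists 0%N.
- move=> _ [U mU ->]; rewrite /pushforward.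
  have E (T : Type) (X : J -> T -> R) (Y := fun w => [tuple X (enum_val i) w | i < #|J|]) :
      Y @^-1` [set t | forall i, U i (tnth t i)] =
      [set w | forall j, U (enum_rank j) (X j w)].
    apply/seteqP; split=> w /= Uw k.
      by have := Uw (enum_rank k); rewrite tnth_mktuple enum_rankK.
    by rewrite tnth_mktuple -{1}[k]enum_valK; exact: Uw.
  transitivity (P1 [set w | forall j, U (enum_rank j) (X1 j w)]).
    by rewrite -(E T1 X1).
  by rewrite (@rect (fun j => U (enum_rank j)))// -(E T2 X2).
- move=> _ ; rewrite /= /pushforward preimage_setT.
  by rewrite probability_setT ltry.
Qed.

Lemma law_unique (f : (J -> R) -> \bar R) :
  measurable_fun setT (fun t : #|J|.-tuple R => f (untuple t)) ->
  (forall x, (0 <= f x)%E) ->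
  (\int[P1]_w f (X1^~ w) = \int[P2]_w f (X2^~ w))%E.
Proof.
move=> mf f0.
have := @ge0_integral_pushforward _ _ _ _ _ Y1 mY1 P1 setT _ measurableT mf
  (fun y _ => f0 _).
have := @ge0_integral_pushforward _ _ _ _ _ Y2 mY2 P2 setT _ measurableT mf
  (fun y _ => f0 _).
rewrite !preimage_setT.
under eq_integral do rewrite /= untuple_retuple.
move=> <-; under eq_integral do rewrite /= untuple_retuple.
move=> <-; apply: eq_measure_integral => A mA _; exact: push_eq.
Qed.

Lemma law_unique_set (S : (J -> R) -> Prop) :
  measurable [set t : #|J|.-tuple R | S (untuple t)] ->
  P1 [set w | S (X1^~ w)] = P2 [set w | S (X2^~ w)].
Proof.
move=> mS; have H := @push_eq _ mS; rewrite /pushforward in H.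
have E (T : Type) (X : J -> T -> R) (Y := fun w => [tuple X (enum_val i) w | i < #|J|]) :
   Y @^-1` [set t | S (untuple t)] = [set w | S (X^~ w)].
  by apply/seteqP; split=> w /=; rewrite untuple_retuple.
transitivity (P1 (Y1 @^-1` [set t | S (untuple t)])); first by rewrite E.
by rewrite H -(E T2 X2).
Qed.

End law_unique.

(** * Affine changes of variables and the normal law *)

Section lebesgue_affine.
Context {R : realType}.
Local Notation mu := (@lebesgue_measure R).

(** The scaled pushforward agrees with Lebesgue measure on half-open intervals, which determine
    it. *)
Lemma lebesgue_measure_affine (c b : R) (A : set R) : 0 < c -> measurable A ->
  (c%:E * mu ((fun x => c * x + b)%R @^-1` A) = mu A)%E.
Proof.
move=> c0 mA; pose phi (x : R) : measurableTypeR R := c * x + b.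
have mphi : measurable_fun setT phi by apply: measurable_funD => //.
pose cn : {nonneg R} := NngNum (ltW c0).
pose nu : {measure set (measurableTypeR R) -> \bar R} :=
  measure_function_pushforward__canonical__measure_function_Measure mu mphi.
transitivity (mscale cn nu A); first by [].
apply/esym/lebesgue_measure_unique => //= _ [[x y]] _ <-.
rewrite /mscale /= /pushforward.
rewrite (_ : _ @^-1` _ = `](x - b) / c, (y - b) / c]%classic); last first.
  apply/seteqP; split => z /=; rewrite !in_itv/= /phi;
  by rewrite ltr_pdivrMr// ler_pdivlMr// ltrBlDr lerBrDr mulrC.
rewrite !lebesgue_measure_itv/= !lte_fin ltr_pM2r ?invr_gt0// ltrD2r.
case: ifP => _; last by rewrite mule0.
rewrite -!EFinD -EFinM; congr EFin; field; exact: lt0r_neq0.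
Qed.

Lemma ge0_integral_affine (c b : R) (f : R -> \bar R) : 0 < c ->
  measurable_fun setT f -> (forall x, (0 <= f x)%E) ->
  (\int[mu]_x f x = c%:E * \int[mu]_x f (c * x + b)%R)%E.
Proof.
move=> c0 mf f0; pose phi (x : R) : measurableTypeR R := c * x + b.
have mphi : measurable_fun setT phi by apply: measurable_funD => //.
pose cn : {nonneg R} := NngNum (ltW c0).
pose nu : {measure set (measurableTypeR R) -> \bar R} :=
  measure_function_pushforward__canonical__measure_function_Measure mu mphi.
have := @ge0_integral_pushforward _ _ (measurableTypeR R) (measurableTypeR R) R
  phi mphi mu setT f measurableT mf
  (fun y _ => f0 y).
rewrite preimage_setT => <-.
rewrite -(@ge0_integral_mscale _ _ _ nu setT measurableT
  cn f mf (fun x _ => f0 x)).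
apply: eq_measure_integral => A mA _.
by rewrite /= /mscale/= /pushforward lebesgue_measure_affine.
Qed.

Lemma ge0_integral_shift (b : R) (f : R -> \bar R) :
  measurable_fun setT f -> (forall x, (0 <= f x)%E) ->
  (\int[mu]_x f x = \int[mu]_x f (x + b)%R)%E.
Proof.
move=> mf f0; rewrite (@ge0_integral_affine 1 b)// mul1e.
by apply: eq_integral => x _; rewrite mul1r.
Qed.

(** The Radon-Nikodym derivative of the normal law equals [normal_pdf] almost everywhere, because
    both have the same integrals over measurable sets. *)
Lemma ge0_integral_normal (s : R) (f : R -> \bar R) :
  measurable_fun setT f -> (forall x, (0 <= f x)%E) ->
  (\int[normal_prob 0 s]_x f x = \int[mu]_x (f x * (normal_pdf 0 s x)%:E))%E.
Proof.
move=> mf f0.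
rewrite -(Radon_Nikodym_SigmaFinite.change_of_variables
  (@normal_prob_dominates R 0 s))//.
have fint := Radon_Nikodym_SigmaFinite.f_integrable
  (@normal_prob_dominates R 0 s).
apply: ge0_ae_eq_integral => //.
- apply: emeasurable_funM => //; exact: measurable_int fint.
- apply: emeasurable_funM => //; apply/measurable_EFinP.
  exact: measurable_normal_pdf.
- move=> x _; apply: mule_ge0 => //; apply: Radon_Nikodym_SigmaFinite.f_ge0.
  exact: normal_prob_dominates.
- by move=> x _; rewrite mule_ge0// lee_fin normal_pdf_ge0.
- apply: ae_eqe_mul2l; apply: integral_ae_eq => //.
  + by apply/measurable_EFinP; exact: measurable_normal_pdf.
  + move=> E ET mE; rewrite -Radon_Nikodym_SigmaFinite.f_integral//.
    exact: normal_prob_dominates.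
Qed.

Lemma normal_prob_scale (c s : R) (U : set R) : 0 < c -> 0 < s -> measurable U ->
  normal_prob 0 (c * s) U = normal_prob 0 s ((fun x => c * x) @^-1` U).
Proof.
move=> c0 s0 mU; rewrite /normal_prob.
have mU' : measurable ((fun x : R => c * x) @^-1` U).
  rewrite -[X in measurable X]setTI.
  have: measurable_fun setT (fun x : R => c * x) by exact: mulrl_measurable.
  exact.
rewrite [LHS]integral_mkcond [RHS]integral_mkcond.
rewrite (@ge0_integral_affine c 0)//; last 2 first.
- apply/(measurable_restrictT _ _).1 => //.
  apply: measurable_funTS; apply/measurable_EFinP; exact: measurable_normal_pdf.
- by move=> x; rewrite erestrict_ge0// => y _; rewrite lee_fin normal_pdf_ge0.
rewrite -ge0_integralZl//=; last 3 first.
- apply: (measurableT_comp (f := (fun x => (normal_pdf 0 (c * s) x)%:E) \_ U)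
    (g := fun x => c * x + 0)).
    apply/(measurable_restrictT _ _).1 => //.
    apply: measurable_funTS; apply/measurable_EFinP; exact: measurable_normal_pdf.
  by apply: measurable_funD => //; exact: mulrl_measurable.
- by move=> x _; rewrite erestrict_ge0// => y _; rewrite lee_fin normal_pdf_ge0.
- by rewrite lee_fin ltW.
apply: eq_integral => x _; rewrite addr0 /patch.
rewrite (_ : (x \in _ @^-1` _) = (c * x \in U)); last by apply/idP/idP; rewrite !inE.
case: ifP => _; last by rewrite mule0.
rewrite -EFinM; congr EFin.
rewrite !normal_pdfE ?mulf_neq0 ?gt_eqF// /normal_peak /normal_fun.
rewrite !subr0 mulrA; congr (_ * expR _).
- rewrite exprMn -mulrA -mulrnAr sqrtrM ?sqr_ge0// sqrtr_sqr gtr0_norm//.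
  by rewrite invfM mulrA divff ?gt_eqF// mul1r mulrnAr.
- rewrite !exprMn -mulrnAr; field.
  by rewrite ?gt_eqF// mulrn_wgt0// exprn_gt0.
Qed.

End lebesgue_affine.

Section normal_rotation.
Context {R : realType}.
Local Notation mu := (@lebesgue_measure R).

Lemma normal_pdf_sqrt (v x : R) : 0 < v ->
  normal_pdf 0 (Num.sqrt v) x =
  (Num.sqrt (v * (pi *+ 2)))^-1 * expR (- x ^+ 2 / (v *+ 2)).
Proof.
move=> v0; rewrite normal_pdfE ?gt_eqF ?sqrtr_gt0//.
by rewrite /normal_peak /normal_fun subr0 sqr_sqrtr ?ltW// -mulrnAr.
Qed.

(** Two factorizations of the joint density of a Brownian motion at times s < t, with y the value at
    s and z the increment: on the right by independent increments, on the left by the value at t and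
    the bridge, whose mean is s / t times that value and whose variance is s (t - s) / t. *)
Lemma normal_pdf_rotation (s t y z : R) : 0 < s -> s < t ->
  normal_pdf 0 (Num.sqrt (s * (t - s) / t)) (y - s / t * (z + y)) *
  normal_pdf 0 (Num.sqrt t) (z + y) =
  normal_pdf 0 (Num.sqrt s) y * normal_pdf 0 (Num.sqrt (t - s)) z.
Proof.
move=> s0 st; have t0 : 0 < t by exact: lt_trans st.
have ts0 : 0 < t - s by rewrite subr_gt0.
have pi2 : 0 < pi *+ 2 :> R by rewrite mulrn_wgt0// pi_gt0.
rewrite !normal_pdf_sqrt//; last by rewrite divr_gt0// mulr_gt0.
rewrite mulrACA [RHS]mulrACA -!invfM -!expRD -!sqrtrM; last 2 first.
- by rewrite mulr_ge0// ltW.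
- by rewrite mulr_ge0// ltW// divr_gt0// mulr_gt0.
congr ((Num.sqrt _)^-1 * expR _); field.
  by rewrite gt_eqF.
by rewrite !gt_eqF.
Qed.

(** The change of variables is a product of two shears. Each is a one-dimensional translation, with
    Tonelli between them, so no Jacobian appears. *)
Lemma integral_normal_rotation (s t : R) (f : R * R -> \bar R) :
  0 < s -> s < t -> measurable_fun setT f -> (forall x, 0 <= f x)%E ->
  (\int[normal_prob 0 (Num.sqrt t)]_x
     \int[normal_prob 0 (Num.sqrt (s * (t - s) / t))]_y
       f (s / t * x + y, x - (s / t * x + y))%R =
   \int[normal_prob 0 (Num.sqrt s)]_x
     \int[normal_prob 0 (Num.sqrt (t - s))]_y f (x, y))%E.
Proof.
move=> s0 st mf f0.
have pdf0 (v x : R) : (0 <= (normal_pdf 0 v x)%:E)%E.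
  by rewrite lee_fin normal_pdf_ge0.
have mpdf v : measurable_fun setT (EFin \o normal_pdf 0 v : R -> \bar R).
  by apply/measurable_EFinP; exact: measurable_normal_pdf.
pose phi1 (p : R * R) : R * R := (s / t * p.1 + p.2, p.1 - (s / t * p.1 + p.2)).
have mlin : measurable_fun setT (fun p : R * R => s / t * p.1 + p.2).
  by apply: measurable_funD => //; apply: measurable_funM.
have mphi1 : measurable_fun setT phi1.
  by apply/measurable_fun_pairP; split => //=; exact: measurable_funB.
have mf1 : measurable_fun setT (f \o phi1) by exact: measurableT_comp.
pose F x := (\int[normal_prob 0 (Num.sqrt (s * (t - s) / t))]_y
  (f \o phi1) (x, y))%E.
have mF : measurable_fun setT F.
  by apply: measurable_fun_fubini_tonelli_F => // x; exact: f0.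
have F0 x : (0 <= F x)%E by apply: integral_ge0 => y _; exact: f0.
rewrite -[LHS]/(\int[normal_prob 0 (Num.sqrt t)]_x F x)%E.
rewrite [LHS](ge0_integral_normal (Num.sqrt t) mF F0).
pose h (p : R * R) := (f (p.2, p.1 - p.2)%R *
  (normal_pdf 0 (Num.sqrt (s * (t - s) / t)) (p.2 - s / t * p.1))%:E *
  (normal_pdf 0 (Num.sqrt t) p.1)%:E)%E.
have mh : measurable_fun setT h.
  apply: emeasurable_funM; [apply: emeasurable_funM|].
  - apply: (measurableT_comp mf); apply: measurable_fun_pair => //.
    exact: measurable_funB.
  - apply: (measurableT_comp (mpdf _)); apply: measurable_funB => //.
    exact: measurable_funM.
  - by apply: (measurableT_comp (mpdf _)).
have h0 p : (0 <= h p)%E.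
  by rewrite /h !mule_ge0// lee_fin normal_pdf_ge0.
transitivity (\int[mu]_x \int[mu]_y h (x, y))%E.
  apply: eq_integral => x _.
  have mf1x : measurable_fun setT (fun y => (f \o phi1) (x, y)).
    by apply: (measurableT_comp mf1); exact: measurable_fun_pair.
  rewrite /F (ge0_integral_normal _ mf1x (fun y => f0 _)).
  rewrite (@ge0_integral_shift _ (- (s / t * x))); last 2 first.
  - apply: emeasurable_funM mf1x _; exact: mpdf.
  - by move=> y; apply: mule_ge0; [exact: f0|exact: pdf0].
  rewrite -ge0_integralZr; last 4 first.
  - exact: measurableT.
  - apply: emeasurable_funM.
      apply: (measurableT_comp mf1x); exact: measurable_funD.
    apply: (measurableT_comp (mpdf _)); exact: measurable_funD.
  - by move=> y _; apply: mule_ge0; [exact: f0|exact: pdf0].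
  - exact: pdf0.
  apply: eq_integral => y _; rewrite /h /phi1 /=.
  by rewrite [(_ + (y - _))%R]addrC subrK.
rewrite [LHS](@fubini_tonelli _ _ (measurableTypeR R) (measurableTypeR R) R
  mu mu h mh h0).
pose G y := (\int[normal_prob 0 (Num.sqrt (t - s))]_z f (y, z))%E.
have mG : measurable_fun setT G by exact: measurable_fun_fubini_tonelli_F.
have G0 x : (0 <= G x)%E by apply: integral_ge0 => y _; exact: f0.
rewrite -[RHS]/(\int[normal_prob 0 (Num.sqrt s)]_x G x)%E.
rewrite [RHS](ge0_integral_normal (Num.sqrt s) mG G0).
apply: eq_integral => y _.
rewrite (@ge0_integral_shift _ y)//; last first.
  by apply: (measurableT_comp mh); exact: measurable_fun_pair.
have mfy : measurable_fun setT (fun z => f (y, z)).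
  by apply: (measurableT_comp mf); exact: measurable_fun_pair.
rewrite /G (ge0_integral_normal _ mfy (fun z => f0 _)).
rewrite -ge0_integralZr; last 4 first.
- exact: measurableT.
- apply: emeasurable_funM mfy _; exact: mpdf.
- by move=> z _; apply: mule_ge0; [exact: f0|exact: pdf0].
- exact: pdf0.
apply: eq_integral => z _; rewrite /h /= addrK -!muleA -!EFinM.
by rewrite normal_pdf_rotation// mulrC.
Qed.

Lemma product_measure_map {d1 d2 d3 d4} {T1 : measurableType d1}
    {T2 : measurableType d2} {T3 : measurableType d3} {T4 : measurableType d4}
    (P1 : probability T1 R) (P2 : probability T2 R) (Q1 : probability T3 R)
    (Q2 : probability T4 R) (phi : T1 * T2 -> T3 * T4) :
  measurable_fun setT phi ->
  (forall f : T3 * T4 -> \bar R, measurable_fun setT f -> (forall x, 0 <= f x)%E ->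
    (\int[P1]_x \int[P2]_y f (phi (x, y)) = \int[Q1]_x \int[Q2]_y f (x, y))%E) ->
  forall U V, measurable U -> measurable V ->
  (P1 \x P2)%E (phi @^-1` (U `*` V)) = (Q1 U * Q2 V)%E.
Proof.
move=> mphi H U V mU mV.
have mUV : measurable (U `*` V) by exact: measurableX.
have mS : measurable (phi @^-1` (U `*` V)).
  by rewrite -[X in measurable X]setTI; exact: mphi.
have m1 : measurable_fun setT (EFin \o \1_(U `*` V) : T3 * T4 -> \bar R).
  by apply/measurable_EFinP; exact: measurable_indic.
have m2 : measurable_fun setT (EFin \o \1_(phi @^-1` (U `*` V)) : T1 * T2 -> \bar R).
  by apply/measurable_EFinP; exact: measurable_indic.
rewrite -product_measure1E// -[RHS]/((Q1 \x Q2)%E (U `*` V)).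
transitivity (\int[P1 \x P2]_p (\1_(phi @^-1` (U `*` V)) p)%:E)%E.
  by rewrite integral_indic// setIT.
transitivity (\int[Q1 \x Q2]_p (\1_(U `*` V) p)%:E)%E; last first.
  by rewrite integral_indic// setIT.
have i0 T (A : set T) x : (0 <= (EFin \o \1_A : T -> \bar R) x)%E.
  by rewrite /= lee_fin.
rewrite [RHS](fubini_tonelli1 (EFin \o \1_(U `*` V)) m1 (i0 _ _)).
rewrite [LHS](fubini_tonelli1 (EFin \o \1_(phi @^-1` (U `*` V))) m2 (i0 _ _)).
exact: (H _ m1 (i0 _ _)).
Qed.

(* With p ~ N(0, t) the value of a Brownian motion at time t, s / t * p + q is its
   value at time s once q is an independent bridge increment: this is the
   elementary step of time inversion. *)
Lemma normal_prob_rotation (s t : R) (U V : set R) :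
  0 < s -> s < t -> measurable U -> measurable V ->
  (normal_prob 0 (Num.sqrt t) \x normal_prob 0 (Num.sqrt (s * (t - s) / t)))%E
    [set p | U (s / t * p.1 + p.2) /\ V (p.1 - (s / t * p.1 + p.2))] =
  (normal_prob 0 (Num.sqrt s) U * normal_prob 0 (Num.sqrt (t - s)) V)%E.
Proof.
move=> s0 st mU mV.
pose phi (p : R * R) : R * R := (s / t * p.1 + p.2, p.1 - (s / t * p.1 + p.2)).
have mlin : measurable_fun setT (fun p : R * R => s / t * p.1 + p.2).
  by apply: measurable_funD => //; apply: measurable_funM.
have mphi : measurable_fun setT phi.
  by apply: measurable_fun_pair => //=; exact: measurable_funB.
pose TR := measurableTypeR R.
exact: (@product_measure_map _ _ _ _ TR TR TR TR (normal_prob 0 (Num.sqrt t))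
  (normal_prob 0 (Num.sqrt (s * (t - s) / t))) (normal_prob 0 (Num.sqrt s))
  (normal_prob 0 (Num.sqrt (t - s))) phi mphi
  (fun f mf f0 => integral_normal_rotation s0 st mf f0) U V mU mV).
Qed.

(** One-dimensional Cameron-Martin formula: translate Lebesgue measure by [c] and compare the normal
    densities at x + c and x. *)
Lemma integral_normal_shift (c : R) (f : R -> \bar R) :
  measurable_fun setT f -> (forall x, 0 <= f x)%E ->
  (\int[normal_prob 0 1]_x f x =
   \int[normal_prob 0 1]_x (f (x + c)%R * (expR (- c * x - c ^+ 2 / 2))%:E))%E.
Proof.
move=> mf f0.
have mpdf : measurable_fun setT (EFin \o normal_pdf 0 1 : R -> \bar R).
  by apply/measurable_EFinP; exact: measurable_normal_pdf.
have mfc : measurable_fun setT (fun x : R => f (x + c)).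
  by apply: (measurableT_comp mf); exact: measurable_funD.
have mg : measurable_fun setT
    (fun x : R => f (x + c)%R * (expR (- c * x - c ^+ 2 / 2))%:E)%E.
  apply: emeasurable_funM => //; apply/measurable_EFinP.
  apply: measurableT_comp => //; apply: measurable_funB => //.
have g0 (x : R) : (0 <= f (x + c)%R * (expR (- c * x - c ^+ 2 / 2))%:E)%E.
  by rewrite mule_ge0// lee_fin expR_ge0.
rewrite [LHS](ge0_integral_normal _ mf f0) [RHS](ge0_integral_normal _ mg g0).
rewrite [LHS](@ge0_integral_shift _ c); last 2 first.
- exact: emeasurable_funM.
- by move=> x; rewrite mule_ge0// lee_fin normal_pdf_ge0.
apply: eq_integral => x _; rewrite -muleA -EFinM; congr (_ * _%:E)%E.
rewrite !normal_pdfE ?oner_eq0// /normal_fun !subr0 mulrCA -expRD.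
by congr (_ * expR _); field.
Qed.

End normal_rotation.

(** * Independent normal families *)

Section indep_normal.
Context {d} {T : measurableType d} {R : realType} (P : probability T R).

(** If [P E] is positive, the conditional law of (X, Y) given [E] agrees with the product law on
    rectangles, hence everywhere; if [P E = 0] both sides vanish. *)
Lemma indep_pair {d1 d2} {T1 : measurableType d1} {T2 : measurableType d2}
    (N1 : probability T1 R) (N2 : probability T2 R) (E : set T)
    (X : T -> T1) (Y : T -> T2) :
  measurable E -> measurable_fun setT X -> measurable_fun setT Y ->
  (forall C1 C2, measurable C1 -> measurable C2 ->
    P (E `&` [set w | C1 (X w) /\ C2 (Y w)]) = (P E * (N1 C1 * N2 C2))%E) ->
  forall C, measurable C ->
  P (E `&` [set w | C (X w, Y w)]) = (P E * (N1 \x N2)%E C)%E.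
Proof.
move=> mE mX mY H C mC.
have mXY : measurable_fun setT (fun w => (X w, Y w)) by exact: measurable_fun_pair.
have mpre D : measurable D -> measurable [set w | D (X w, Y w)].
  by move=> mD; rewrite -[X in measurable X]setTI; exact: mXY.
have [PE0|PE0] := eqVneq (P E) 0%E.
  rewrite PE0 mul0e; apply/eqP; rewrite eq_le measure_ge0 andbT -PE0.
  by apply: le_measure; rewrite ?inE//; apply: measurableI => //; exact: mpre.
have PEf : P E \is a fin_num by exact: fin_num_measure.
have PEg : (0 < fine (P E))%R.
  by apply: fine_gt0; rewrite lt0e PE0 measure_ge0/= -ge0_fin_numE.
have PEi : (0 <= (fine (P E))^-1)%R by rewrite invr_ge0 ltW.
pose nu : {measure set (T1 * T2) -> \bar R} :=
  measure_function_pushforward__canonical__measure_function_Measure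
    (mrestr P mE) mXY.
have nuE D : nu D = P (E `&` [set w | D (X w, Y w)]) by rewrite /nu /= /pushforward /mrestr setIC.
rewrite (@product_measure_unique _ _ _ _ _ N1 N2
  (mscale (NngNum PEi) nu))//.
  rewrite /= /mscale/= -[pushforward _ _ _]/(nu C) nuE.
  rewrite muleA -[X in (X * _ * _)%E]fineK// -EFinM divff ?gt_eqF//.
  by rewrite mul1e.
move=> C1 C2 mC1 mC2; rewrite /= /mscale/= -[pushforward _ _ _]/(nu (C1 `*` C2)) nuE.
have -> : P (E `&` [set w | (C1 `*` C2) (X w, Y w)]) = (P E * (N1 C1 * N2 C2))%E.
  exact: H.
rewrite muleA -[X in (_ * X * _)%E]fineK// -EFinM mulVf ?gt_eqF//.
by rewrite mul1e.
Qed.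

(** Here [s j] is a standard deviation. The event [E] is carried along so that independence of the
    drift survives every transformation of the family: later statements let [E] range over the
    rectangles in the drift. *)
Definition indep_normal {J : finType} (E : set T) (X : J -> T -> R) (s : J -> R) :=
  forall U : J -> set R, (forall j, measurable (U j)) ->
  P (E `&` [set w | forall j, U j (X j w)]) =
  (P E * \prod_j normal_prob 0 (s j) (U j))%E.

Lemma measurable_forall {J : finType} (X : J -> T -> R) (U : J -> set R) :
  (forall j, measurable_fun setT (X j)) -> (forall j, measurable (U j)) ->
  measurable [set w | forall j, U j (X j w)].
Proof.
move=> mX mU; rewrite (_ : mkset _ = \bigcap_(j in [set: J]) (X j @^-1` U j)).
  apply: fin_bigcap_measurable => // j _.
  by rewrite -[X in measurable X]setTI; exact: mX.
by apply/seteqP; split=> w Uw j; [move=> _|]; exact: Uw.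
Qed.

Lemma eq_indep_normal {J : finType} (E : set T) (X X' : J -> T -> R)
    (s s' : J -> R) : X =2 X' -> s =1 s' ->
  indep_normal E X s -> indep_normal E X' s'.
Proof.
move=> XX' ss'; have -> : X' = X by apply/funext => j; apply/funext => w.
by have -> : s' = s by exact/funext.
Qed.

(** Only the coordinates [p] and [q] change. The constraints on all other coordinates are absorbed
    into the event [E'], so that [indep_pair] reduces the claim to the planar identity
    [normal_prob_rotation]. *)
Lemma indep_normal_rotation {J : finType} (E : set T) (X X' : J -> T -> R)
    (sd sd' : J -> R) (p q : J) (s t : R) :
  0 < s -> s < t -> p != q -> measurable E ->
  (forall j, measurable_fun setT (X j)) ->
  sd p = Num.sqrt t -> sd q = Num.sqrt (s * (t - s) / t) ->
  sd' q = Num.sqrt s -> sd' p = Num.sqrt (t - s) ->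
  X' q = (fun w => s / t * X p w + X q w) ->
  X' p = (fun w => X p w - (s / t * X p w + X q w)) ->
  (forall j, j != p -> j != q -> X' j = X j /\ sd' j = sd j) ->
  indep_normal E X sd -> indep_normal E X' sd'.
Proof.
move=> s0 st pq mE mX sdp sdq sdq' sdp' X'q X'p XX' indX U mU.
pose E' := E `&` [set w | forall j, (if (j == p) || (j == q) then setT else U j) (X j w)].
have mV (C1 C2 : set R) : measurable C1 -> measurable C2 -> forall j,
    measurable (if j == p then C1 else if j == q then C2 else U j).
  by move=> mC1 mC2 j; do 2 case: ifP => // _.
have mE' : measurable E'.
  apply: measurableI => //.
  apply: (@measurable_forall _ X
    (fun j => if (j == p) || (j == q) then setT else U j)) => // j.
  by case: ifP.
have prodE (s' : J -> R) (V : J -> set R) : (\prod_j normal_prob 0 (s' j) (V j) =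
    normal_prob 0 (s' p) (V p) * (normal_prob 0 (s' q) (V q) *
    \prod_(j | (j != p) && (j != q)) normal_prob 0 (s' j) (V j)))%E.
  by rewrite (bigD1 p)//= (bigD1 q)//= eq_sym.
set c := (\prod_(j | (j != p) && (j != q)) normal_prob 0 (sd j) (U j))%E.
have HC (C1 C2 : set R) : measurable C1 -> measurable C2 ->
    P (E' `&` [set w | C1 (X p w) /\ C2 (X q w)]) =
    (P E * (normal_prob 0 (sd p) C1 * (normal_prob 0 (sd q) C2 * c)))%E.
  move=> mC1 mC2.
  have := indX _ (mV _ _ mC1 mC2); rewrite prodE eqxx eq_sym (negbTE pq) eqxx.
  rewrite [X in (_ * (_ * (_ * X)))%E](_ : _ = c); last first.
    by apply: eq_bigr => j /andP[/negbTE -> /negbTE ->].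
  move=> <-; congr (P _); rewrite /E' -setIA; congr (_ `&` _).
  apply/seteqP; split=> [w /= [H [H1 H2]] j|w /= H].
    have := H j; have [->|jp]//= := eqVneq j p.
    by have [->|jq]//= := eqVneq j q.
  split=> [j|]; last first.
    by have := H p; have := H q; rewrite !eqxx eq_sym (negbTE pq).
  by have := H j; have [|] := eqVneq j p; have [|] := eqVneq j q.
have PE' : P E' = (P E * c)%E.
  have := HC setT setT measurableT measurableT.
  rewrite !probability_setT !mul1e => <-; congr (P _).
  by apply/seteqP; split=> w //= [].
have HC' (C1 C2 : set R) : measurable C1 -> measurable C2 ->
    P (E' `&` [set w | C1 (X p w) /\ C2 (X q w)]) =
    (P E' * (normal_prob 0 (sd p) C1 * normal_prob 0 (sd q) C2))%E.
  move=> mC1 mC2; rewrite HC// PE' -!muleA; congr (_ * _)%E.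
  by rewrite muleA muleC.
pose C : set (R * R) := [set z | U q (s / t * z.1 + z.2) /\
  U p (z.1 - (s / t * z.1 + z.2))].
have mC : measurable C.
  have mlin : measurable_fun setT (fun z : R * R => s / t * z.1 + z.2).
    by apply: measurable_funD => //; exact: measurable_funM.
  apply: measurableI.
    by rewrite -[X in measurable X]setTI; exact: mlin.
  have mlin2 : measurable_fun setT (fun z : R * R => z.1 - (s / t * z.1 + z.2)).
    exact: measurable_funB.
  by rewrite -[X in measurable X]setTI; exact: mlin2.
have := @indep_pair _ _ (measurableTypeR R) (measurableTypeR R)
  (normal_prob 0 (sd p)) (normal_prob 0 (sd q)) E' (X p) (X q)
  mE' (mX p) (mX q) HC' C mC.
have -> : ((normal_prob 0 (sd p) \x normal_prob 0 (sd q)) C =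
    normal_prob 0 (sd' q) (U q) * normal_prob 0 (sd' p) (U p))%E.
  by rewrite sdp sdq sdp' sdq'; exact: normal_prob_rotation.
rewrite PE' prodE.
have -> : (\prod_(j | (j != p) && (j != q)) normal_prob 0 (sd' j) (U j) = c)%E.
  by apply: eq_bigr => j /andP[jp jq]; have [_ ->] := XX' _ jp jq.
have gen (x y z v : \bar R) : (x * y * (v * z) = x * (z * (v * y)))%E.
  by rewrite -!muleA; congr (_ * _)%E; rewrite muleA [RHS]muleC [(v * y)%E]muleC.
move=> H; rewrite -[RHS]gen -[RHS]H; congr (P _).
rewrite /E' -setIA; congr (_ `&` _); apply/seteqP; split=> [w /= H'|w /= [H' H2] j].
  split=> [j|]; last first.
    by have := H' p; have := H' q; rewrite X'p X'q.
  have := H' j; have [//|jp] := eqVneq j p; have [//|jq/=] := eqVneq j q.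
  by have [-> _] := XX' _ jp jq.
have := H' j; have [->|jp] := eqVneq j p; first by rewrite X'p; case: H2.
have [->|jq/=] := eqVneq j q; first by rewrite X'q; case: H2.
by have [-> _] := XX' _ jp jq.
Qed.

End indep_normal.

Definition sumf {A B C : Type} (f : A -> C) (g : B -> C) (x : A + B) : C :=
  match x with inl a => f a | inr b => g b end.

Section indep_normal_law.
Context {R : realType} {d1 d2 : measure_display} {T1 : measurableType d1}
  {T2 : measurableType d2} (P1 : probability T1 R) (P2 : probability T2 R).
Context {J K : finType}.
Variables (e1 : J -> T1 -> R) (X1 : K -> T1 -> R).
Variables (e2 : J -> T2 -> R) (X2 : K -> T2 -> R) (sd : K -> R).

(** A rectangle over [J + K] splits into a drift rectangle and independent normal factors; the joint
    law is therefore determined by the law of the drift and by [sd]. *)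
Lemma indep_normal_law (S : (J + K -> R) -> Prop) :
  (forall j, measurable_fun setT (e1 j)) -> (forall j, measurable_fun setT (e2 j)) ->
  (forall j, measurable_fun setT (X1 j)) -> (forall j, measurable_fun setT (X2 j)) ->
  (forall E : J -> set R, (forall j, measurable (E j)) ->
    P1 [set w | forall j, E j (e1 j w)] = P2 [set w | forall j, E j (e2 j w)]) ->
  (forall E : J -> set R, (forall j, measurable (E j)) ->
    indep_normal P1 [set w | forall j, E j (e1 j w)] X1 sd) ->
  (forall E : J -> set R, (forall j, measurable (E j)) ->
    indep_normal P2 [set w | forall j, E j (e2 j w)] X2 sd) ->
  measurable [set t : #|{: J + K}|.-tuple R | S (untuple t)] ->
  P1 [set w | S (sumf (e1^~ w) (X1^~ w))] = P2 [set w | S (sumf (e2^~ w) (X2^~ w))].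
Proof.
move=> me1 me2 mX1 mX2 ee iX1 iX2 mS.
pose Y1 (x : J + K) : T1 -> R := sumf e1 X1 x.
pose Y2 (x : J + K) : T2 -> R := sumf e2 X2 x.
have -> : [set w | S (sumf (e1^~ w) (X1^~ w))] = [set w | S (Y1^~ w)].
  by apply/seteqP; split=> w /=; congr S; apply/funext => -[].
have -> : [set w | S (sumf (e2^~ w) (X2^~ w))] = [set w | S (Y2^~ w)].
  by apply/seteqP; split=> w /=; congr S; apply/funext => -[].
apply: law_unique_set => //.
- by case.
- by case.
move=> U mU.
have rectE T (f : J -> T -> R) (g : K -> T -> R) :
    [set w | forall x : J + K, U x (sumf f g x w)] =
    [set w | forall j, U (inl j) (f j w)] `&` [set w | forall k, U (inr k) (g k w)].
  apply/seteqP; split=> [w H|w [H1 H2] []//].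
  by split=> x; [have := H (inl x)|have := H (inr x)].
rewrite /Y1 /Y2 !rectE.
have mUl j : measurable (U (inl j)) by [].
have mUr j : measurable (U (inr j)) by [].
rewrite (iX1 (fun j => U (inl j)) mUl (fun k => U (inr k)) mUr).
rewrite (iX2 (fun j => U (inl j)) mUl (fun k => U (inr k)) mUr).
by rewrite (ee (fun j => U (inl j)) mUl).
Qed.

End indep_normal_law.

(** Backward telescoping, suited to times that decrease with the index: the last entry is the value
    itself, that is, the increment from time 0. *)
Lemma sum_increments {V : zmodType} (f : nat -> V) (n k : nat) : (k <= n)%N ->
  \sum_(j < n.+1 | (k <= j)%N) (if (j < n)%N then f j - f j.+1 else f j) = f k.
Proof.
move=> kn.
have H m : (k <= m)%N -> \sum_(j < m | (k <= j)%N) (f j - f j.+1) = f k - f m.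
  elim: m => [|m IH]; first by rewrite leqn0 => /eqP ->; rewrite big_ord0 subrr.
  rewrite leq_eqVlt => /predU1P[<-|].
    rewrite subrr big1// => j; rewrite leqNgt ltn_ord//.
  rewrite ltnS => km; rewrite big_mkcond big_ord_recr -big_mkcond/= km IH//.
  by rewrite addrA subrK.
rewrite big_mkcond big_ord_recr -big_mkcond/= kn ltnn.
rewrite (eq_bigr (fun j : 'I_n => f j - f j.+1)); last first.
  by move=> j _; rewrite ltn_ord.
by rewrite H// subrK.
Qed.

Lemma product_probabilityE {R : realType} {d1 d2} {T1 : measurableType d1}
    {T2 : measurableType d2} (P1 : probability T1 R) (P2 : probability T2 R)
    (A : set T1) (B : set T2) : measurable A -> measurable B ->
  ((P1 \x P2)%E : probability (T1 * T2)%type R) (A `*` B) = (P1 A * P2 B)%E.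
Proof. exact: product_measure1E. Qed.

(** * Time inversion *)

(** A version without exceptional null sets, started at 0 on every path. [bm_indep] merges the
    independence of the coordinates, of the increments and of the drift. The grid is an infinite
    sequence, of which only the first [n.+1] times enter, so that strict monotonicity can be stated
    without bounds on the index. *)
Record brownian_model {R : realType} {dsp} {T : measurableType dsp}
    (P : probability T R) {d : nat} (X : 'I_d -> R -> T -> R)
    (e : 'I_d -> T -> R) : Prop := {
  bm_measurable : forall i t, measurable_fun setT (X i t);
  bm_measurable_drift : forall i, measurable_fun setT (e i);
  bm_zero : forall i w, X i 0 w = 0;
  bm_continuous : forall i w, {within `[0, +oo[, continuous (X i ^~ w)};
  bm_indep : forall n (t : nat -> R), t 0%N = 0 -> (forall k, t k < t k.+1) ->
    forall E : 'I_d -> set R, (forall i, measurable (E i)) ->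
    indep_normal P [set w | forall i, E i (e i w)]
      (fun (p : 'I_d * 'I_n) w => X p.1 (t p.2.+1) w - X p.1 (t p.2) w)
      (fun p => Num.sqrt (t p.2.+1 - t p.2)) }.

Section time_inversion.
Context {R : realType} {dsp} {T : measurableType dsp} (P : probability T R).
Context {d : nat} (X : 'I_d -> R -> T -> R) (e : 'I_d -> T -> R).
Hypothesis BM : brownian_model P X e.
Variables (u : R) (n : nat) (s : nat -> R).
Hypotheses (u0 : 0 < u) (s0 : s 0%N = 0) (sS : forall k, s k < s k.+1).

Definition inverted_time (x : R) := (1 + x / u ^+ 2)^-1.
Let tt k := inverted_time (s k).

Let s_ge0 k : 0 <= s k.
Proof. by elim: k => [|k IH]; rewrite ?s0// (le_trans IH)// ltW. Qed.

Let su k : 0 <= s k / u ^+ 2.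
Proof. by rewrite divr_ge0// exprn_ge0// ltW. Qed.

Let tt_gt0 k : 0 < tt k.
Proof. by rewrite invr_gt0 ltr_wpDr. Qed.

Let tt0 : tt 0 = 1.
Proof. by rewrite /tt /inverted_time s0 mul0r addr0 invr1. Qed.

Let ttS k : tt k.+1 < tt k.
Proof.
have gt0 j : 0 < 1 + s j / u ^+ 2 by rewrite ltr_wpDr.
rewrite ltf_pV2 ?posrE ?gt0// ltrD2l ltr_pM2r ?sS//.
by rewrite invr_gt0 exprn_gt0.
Qed.

(** [w.1] supplies the value at time 1 and [w.2] the independent copy. With t = 1 / (1 + s / u^2)
    the variance is t^2 (1 + s / u^2) = t, as for a Brownian motion at time t. *)
Definition inverted (i : 'I_d) (k : nat) (w : T * T) : R :=
  tt k * (X i 1 w.1 + X i (s k) w.2 / u).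

Let Y := inverted.

Let Z (i : 'I_d) (k : nat) (w : T * T) : R :=
  if k is k'.+1 then tt k / u * (X i (s k) w.2 - X i (s k') w.2)
  else X i 1 w.1.

(** For positive index, the standard deviation of a Brownian motion at the time [tt k] given its
    value at the preceding, larger time [tt k']. *)
Let sdZ (k : nat) : R :=
  if k is k'.+1 then Num.sqrt (tt k * (tt k' - tt k) / tt k') else 1.

Let mX i t := bm_measurable BM i t.
Let me_ i := bm_measurable_drift BM i.

Let mY i k : measurable_fun setT (Y i k).
Proof.
apply: measurable_funM => //; apply: measurable_funD.
  exact: (measurableT_comp (mX i 1)).
apply: measurable_funM => //; exact: (measurableT_comp (mX i (s k))).
Qed.

Let mZ i k : measurable_fun setT (Z i k).
Proof.
case: k => [|k] /=; first exact: (measurableT_comp (mX i 1)).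
apply: measurable_funM => //; apply: measurable_funB.
  exact: (measurableT_comp (mX i (s k.+1))).
exact: (measurableT_comp (mX i (s k))).
Qed.

Section stages.
Variable E : 'I_d -> set R.
Hypothesis mE : forall i, measurable (E i).

Let E' : set (T * T) := [set w | forall i, E i (e i w.1)].

Let mE0 : measurable [set w | forall i, E i (e i w)].
Proof. exact: measurable_forall. Qed.

Let E'E : E' = [set w | forall i, E i (e i w)] `*` setT.
Proof. by apply/seteqP; split=> w //= []. Qed.

Let mE' : measurable E'.
Proof. by rewrite E'E; exact: measurableX. Qed.

Let indep_Z : indep_normal (P \x P)%E E'
  (fun (p : 'I_d * 'I_n.+1) => Z p.1 p.2) (fun p => sdZ p.2).
Proof.
move=> U mU.
pose A := [set w | forall i, E i (e i w)] `&` [set w | forall i, U (i, ord0) (X i 1 w)].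
pose c k : R := tt k.+1 / u.
have c0 k : 0 < c k by rewrite divr_gt0.
pose V (p : 'I_d * 'I_n) := (fun x : R => c p.2 * x) @^-1` U (p.1, lift ord0 p.2).
have mV p : measurable (V p).
  have : measurable_fun setT (fun x : R => c p.2 * x) by exact: mulrl_measurable.
  by rewrite -[X in measurable X]setTI; exact.
pose B := [set w | forall p : 'I_d * 'I_n, V p (X p.1 (s p.2.+1) w - X p.1 (s p.2) w)].
have mA : measurable A.
  apply: measurableI => //.
  exact: (measurable_forall (fun i => mX i 1) (fun i => mU (i, ord0))).
have mB : measurable B.
  apply: (@measurable_forall _ _ _ _
    (fun (p : 'I_d * 'I_n) w => X p.1 (s p.2.+1) w - X p.1 (s p.2) w)) => // p.
  exact: measurable_funB.
have -> : E' `&` [set w | forall p : 'I_d * 'I_n.+1, U p (Z p.1 p.2 w)] = A `*` B.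
  apply/seteqP; split=> [w [/= Ew H]|w [/= [Ew H1] H2]].
    split; first by split=> // i; exact: (H (i, ord0)).
    by move=> p /=; exact: (H (p.1, lift ord0 p.2)).
  split=> // -[i k]; case: (unliftP ord0 k) => [k' ->|->]; last exact: H1.
  exact: (H2 (i, k')).
rewrite E'E !product_probabilityE// probability_setT mule1.
have PA : (P A = P [set w | forall i, E i (e i w)] *
    \prod_(i < d) normal_prob 0 1 (U (i, ord0)))%E.
  have ltS k : (k%:R : R) < k.+1%:R by rewrite ltr_nat.
  have := @bm_indep _ _ _ _ _ _ _ BM 1 (fun k => k%:R) erefl ltS E mE
    (fun p => U (p.1, ord0)) (fun p => mU _).
  rewrite (_ : _ `&` _ = A); last first.
    congr (_ `&` _); apply/seteqP; split=> [w H i|w H [i k]].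
      by have := H (i, ord0); rewrite /= (bm_zero BM) subr0.
    by rewrite [k]ord1 /= (bm_zero BM) subr0.
  move=> ->; congr (_ * _)%E.
  rewrite -(pair_bigA _ (fun (i : 'I_d) (k : 'I_1) =>
    normal_prob 0 (Num.sqrt (k.+1%:R - k%:R)) (U (i, ord0))))/=.
  by apply: eq_bigr => i _; rewrite big_ord1 subr0 sqrtr1.
have PB : (P B = \prod_(p : 'I_d * 'I_n) normal_prob 0 (sdZ p.2.+1) (U (p.1, lift ord0 p.2)))%E.
  have := @bm_indep _ _ _ _ _ _ _ BM n s s0 sS (fun=> setT)
    (fun _ => measurableT) V mV.
  rewrite (_ : [set w | forall i : 'I_d, setT (e i w)] = setT); last first.
    by apply/seteqP; split.
  rewrite setTI probability_setT mul1e => ->.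
  apply: eq_bigr => p _.
  (* As 1 / tt = 1 + s / u^2, consecutive inverted times differ by their product times the increment
     of s over u^2; this identifies the variance of the rescaled increment with the bridge
     variance. *)
  have sdE : c p.2 * Num.sqrt (s p.2.+1 - s p.2) = sdZ p.2.+1.
    rewrite -[c _]ger0_norm ?ltW// -sqrtr_sqr -sqrtrM ?sqr_ge0//.
    rewrite /sdZ; congr (Num.sqrt _); rewrite /c /tt /inverted_time; field.
    have H k : u ^+ 2 + s k != 0.
      by rewrite gt_eqF// ltr_wpDr// exprn_gt0.
    by rewrite !H gt_eqF.
  have ds0 : 0 < Num.sqrt (s p.2.+1 - s p.2) by rewrite sqrtr_gt0 subr_gt0.
  by rewrite -sdE; exact: esym (normal_prob_scale (c0 p.2) ds0 (mU _)).
rewrite PA PB -muleA; congr (_ * _)%E.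
transitivity (\prod_i \prod_(k < n.+1) normal_prob 0 (sdZ k) (U (i, k)))%E.
  rewrite -(pair_bigA _ (fun (i : 'I_d) (k : 'I_n) =>
    normal_prob 0 (sdZ k.+1) (U (i, lift ord0 k)))) -big_split/=.
  by apply: eq_bigr => i _; rewrite big_ord_recl.
by rewrite pair_bigA; apply: eq_bigr => -[].
Qed.

(* In row i, the first c i variables have been turned into increments of the
   inverted process, entry c i holds its value at the c i-th time, and the later
   ones are still increments of the original process. *)
Let F (c : 'I_d -> nat) (p : 'I_d * 'I_n.+1) : T * T -> R :=
  if (p.2 < c p.1)%N then fun w => Y p.1 p.2 w - Y p.1 p.2.+1 w
  else if p.2 == c p.1 :> nat then Y p.1 p.2 else Z p.1 p.2.

Let sdF (c : 'I_d -> nat) (p : 'I_d * 'I_n.+1) : R :=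
  if (p.2 < c p.1)%N then Num.sqrt (tt p.2 - tt p.2.+1)
  else if p.2 == c p.1 :> nat then Num.sqrt (tt p.2) else sdZ p.2.

Let mF c p : measurable_fun setT (F c p).
Proof.
rewrite /F; case: ifP => _; first exact: measurable_funB.
by case: ifP.
Qed.

Let ZE i k : (0 < k)%N ->
  Z i k = (fun w => tt k / u * (X i (s k) w.2 - X i (s k.-1) w.2)).
Proof. by case: k. Qed.

Let sdZE k : (0 < k)%N ->
  sdZ k = Num.sqrt (tt k * (tt k.-1 - tt k) / tt k.-1).
Proof. by case: k. Qed.

Let YE i k : (0 < k)%N ->
  Y i k = fun w => tt k / tt k.-1 * Y i k.-1 w + Z i k w.
Proof.
move=> k0; apply/funext => w; rewrite ZE// /Y /inverted -!/(tt _).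
rewrite mulrA divfK ?gt_eqF// -[tt k / u * _]mulrA -mulrDr; congr (_ * _).
by field; rewrite gt_eqF.
Qed.

(** Induction on the total number of converted variables. One step advances a single row by one
    position, which is one rotation of the entries at [(c i).-1] and [c i]; the base case is
    [indep_Z], since at index 0 the inverted process is the value at time 1. *)
Let stage m : forall c, (\sum_i c i)%N = m -> (forall i, c i <= n)%N ->
  indep_normal (P \x P)%E E' (F c) (sdF c).
Proof.
elim: m => [|m IH] c cm cn.
  apply: (eq_indep_normal _ _ indep_Z) => [[i k] w|[i k]]; rewrite /F /sdF /=.
    have -> : c i = 0%N.
      by apply/eqP; rewrite -leqn0 -cm (bigD1 i)//= leq_addr.
    have [k0|k0] := eqVneq (k : nat) 0%N; rewrite ltn0 ?k0//.
    by rewrite /Y /inverted -/(tt 0) tt0 mul1r s0 (bm_zero BM) mul0r addr0.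
  have -> : c i = 0%N.
    by apply/eqP; rewrite -leqn0 -cm (bigD1 i)//= leq_addr.
  have [k0|k0] := eqVneq (k : nat) 0%N; rewrite ltn0 ?k0//.
  by rewrite /= tt0 sqrtr1.
have [i ci] : exists i, (0 < c i)%N.
  apply/existsP; move: cm; apply: contraPP => /negP.
  rewrite negb_exists => /forallP H; rewrite big1// => i _.
  by apply/eqP; have := H i; rewrite lt0n negbK.
pose c' j := if j == i then (c i).-1 else c j.
have c'i : c' i = (c i).-1 by rewrite /c' eqxx.
have c'j j : j != i -> c' j = c j by rewrite /c' => /negbTE ->.
have c'm : (\sum_j c' j)%N = m.
  apply/eqP; rewrite -eqSS -cm (bigD1 i)//= [X in _ == X](bigD1 i)//=.
  rewrite c'i -addSn prednK// eqn_add2l; apply/eqP; apply: eq_bigr => j ji.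
  exact: c'j.
have c'n j : (c' j <= n)%N.
  by rewrite /c'; case: ifP => // _; rewrite (leq_trans (leq_pred _)).
have kn : ((c i).-1 < n.+1)%N by rewrite prednK// (leq_trans (cn i)).
have kn' : (c i < n.+1)%N by rewrite ltnS.
pose k := Ordinal kn; pose k' := Ordinal kn'.
have kk' : k != k' by rewrite -val_eqE /= neq_ltn ltn_predL ci.
have ttk : tt (c i) < tt (c i).-1 by rewrite -{1}(prednK ci).
apply: (@indep_normal_rotation _ _ _ _ _ _ (F c') (F c) (sdF c') (sdF c)
  (i, k) (i, k') (tt (c i)) (tt (c i).-1)) (IH _ c'm c'n) => //.
- by rewrite xpair_eqE eqxx.
- by rewrite /sdF /= c'i ltnn eqxx.
- rewrite /sdF /= c'i ltnNge leq_pred/= gtn_eqF ?ltn_predL//.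
  exact: sdZE.
- by rewrite /sdF /= ltnn eqxx.
- by rewrite /sdF /= ltn_predL ci prednK.
- rewrite /F /= ltnn eqxx c'i ltnn eqxx ltnNge leq_pred/=.
  by rewrite gtn_eqF ?ltn_predL//; exact: YE.
- rewrite /F /= c'i ltnn eqxx ltn_predL ci prednK//.
  rewrite ltnNge leq_pred/= gtn_eqF ?ltn_predL//.
  by apply/funext => w; rewrite [Y i (c i)]YE.
move=> [j l] /=; rewrite !xpair_eqE; have [->/=|ji] := eqVneq j i; last first.
  by rewrite /F /sdF /= c'j.
rewrite -!val_eqE /= /F /sdF /= c'i => lk lk'.
have -> : (l < c i)%N = (l < (c i).-1)%N.
  by rewrite -{1}(prednK ci) ltnS leq_eqVlt (negbTE lk).
by rewrite (negbTE lk) (negbTE lk').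
Qed.

Lemma indep_inverted : indep_normal (P \x P)%E E'
  (fun (p : 'I_d * 'I_n.+1) w =>
    if (p.2 < n)%N then Y p.1 p.2 w - Y p.1 p.2.+1 w else Y p.1 p.2 w)
  (fun p => if (p.2 < n)%N then Num.sqrt (tt p.2 - tt p.2.+1)
            else Num.sqrt (tt p.2)).
Proof.
apply: (eq_indep_normal _ _ (@stage _ (fun=> n) erefl (fun=> leqnn n))).
- move=> [i k] w; rewrite /F /=; case: ltnP => // nk.
  by rewrite eqn_leq nk -ltnS ltn_ord.
- move=> [i k]; rewrite /sdF /=; case: ltnP => // nk.
  by rewrite eqn_leq nk -ltnS ltn_ord.
Qed.

(** The inverted times in increasing order, preceded by 0. The values beyond index [n.+1] are filler
    that keeps the sequence strictly increasing. *)
Let r j : R :=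
  if j is 0%N then 0 else if (j <= n.+1)%N then tt (n.+1 - j) else (j - n)%:R.

Let rS j : r j < r j.+1.
Proof.
rewrite /r; case: j => [|j]; first by rewrite ltnS leq0n.
rewrite !ltnS; have [jn|] := ltnP j n.
  by rewrite (ltnW jn) !subSS -(subnSK jn); exact: ttS.
rewrite leq_eqVlt => /predU1P[<-|nj].
  rewrite leqnn subnn tt0 -[X in X < _]/(1%:R) ltr_nat.
  by rewrite subSn ?leqnSn// subSnn.
by rewrite leqNgt nj/= ltr_nat ltn_sub2r// ltnW// ltnS ltnW.
Qed.

Lemma indep_grid : indep_normal P [set w | forall i, E i (e i w)]
  (fun (p : 'I_d * 'I_n.+1) w =>
    if (p.2 < n)%N then X p.1 (tt p.2) w - X p.1 (tt p.2.+1) w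
    else X p.1 (tt p.2) w)
  (fun p => if (p.2 < n)%N then Num.sqrt (tt p.2 - tt p.2.+1)
            else Num.sqrt (tt p.2)).
Proof.
move=> U mU.
have rk (k : 'I_n.+1) : r (rev_ord k).+1 = tt k.
  by rewrite /r /= subSS ltnS leq_subr subSS subKn// -ltnS ltn_ord.
have rk1 (k : 'I_n.+1) : (k < n)%N -> r (rev_ord k) = tt k.+1.
  move=> kn; rewrite /r /= subSS -(subnSK kn) ltnS (leq_trans (leq_subr _ _))//.
  by rewrite subSS subKn.
have rk0 (k : 'I_n.+1) : (k < n)%N = false -> r (rev_ord k) = 0.
  by move=> /negbT; rewrite -leqNgt /r /= subSS -subn_eq0 => /eqP ->.
have GE i (k : 'I_n.+1) w : X i (r (rev_ord k).+1) w - X i (r (rev_ord k)) w =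
    if (k < n)%N then X i (tt k) w - X i (tt k.+1) w else X i (tt k) w.
  rewrite rk; case: ifP => kn; first by rewrite rk1.
  by rewrite rk0// (bm_zero BM) subr0.
have := @bm_indep _ _ _ _ _ _ _ BM n.+1 r erefl rS E mE
  (fun p => U (p.1, rev_ord p.2)) (fun p => mU _).
rewrite [X in P X](_ : _ = [set w | forall i, E i (e i w)] `&`
    [set w | forall p : 'I_d * 'I_n.+1, U p
      (if (p.2 < n)%N then X p.1 (tt p.2) w - X p.1 (tt p.2.+1) w
       else X p.1 (tt p.2) w)]); last first.
  congr (_ `&` _); apply/seteqP; split=> [w /= H [i k]|w /= H [i k]].
    have : U (i, rev_ord (rev_ord k)) (X i (r (rev_ord k).+1) w -
      X i (r (rev_ord k)) w) by exact: (H (i, rev_ord k)).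
    by rewrite rev_ordK GE.
  have : U (i, rev_ord k) (if (rev_ord k < n)%N
      then X i (tt (rev_ord k)) w - X i (tt (rev_ord k).+1) w
      else X i (tt (rev_ord k)) w) by exact: (H (i, rev_ord k)).
  by rewrite -GE rev_ordK.
move=> ->; congr (_ * _)%E.
rewrite [LHS](reindex (fun p : 'I_d * 'I_n.+1 => (p.1, rev_ord p.2)))/=; last first.
  by exists (fun p => (p.1, rev_ord p.2)) => -[i k] _ /=; rewrite rev_ordK.
apply: eq_bigr => -[i k] _.
apply: (@etrans _ _ (normal_prob 0 (Num.sqrt (r (rev_ord k).+1 - r (rev_ord k)))
  (U (i, rev_ord (rev_ord k))))); first by [].
rewrite rev_ordK rk.
apply: (@etrans _ _ (normal_prob 0 (if (k < n)%N then Num.sqrt (tt k - tt k.+1)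
  else Num.sqrt (tt k)) (U (i, k)))); last by [].
congr (normal_prob 0 _ _); case: ifP => kn; first by rewrite rk1.
by rewrite rk0// subr0.
Qed.

End stages.

(** By [indep_grid] and [indep_inverted] the two processes have increments with the same law,
    jointly with the drift; [cumul] rebuilds the values from the increments. *)
Lemma time_inversion (S : ('I_d -> R) -> ('I_d -> 'I_n.+1 -> R) -> Prop) :
  measurable [set t : #|{: 'I_d + 'I_d * 'I_n.+1}|.-tuple R |
    S (fun i => untuple t (inl i)) (fun i k => untuple t (inr (i, k)))] ->
  P [set w | S (e^~ w) (fun i k => X i (tt k) w)] =
  (P \x P)%E [set w | S (e^~ w.1) (fun i (k : 'I_n.+1) => inverted i k w)].
Proof.
move=> mS.
pose cumul (f : 'I_d + 'I_d * 'I_n.+1 -> R) (x : 'I_d + 'I_d * 'I_n.+1) : R :=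
  match x with
  | inl i => f (inl i)
  | inr (i, k) => \sum_(j < n.+1 | (k <= j)%N) f (inr (i, j))
  end.
pose S' f := S (fun i => cumul f (inl i)) (fun i k => cumul f (inr (i, k))).
have mS' : measurable [set t : #|{: 'I_d + 'I_d * 'I_n.+1}|.-tuple R | S' (untuple t)].
  have mcumul x : measurable_fun setT
      (fun t : #|{: 'I_d + 'I_d * 'I_n.+1}|.-tuple R => cumul (untuple t) x).
    case: x => [i|[i k]] /=; first exact: measurable_untuple.
    rewrite [X in measurable_fun _ X](_ : _ = fun t : _.-tuple R =>
      \sum_(j < n.+1) if (k <= j)%N then untuple t (inr (i, j)) else 0).
      by apply: measurable_sum => j; case: (k <= j)%N => //; exact: measurable_untuple.
    by apply/funext => t; rewrite -big_mkcond.
  have := measurable_retuple mcumul measurableT mS; rewrite setTI.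
  congr measurable; apply/seteqP; split=> t /=; congr (S _ _);
    by do ?[apply/funext => ?]; rewrite /untuple tnth_mktuple enum_rankK.
have me1 i : measurable_fun setT (fun w : T * T => e i w.1).
  exact: (measurableT_comp (me_ i)).
have := @indep_normal_law _ _ _ _ _ P (P \x P)%E _ _ e
  (fun (p : 'I_d * 'I_n.+1) w =>
    if (p.2 < n)%N then X p.1 (tt p.2) w - X p.1 (tt p.2.+1) w
    else X p.1 (tt p.2) w) (fun i w => e i w.1)
  (fun (p : 'I_d * 'I_n.+1) w =>
    if (p.2 < n)%N then Y p.1 p.2 w - Y p.1 p.2.+1 w else Y p.1 p.2 w)
  (fun p => if (p.2 < n)%N then Num.sqrt (tt p.2 - tt p.2.+1)
            else Num.sqrt (tt p.2)) S' me_ me1.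
have step1 (p : 'I_d * 'I_n.+1) : measurable_fun setT (fun w =>
    if (p.2 < n)%N then X p.1 (tt p.2) w - X p.1 (tt p.2.+1) w
    else X p.1 (tt p.2) w).
  by case: (p.2 < n)%N => //; exact: measurable_funB.
have step2 (p : 'I_d * 'I_n.+1) : measurable_fun setT (fun w =>
    if (p.2 < n)%N then Y p.1 p.2 w - Y p.1 p.2.+1 w else Y p.1 p.2 w).
  by case: (p.2 < n)%N => //; exact: measurable_funB.
have ee (E : 'I_d -> set R) : (forall i, measurable (E i)) ->
    P [set w | forall i, E i (e i w)] = (P \x P)%E [set w | forall i, E i (e i w.1)].
  move=> mE; have mE0 : measurable [set w | forall i, E i (e i w)].
    exact: measurable_forall.
  rewrite [X in _ = _ X](_ : _ = [set w | forall i, E i (e i w)] `*` setT).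
    by rewrite product_probabilityE// probability_setT mule1.
  by apply/seteqP; split=> w //= [].
move=> /(_ step1 step2 ee indep_grid indep_inverted mS') H.
rewrite [LHS](_ : _ = P [set w | S' (sumf (e^~ w) (fun p : 'I_d * 'I_n.+1 =>
    if (p.2 < n)%N then X p.1 (tt p.2) w - X p.1 (tt p.2.+1) w
    else X p.1 (tt p.2) w))]).
  rewrite H.
  congr (_ _); apply/seteqP; split=> w; rewrite /S' /=;
    congr (S _ _); apply/funext => i; apply/funext => k;
    by rewrite (sum_increments (fun k => Y i k w))// -ltnS.
congr (_ _); apply/seteqP; split=> w; rewrite /S' /=;
  congr (S _ _); apply/funext => i; apply/funext => k;
  by rewrite (sum_increments (fun k => X i (tt k) w))// -ltnS.
Qed.

End time_inversion.

(** * Gaussian orthant probabilities *)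

Section measurable2.
Context {R : realType} {d : nat}.

Definition measurable2 (f : ('I_d -> R) -> ('I_d -> R) -> \bar R) :=
  measurable_fun setT (fun t : #|{: 'I_d + 'I_d}|.-tuple R =>
    f (fun i => untuple t (inl i)) (fun i => untuple t (inr i))).

Lemma measurable2_comp {dsp} {T : measurableType dsp} f (x y : 'I_d -> T -> R) :
  measurable2 f -> (forall i, measurable_fun setT (x i)) ->
  (forall i, measurable_fun setT (y i)) ->
  measurable_fun setT (fun w => f (x^~ w) (y^~ w)).
Proof.
move=> mf mx my.
have mX (z : 'I_d + 'I_d) : measurable_fun setT (sumf x y z) by case: z.
have := measurableT_comp mf (measurable_retuple mX).
apply: eq_measurable_fun => w _ /=.
by congr (f _ _); apply/funext => i; rewrite /untuple tnth_mktuple enum_rankK.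
Qed.

End measurable2.

(** * The Cameron-Martin formula in several variables *)

Section cameron_martin.
Context {R : realType} {dsp} {T : measurableType dsp} (P : probability T R).
Context {d : nat} (e Z : 'I_d -> T -> R).
Hypotheses (me : forall i, measurable_fun setT (e i))
  (mZ : forall i, measurable_fun setT (Z i)).
Hypothesis indepZ : forall E : 'I_d -> set R, (forall i, measurable (E i)) ->
  indep_normal P [set w | forall i, E i (e i w)] Z (fun=> 1).

Let fst_event (E : 'I_d -> set R) : (forall i, measurable (E i)) ->
  ((P \x P)%E : probability (T * T)%type R) [set w | forall i, E i (e i w.1)] =
  P [set w | forall i, E i (e i w)].
Proof.
move=> mE; have mE0 : measurable [set w | forall i, E i (e i w)].
  exact: measurable_forall.
rewrite [X in _ X = _](_ : _ = [set w | forall i, E i (e i w)] `*` setT).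
  by rewrite product_probabilityE// probability_setT mule1.
by apply/seteqP; split=> w //= [].
Qed.

Let replace (i : 'I_d) (j : 'I_d) (w : T * T) := if j == i then Z i w.2 else Z j w.1.

Let m_replace i j : measurable_fun setT (replace i j).
Proof.
by rewrite /replace; case: (j == i); apply: (measurableT_comp (mZ _)).
Qed.

Let me1 i : measurable_fun setT (fun w : T * T => e i w.1).
Proof. exact: (measurableT_comp (me i)). Qed.

Let indep_replace i (E : 'I_d -> set R) : (forall j, measurable (E j)) ->
  indep_normal (P \x P)%E [set w | forall j, E j (e j w.1)] (replace i) (fun=> 1).
Proof.
move=> mE U mU.
have mE0 : measurable [set w | forall i, E i (e i w)] by exact: measurable_forall.
pose U1 j := if j == i then setT else U j.
pose U2 j := if j == i then U i else setT.
have mU1 j : measurable (U1 j) by rewrite /U1; case: ifP.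
have mU2 j : measurable (U2 j) by rewrite /U2; case: ifP.
pose A := [set w | forall j, E j (e j w)] `&` [set w | forall j, U1 j (Z j w)].
pose B := [set w | forall j : 'I_d, setT (e j w)] `&` [set w | forall j, U2 j (Z j w)].
have mA : measurable A by apply: measurableI => //; exact: measurable_forall.
have mB : measurable B.
  apply: measurableI; last exact: measurable_forall.
  exact: (measurable_forall me (fun=> measurableT)).
rewrite [LHS](_ : _ = ((P \x P)%E : probability _ R) (A `*` B)); last first.
  congr (_ _); apply/seteqP; split=> [w /= [Ew Uw]|w [/= [Ew U1w] [_ U2w]]].
    split; split => //= j.
      have := Uw j; rewrite /U1 /replace; case: ifP => //.
    have := Uw j; rewrite /U2 /replace; case: eqP => // ->; exact.
  split=> // j; rewrite /replace; have := U1w j; have := U2w j; rewrite /U1 /U2.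
  by case: eqP => // ->.
rewrite product_probabilityE// (fst_event mE).
rewrite (indepZ mE mU1) (indepZ (fun=> measurableT) mU2).
rewrite [P [set w | forall j : 'I_d, setT (e j w)]](_ : _ = 1%E) ?mul1e; last first.
  by rewrite -[RHS](probability_setT P); congr (P _); apply/seteqP; split.
rewrite -muleA -big_split/=; congr (_ * _)%E; apply: eq_bigr => j _.
rewrite /U1 /U2; case: eqP => [->|_].
  by rewrite probability_setT mul1e.
by rewrite probability_setT mule1.
Qed.

(** Coordinate [i] is independent of the drift and of the other coordinates, so it may be resampled
    from an independent copy without changing the joint law. This isolates a one-dimensional normal
    integral. *)
Let integral_replace i f : measurable2 f -> (forall x z, 0 <= f x z)%E ->
  (\int[P]_w f (e^~ w) (Z^~ w) =
   \int[P]_w \int[normal_prob 0 1]_x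
     f (e^~ w) (fun j => if j == i then x else Z j w))%E.
Proof.
move=> mf f0.
pose g (h : 'I_d + 'I_d -> R) := f (fun i => h (inl i)) (fun i => h (inr i)).
pose X1 (x : 'I_d + 'I_d) : T -> R := sumf e Z x.
pose X2 (x : 'I_d + 'I_d) : T * T -> R := sumf (fun i w => e i w.1) (replace i) x.
have mX1 x : measurable_fun setT (X1 x) by case: x.
have mX2 x : measurable_fun setT (X2 x).
  by case: x => j; [exact: me1|exact: m_replace].
have rect U : (forall x, measurable (U x)) ->
    P [set w | forall x, U x (X1 x w)] =
    ((P \x P)%E : probability _ R) [set w | forall x, U x (X2 x w)].
  move=> mU.
  have mUl j : measurable (U (inl j)) by [].
  have mUr j : measurable (U (inr j)) by [].
  have mE0 : measurable [set w | forall i, U (inl i) (e i w)].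
    exact: (measurable_forall me mUl).
  rewrite [LHS](_ : _ = P ([set w | forall i, U (inl i) (e i w)] `&`
    [set w | forall i, U (inr i) (Z i w)])); last first.
    congr (P _); apply/seteqP; split=> [w H|w [H1 H2] []//].
    by split=> x; [have := H (inl x)|have := H (inr x)].
  rewrite [RHS](_ : _ = ((P \x P)%E : probability _ R) ([set w | forall i, U (inl i) (e i w.1)] `&`
    [set w | forall j, U (inr j) (replace i j w)])); last first.
    congr (_ _); apply/seteqP; split=> [w H|w [H1 H2] []//].
    by split=> x; [have := H (inl x)|have := H (inr x)].
  rewrite (indepZ mUl mUr) (indep_replace i mUl mUr).
  by rewrite (fst_event mUl).
have := @law_unique _ _ _ _ _ _ P (P \x P)%E X1 X2 mX1 mX2 rect g mf
  (fun h => f0 _ _).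
rewrite [X in X = _](_ : _ = (\int[P]_w f (e^~ w) (Z^~ w))%E)// => ->.
have mgX2 : measurable_fun setT (fun w => g (X2^~ w)).
  exact: (measurable2_comp mf me1 (m_replace i)).
rewrite (fubini_tonelli1 _ mgX2 (fun=> f0 _ _)).
apply: eq_integral => w _; rewrite /fubini_F.
pose h x := f (e^~ w) (fun j => if j == i then x else Z j w).
have mh : measurable_fun setT h.
  have mZw j : measurable_fun setT (fun x : R => if j == i then x else Z j w).
    by case: (j == i).
  exact: (measurable2_comp mf (fun i => measurable_cst (e i w)) mZw).
transitivity (\int[P]_w' (h \o Z i) w')%E.
  apply: eq_integral => w' _; rewrite /h /g /X2 /replace /=.
  by congr (f _ _); apply/funext => j; case: ifP.
have := @ge0_integral_pushforward _ _ T (measurableTypeR R) R (Z i) (mZ i) P setT h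
  measurableT mh (fun y _ => f0 _ _).
rewrite preimage_setT => <-.
apply: eq_measure_integral => [|? A mA _]; first exact: mZ.
rewrite /= /pushforward.
pose U j := if j == i then A else setT.
have mU j : measurable (U j) by rewrite /U; case: ifP.
transitivity (P ([set w | forall j : 'I_d, setT (e j w)] `&` [set w | forall j, U j (Z j w)])).
  congr (P _); apply/seteqP; split=> [x Ax|x /= [_ /(_ i)]]; last by rewrite /U eqxx.
  by split=> // j; rewrite /U; case: eqP => // ->.
rewrite (indepZ (fun=> measurableT) mU).
rewrite [P [set w | forall j : 'I_d, setT (e j w)]](_ : _ = 1%E) ?mul1e; last first.
  by rewrite -[RHS](probability_setT P); congr (P _); apply/seteqP; split.
rewrite (bigD1 i)//= {1}/U eqxx big1 ?mule1// => j ji.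
by rewrite /U (negbTE ji) probability_setT.
Qed.

(** The ratio of the standard normal densities at z + v and at z. *)
Definition cm_density (v z : 'I_d -> R) : R :=
  expR (- (\sum_i v i * z i) - (\sum_i v i ^+ 2) / 2).

Let CM v := forall f, measurable2 f -> (forall x z, 0 <= f x z)%E ->
  (\int[P]_w f (e^~ w) (Z^~ w) =
   \int[P]_w (f (e^~ w) (fun i => Z i w + v i)%R * (cm_density v (Z^~ w))%:E))%E.

Let measurable2_shift v f : measurable2 f ->
  measurable2 (fun x z => f x (fun i => z i + v i)%R * (cm_density v z)%:E)%E.
Proof.
move=> mf; apply: emeasurable_funM.
  apply: (measurable2_comp mf) => i; first exact: measurable_untuple.
  by apply: measurable_funD => //; exact: measurable_untuple.
apply/measurable_EFinP; apply: measurableT_comp => //.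
apply: measurable_funB => //; apply: measurableT_comp => //.
by apply: measurable_sum => i; apply: measurable_funM => //; exact: measurable_untuple.
Qed.

Let CM1 i c : CM (fun j => if j == i then c else 0).
Proof.
move=> f mf f0; set v := fun j : 'I_d => if _ then _ else _.
have mf' := measurable2_shift v mf.
have f0' x z : (0 <= f x (fun i => z i + v i)%R * (cm_density v z)%:E)%E.
  by rewrite mule_ge0// lee_fin expR_ge0.
rewrite (integral_replace i mf f0).
rewrite (integral_replace i mf' f0').
apply: eq_integral => w _.
pose h x := f (e^~ w) (fun j => if j == i then x else Z j w).
have mh : measurable_fun setT h.
  have mZw j : measurable_fun setT (fun x : R => if j == i then x else Z j w).
    by case: (j == i).
  exact: (measurable2_comp mf (fun i => measurable_cst (e i w)) mZw).
rewrite [LHS](integral_normal_shift c mh (fun x => f0 _ _)).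
apply: eq_integral => x _; congr (f _ _ * (expR _)%:E)%E.
  by apply/funext => j; rewrite /v; case: eqP => // _; rewrite addr0.
rewrite (bigD1 i)//= /v eqxx big1 ?addr0; last first.
  by move=> j /negbTE ->; rewrite mul0r.
rewrite (bigD1 i)//= eqxx big1 ?addr0 ?mulNr//.
by move=> j /negbTE ->; rewrite expr0n.
Qed.

(** The coordinates are shifted one after another. Successive shifts have disjoint supports, so the
    cross terms vanish and the densities multiply to that of the full shift. *)
Lemma cameron_martin v f : measurable2 f -> (forall x z, 0 <= f x z)%E ->
  (\int[P]_w f (e^~ w) (Z^~ w) =
   \int[P]_w (f (e^~ w) (fun i => Z i w + v i)%R * (cm_density v (Z^~ w))%:E))%E.
Proof.
suff H n : CM (fun j : 'I_d => if (j < n)%N then v j else 0).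
  have <- : (fun j : 'I_d => if (j < d)%N then v j else 0) = v; last exact: H.
  by apply/funext => j; rewrite ltn_ord.
elim: n => [|n IH].
  move=> g mg g0; apply: eq_integral => w _; rewrite /cm_density.
  rewrite big1 ?big1 => [|j _|j _]; last 2 first.
  - by rewrite expr0n.
  - by rewrite mul0r.
  rewrite oppr0 mul0r subr0 expR0 mule1; congr g.
  by apply/funext => j; rewrite addr0.
have [dn|nd] := leqP d n.
  suff -> : (fun j : 'I_d => if (j < n.+1)%N then v j else 0) =
    (fun j : 'I_d => if (j < n)%N then v j else 0) by [].
  apply/funext => j.
  by rewrite (leq_trans (ltn_ord j) dn) (leq_trans (ltn_ord j) (leqW dn)).
pose i := Ordinal nd.
move=> g mg g0; rewrite (IH g mg g0).
set v1 := fun j : 'I_d => if (j < n)%N then v j else 0.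
rewrite (@CM1 i (v i) _ (measurable2_shift v1 mg)); last first.
  by move=> x z; rewrite mule_ge0// lee_fin expR_ge0.
apply: eq_integral => w _; rewrite -muleA -EFinM -expRD.
have vE (j : 'I_d) : (if (j < n.+1)%N then v j else 0) =
    v1 j + (if j == i then v i else 0).
  rewrite /v1; have [->|ji] := eqVneq j i; first by rewrite /= ltnSn ltnn add0r.
  by rewrite addr0 ltnS leq_eqVlt -[X in X || _]/(j == i) (negbTE ji).
congr (g _ _ * (expR _)%:E)%E.
  by apply/funext => j; rewrite vE [v1 j + _]addrC addrA.
have vv (j : 'I_d) : v1 j * (if j == i then v i else 0) = 0.
  by rewrite /v1 -val_eqE /=; case: ltngtP; rewrite ?mulr0 ?mul0r.
rewrite (eq_bigr (fun j => v1 j * Z j w)); last first.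
  by move=> j _; rewrite mulrDr vv addr0.
rewrite [in RHS](eq_bigr (fun j => v1 j * Z j w +
  (if j == i then v i else 0) * Z j w)); last by move=> j _; rewrite vE mulrDl.
rewrite [X in _ = _ - X / _](eq_bigr (fun j => v1 j ^+ 2 +
  (if j == i then v i else 0) ^+ 2)); last first.
  by move=> j _; rewrite vE sqrrD vv mul0rn addr0.
by rewrite !big_split/=; lra.
Qed.

End cameron_martin.

Lemma normal_prob_gt0 {R : realType} (x y : R) : x < y ->
  (0 < normal_prob 0 1 `[x, y]%classic)%E.
Proof.
move=> xy.
pose M := Num.max `|x| `|y|.
pose c : R := normal_peak 1 * expR (- M ^+ 2 / 2).
have c0 : 0 < c by rewrite mulr_gt0 ?expR_gt0// normal_peak_gt0 ?oner_eq0.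
apply: (@lt_le_trans _ _ (\int[lebesgue_measure]_(z in `[x, y]) c%:E)%E).
  rewrite integral_cst//= lebesgue_measure_itv/= lte_fin xy -EFinD -EFinM.
  by rewrite lte_fin mulr_gt0// subr_gt0.
apply: ge0_le_integral => //.
- by move=> z _; rewrite lee_fin ltW.
- by apply: measurable_funTS; apply/measurable_EFinP; exact: measurable_normal_pdf.
- move=> z; rewrite /= in_itv/= => /andP[xz zy].
  rewrite lee_fin normal_pdfE ?oner_eq0// /c ler_wpM2l ?normal_peak_ge0//.
  rewrite /normal_fun subr0 expr1n ler_expR ler_pM2r// lerN2.
  have zM : `|z| <= M.
    rewrite ler_norml; apply/andP; split.
      rewrite (le_trans _ xz)// lerNl (@le_trans _ _ `|x|)//.
        by rewrite -normrN ler_norm.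
      by rewrite le_max lexx.
    by rewrite (le_trans zy)// (@le_trans _ _ `|y|) ?ler_norm// le_max lexx orbT.
  by rewrite -[leLHS]real_normK ?num_real// lerXn2r// ?nnegrE ?(le_trans _ zM).
Qed.

Section orthant.
Context {R : realType} {dsp} {T : measurableType dsp} (P : probability T R).
Context {d : nat} (e Z : 'I_d -> T -> R).
Hypotheses (me : forall i, measurable_fun setT (e i))
  (mZ : forall i, measurable_fun setT (Z i)).
Hypothesis indepZ : forall E : 'I_d -> set R, (forall i, measurable (E i)) ->
  indep_normal P [set w | forall i, E i (e i w)] Z (fun=> 1).
Variables (A : 'M[R]_d).

Definition mulf (z : 'I_d -> R) (i : 'I_d) : R := \sum_j A i j * z j.

Definition orthant_event (c : 'I_d -> R) : set (('I_d -> R) * ('I_d -> R)) :=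
  [set xz | forall i, c i + xz.1 i < mulf xz.2 i].

Definition exceed (c : 'I_d -> R) : set T :=
  [set w | forall i, c i + e i w < mulf (Z^~ w) i].

Lemma measurable_exceed_gen {d'} {T' : measurableType d'} (x z : 'I_d -> T' -> R) c :
  (forall i, measurable_fun setT (x i)) -> (forall i, measurable_fun setT (z i)) ->
  measurable [set w | forall i, c i + x i w < mulf (z^~ w) i].
Proof.
move=> mx mz.
have mg i : measurable_fun setT (fun w => mulf (z^~ w) i - x i w).
  apply: measurable_funB => //; apply: measurable_sum => j.
  exact: measurable_funM.
have -> : [set w | forall i, c i + x i w < mulf (z^~ w) i] =
    [set w | forall i, `]c i, +oo[%classic (mulf (z^~ w) i - x i w)].
  by apply/seteqP; split=> w /= H i; have := H i; rewrite in_itv/= andbT ltrBrDr.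
exact: (measurable_forall mg (fun i => measurable_itv `]c i, +oo[)).
Qed.

Lemma measurable_exceed c : measurable (exceed c).
Proof. exact: measurable_exceed_gen. Qed.

Let f c (th : 'I_d -> R) (k : R) (x z : 'I_d -> R) : \bar R :=
  (\1_(orthant_event c) (x, z) * expR (\sum_j th j * z j + k))%:E.

Let f0 c th k x z : (0 <= f c th k x z)%E.
Proof. by rewrite lee_fin mulr_ge0// expR_ge0. Qed.

Let measurable2_f c th k : measurable2 (f c th k).
Proof.
apply/measurable_EFinP; apply: measurable_funM.
  pose S : set (#|{: 'I_d + 'I_d}|.-tuple R) := [set t | forall i,
    c i + untuple t (inl i) < mulf (fun i => untuple t (inr i)) i].
  rewrite (_ : (fun t => _) = \1_S).
    apply: measurable_indic; rewrite /S.
    exact: (measurable_exceed_gen c (fun i => measurable_untuple (inl i))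
      (fun i => measurable_untuple (inr i))).
  by apply/funext => t; rewrite !indicE; congr (nat_of_bool _)%:R; apply/idP/idP; rewrite !inE.
apply: measurableT_comp => //; apply: measurable_funD => //.
by apply: measurable_sum => i; apply: measurable_funM => //; exact: measurable_untuple.
Qed.

Let mfw c th k : measurable_fun setT (fun w => f c th k (e^~ w) (Z^~ w)).
Proof. exact: (measurable2_comp (measurable2_f c th k)). Qed.

Definition exceed_mean c (th : 'I_d -> R) (k : R) : \bar R :=
  \int[P]_w (\1_(exceed c) w * expR (\sum_j th j * Z j w + k))%:E.

Let exceed_meanE c th k :
  exceed_mean c th k = (\int[P]_w f c th k (e^~ w) (Z^~ w))%E.
Proof.
by apply: eq_integral => w _; congr (_ * _)%:E.
Qed.

Lemma exceed_mean0 c : exceed_mean c (fun=> 0) 0 = P (exceed c).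
Proof.
transitivity (\int[P]_w (\1_(exceed c) w)%:E)%E; last first.
  by rewrite integral_indic ?setIT//; exact: measurable_exceed.
apply: eq_integral => w _; rewrite big1 ?addr0 ?expR0 ?mulr1// => j _.
by rewrite mul0r.
Qed.

Lemma mulfD z v i : mulf (fun i => z i + v i) i = mulf z i + mulf v i.
Proof. by rewrite -big_split/=; apply: eq_bigr => j _; rewrite mulrDr. Qed.

(** The Cameron-Martin formula acts within the family [exceed_mean]: it moves the level, the tilt
    and the constant. The later estimates differ only in the choice of [v]. *)
Lemma exceed_mean_shift c th k v : exceed_mean c th k =
  exceed_mean (fun i => c i - mulf v i) (fun j => th j - v j)
    (k + \sum_j th j * v j - (\sum_j v j ^+ 2) / 2).
Proof.
rewrite exceed_meanE (cameron_martin me mZ indepZ v (measurable2_f c th k) (f0 c th k)).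
rewrite exceed_meanE; apply: eq_integral => w _.
rewrite /f -EFinM -mulrA -expRD; congr (_ * expR _)%:E.
  rewrite !indicE; congr (nat_of_bool _)%:R; apply/idP/idP; rewrite !inE => H i.
    by have := H i; rewrite mulfD /= addrAC ltrBlDr.
  by have := H i; rewrite mulfD /= addrAC ltrBlDr.
rewrite (eq_bigr (fun j => th j * Z j w + th j * v j)); last first.
  by move=> j _; rewrite mulrDr.
rewrite [in RHS](eq_bigr (fun j => th j * Z j w - v j * Z j w)); last first.
  by move=> j _; rewrite mulrBl.
by rewrite big_split sumrB/=; lra.
Qed.

Lemma exp_mean th : (\int[P]_w (expR (\sum_j th j * Z j w))%:E =
  (expR ((\sum_j th j ^+ 2) / 2))%:E)%E.
Proof.
pose g (x z : 'I_d -> R) : \bar R := (expR (\sum_j th j * z j))%:E.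
have mg : measurable2 g.
  apply/measurable_EFinP; apply: measurableT_comp => //.
  by apply: measurable_sum => i; apply: measurable_funM => //; exact: measurable_untuple.
have g0 x z : (0 <= g x z)%E by rewrite lee_fin expR_ge0.
rewrite -[LHS]/(\int[P]_w g (e^~ w) (Z^~ w))%E.
rewrite (cameron_martin me mZ indepZ th mg g0).
under eq_integral => w _.
  rewrite -EFinM /cm_density -expRD.
  rewrite (eq_bigr (fun j => th j * Z j w + th j ^+ 2)); last first.
    by move=> j _; rewrite mulrDr expr2.
  rewrite big_split/= (_ : _ + _ + _ = (\sum_j th j ^+ 2) / 2); last by lra.
  over.
by rewrite integral_cst// [X in (_ * X)%E](probability_setT P) mule1.
Qed.

Lemma exceed_mean_le c c' th th' k k' :
  (forall w, exceed c w -> exceed c' w /\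
     \sum_j th j * Z j w + k <= \sum_j th' j * Z j w + k') ->
  (exceed_mean c th k <= exceed_mean c' th' k')%E.
Proof.
move=> H; rewrite !exceed_meanE; apply: ge0_le_integral => //.
move=> w _; rewrite lee_fin !indicE; case: (boolP (_ \in orthant_event c)) => [|_].
  rewrite inE => /H[H1 H2]; rewrite mem_set// !mul1r ler_expR//.
by rewrite mul0r mulr_ge0// expR_ge0.
Qed.

Lemma exceed_meanZ c th k r :
  (exceed_mean c th (k + r) = (expR r)%:E * exceed_mean c th k)%E.
Proof.
rewrite !exceed_meanE -ge0_integralZl//.
apply: eq_integral => w _; rewrite -EFinM; congr EFin.
by rewrite addrA expRD [RHS]mulrC mulrA.
Qed.

Variables (a at_ lam b : 'I_d -> R).
Hypotheses (bE : forall j, b j = \sum_i A i j * lam i)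
  (atE : forall i, at_ i = mulf b i) (le_a : forall i, a i <= at_ i)
  (lam_ge0 : forall i, 0 <= lam i)
  (slack : forall i, lam i * (at_ i - a i) = 0)
  (unitA : A \in unitmx).

(** With b = A^T lam and [at_] = A b = Sigma lam, this is the value of the quadratic form at [at_].
    The hypotheses are the optimality conditions of the programme: [lam] is the vector of
    multipliers and [slack] is complementary slackness. *)
Definition min_value : R := \sum_j b j ^+ 2.
Local Notation q := min_value.

Lemma dot_mulf z : \sum_j b j * z j = \sum_i lam i * mulf z i.
Proof.
under eq_bigr => j _ do rewrite bE mulr_suml.
rewrite exchange_big/=; apply: eq_bigr => i _; rewrite /mulf mulr_sumr.
by apply: eq_bigr => j _; rewrite mulrAC mulrC.
Qed.

(** Shift by u b. The shifted event forces <lam, A Z> >= <lam, K1>, because [lam] is nonnegative and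
    [slack] removes the term u (a - at_). This yields the exponential factor in u; an exponential
    moment bounds the rest. *)
Lemma exceed_mean_ub (u : R) c (K1 : 'I_d -> R) th : 0 <= u ->
  (forall i w, u * a i + K1 i <= c i + e i w) ->
  (exceed_mean c th (- (u * \sum_j th j * b j)) <=
   (expR (- (u ^+ 2 * q / 2) - u * \sum_i lam i * K1 i + (\sum_j th j ^+ 2) / 2))%:E)%E.
Proof.
move=> u0 hc; rewrite (exceed_mean_shift _ _ _ (fun j => u * b j)).
set r : R := - (u ^+ 2 * q / 2) - u * \sum_i lam i * K1 i.
have mexp : measurable_fun setT (fun w => (expR (\sum_j th j * Z j w))%:E).
  apply/measurable_EFinP; apply: measurableT_comp => //.
  by apply: measurable_sum => i; exact: measurable_funM.
rewrite [leRHS](_ : _ = (expR r)%:E *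
    \int[P]_w (expR (\sum_j th j * Z j w))%:E)%E; last first.
  by rewrite exp_mean -EFinM -expRD.
rewrite -(@ge0_integralZl _ _ _ P setT measurableT _ mexp (expR r)%:E); last 2 first.
- by move=> w _; rewrite lee_fin expR_ge0.
- by rewrite lee_fin expR_ge0.
rewrite exceed_meanE; apply: ge0_le_integral => //.
- by apply: emeasurable_funM => //; exact: measurable_cst.
move=> w _; rewrite -EFinM lee_fin -expRD indicE.
case: (boolP (_ \in orthant_event _)) => [|_]; last by rewrite mul0r expR_ge0.
rewrite inE mul1r ler_expR => ev.
rewrite (eq_bigr (fun j => th j * Z j w - u * (b j * Z j w))); last first.
  by move=> j _; rewrite mulrBl mulrA.
rewrite sumrB -mulr_sumr dot_mulf.
have -> : \sum_j th j * (u * b j) = u * \sum_j th j * b j.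
  by rewrite mulr_sumr; apply: eq_bigr => j _; rewrite mulrCA.
have -> : \sum_j (u * b j) ^+ 2 = u ^+ 2 * q.
  by rewrite mulr_sumr; apply: eq_bigr => j _; rewrite exprMn.
suff H : u * \sum_i lam i * K1 i <= u * \sum_i lam i * mulf (Z^~ w) i.
  by rewrite /r; lra.
apply: ler_wpM2l => //; apply: ler_sum => i _.
have ubE : mulf (fun j => u * b j) i = u * at_ i.
  by rewrite atE mulr_sumr; apply: eq_bigr => j _; rewrite mulrCA.
have := ev i; rewrite /= ubE => /ltW evi.
have := le_trans (lerB (hc i w) (lexx (u * at_ i))) _ => /(_ _ ltac:(rewrite addrAC; exact: evi)).
rewrite addrAC -mulrBr => /(ler_wpM2l (lam_ge0 i)).
rewrite (_ : lam i * (u * (a i - at_ i) + K1 i) =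
  lam i * K1 i - u * (lam i * (at_ i - a i))); last by ring.
by rewrite slack mulr0 subr0.
Qed.

Let solve (m : 'I_d -> R) : {z | forall i, mulf z i = m i}.
Proof.
exists (fun j => (invmx A *m \col_i m i) j 0) => i.
have /matrixP/(_ i 0) := mulKVmx unitA (\col_i m i).
by rewrite !mxE => <-; apply: eq_bigr => j _.
Qed.

Lemma small_ball_gt0 (r : R) : 0 < r ->
  (0 < P [set w | forall j, `|Z j w| <= r]%R)%E.
Proof.
move=> r0.
have := @indepZ (fun=> setT) (fun=> measurableT) (fun=> `[- r, r]%classic)
  (fun=> measurable_itv _).
rewrite [X in P X](_ : _ = [set w | forall j, `|Z j w| <= r]); last first.
  apply/seteqP; split=> [w [_ H] j|w H].
    by have := H j; rewrite /= in_itv/= ler_norml.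
  by split=> // j; rewrite /= in_itv/= -ler_norml.
move=> ->.
rewrite [P [set w | forall j : 'I_d, setT (e j w)]](_ : _ = 1%E) ?mul1e; last first.
  by rewrite -[RHS](probability_setT P); congr (P _); apply/seteqP; split.
elim/big_ind: _ => [|x y|i _]; [exact: lte01|exact: mule_gt0|].
by apply: normal_prob_gt0; rewrite gtrN.
Qed.

(** Shift by u b + k with A k = K2 + 1. Then a fixed small ball around the origin lies inside the
    event, and on it the density is bounded below up to a factor exp (- C1 u). *)
Lemma exceed_lb (K2 : 'I_d -> R) : exists c0 C1 : R, 0 < c0 /\
  forall (u : R) c, 0 <= u -> (forall i w, c i + e i w <= u * a i + K2 i) ->
  ((c0 * expR (- (u ^+ 2 * q / 2) - C1 * u))%:E <= P (exceed c))%E.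
Proof.
have [k kE] := solve (fun i => K2 i + 1).
(* This radius makes every coordinate of A z greater than -1 on the ball, which the surplus 1 in [k]
   compensates. *)
pose r : R := (1 + \sum_i \sum_j `|A i j|)^-1.
have r0 : 0 < r.
  by rewrite invr_gt0 ltr_wpDr// sumr_ge0// => i _; rewrite sumr_ge0.
have Ar z i : (forall j, `|z j| <= r) -> -1 < mulf z i.
  move=> zr; rewrite -ltrN2 opprK (le_lt_trans (ler_norm _))// normrN.
  apply: (@le_lt_trans _ _ (\sum_j `|A i j| * r)).
    apply: (le_trans (ler_norm_sum _ _ _)); apply: ler_sum => j _.
    by rewrite normrM ler_wpM2l.
  rewrite -mulr_suml ltr_pdivrMr ?mul1r; last first.
    by rewrite ltr_wpDr// sumr_ge0// => ? _; rewrite sumr_ge0.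
  rewrite [X in _ < 1 + X](bigD1 i)//= addrCA ltrDl ltr_wpDr// sumr_ge0// => ? _.
  by rewrite sumr_ge0.
pose S := [set w | forall j, `|Z j w| <= r].
have mS : measurable S.
  rewrite (_ : S = [set w | forall j, `[- r, r]%classic (Z j w)]); last first.
    by apply/seteqP; split=> w H j; have := H j; rewrite /= in_itv/= ler_norml.
  exact: (measurable_forall mZ (fun=> measurable_itv _)).
pose p0 := fine (P S).
have p00 : 0 < p0 by rewrite fine_gt0// small_ball_gt0//= ltey_eq fin_num_measure.
pose C1 := r * (\sum_j `|b j|) + \sum_j b j * k j.
pose c0 := p0 * expR (- (r * (\sum_j `|k j|)) - (\sum_j k j ^+ 2) / 2).
exists c0, C1; split; first by rewrite mulr_gt0// expR_gt0.
move=> u c u0 hc; pose v j := u * b j + k j.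
rewrite -exceed_mean0 (exceed_mean_shift _ _ _ v).
pose low : R := expR (- (r * (\sum_j `|k j|)) - (\sum_j k j ^+ 2) / 2) *
  expR (- (u ^+ 2 * q / 2) - C1 * u).
apply: (@le_trans _ _ (\int[P]_w ((\1_S w)%:E * low%:E))%E).
  rewrite ge0_integralZr//; last 2 first.
  - by apply/measurable_EFinP; exact: measurable_indic.
  - by rewrite lee_fin mulr_ge0// expR_ge0.
  rewrite integral_indic// setIT -[X in (_ <= X * _)%E]fineK ?fin_num_measure//.
  by rewrite -EFinM lee_fin /c0 /low -/p0 !mulrA.
rewrite exceed_meanE; apply: ge0_le_integral => //.
- by move=> w _; rewrite -EFinM lee_fin mulr_ge0// mulr_ge0// expR_ge0.
- by apply: emeasurable_funM => //; apply/measurable_EFinP; exact: measurable_indic.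
move=> w _; rewrite -EFinM lee_fin !indicE.
case: (boolP (w \in S)) => [|_]; last by rewrite mul0r mulr_ge0// expR_ge0.
rewrite inE mul1r => Sw; rewrite mem_set ?mul1r; last first.
  move=> i; rewrite /=.
  have -> : mulf v i = u * at_ i + (K2 i + 1).
    rewrite -kE atE mulr_sumr -big_split; apply: eq_bigr => j _.
    by rewrite /v mulrDr mulrCA.
  have := Ar (Z^~ w) i Sw; have := hc i w; have := ler_wpM2l u0 (le_a i).
  lra.
rewrite /low -expRD ler_expR.
have H1 : - (r * (u * (\sum_j `|b j|) + \sum_j `|k j|)) <= \sum_j (0 - v j) * Z j w.
  rewrite lerNl -sumrN mulr_sumr -big_split mulr_sumr/=; apply: ler_sum => j _.
  rewrite sub0r mulNr opprK; apply: (le_trans (ler_norm _)); rewrite normrM mulrC.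
  apply: ler_pM => //; apply: (le_trans (ler_normD _ _)).
  by rewrite normrM (ger0_norm u0).
have H2 : \sum_j v j ^+ 2 = u ^+ 2 * q + 2 * u * (\sum_j b j * k j) + \sum_j k j ^+ 2.
  rewrite !mulr_sumr -!big_split/=; apply: eq_bigr => j _; rewrite /v; ring.
have H3 : \sum_j 0 * v j = 0 by rewrite big1// => j _; rewrite mul0r.
rewrite H2 H3.
by move: H1; rewrite /C1; lra.
Qed.

Let exceed_mean_sum {I : Type} (s : seq I) c th (k : R) (ths : I -> 'I_d -> R) (ks : I -> R) (k0 : R) :
  (forall w, expR (\sum_j th j * Z j w + k) <=
    expR k0 + \sum_(i <- s) expR (\sum_j ths i j * Z j w + ks i)) ->
  (exceed_mean c th k <= (expR k0)%:E * P (exceed c) +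
    \sum_(i <- s) exceed_mean c (ths i) (ks i))%E.
Proof.
move=> H.
have -> : ((expR k0)%:E * P (exceed c) = exceed_mean c (fun=> 0%R) k0)%E.
  by rewrite -exceed_mean0 -exceed_meanZ add0r.
rewrite !exceed_meanE.
under [in leRHS]eq_bigr do rewrite exceed_meanE.
rewrite -ge0_integral_sum//.
rewrite -ge0_integralD//; last 2 first.
- by move=> w _; apply: sume_ge0.
- by apply: emeasurable_sum.
apply: ge0_le_integral => //.
- by apply: emeasurable_funD => //; exact: emeasurable_sum.
move=> w _; rewrite /f sumEFin -EFinD lee_fin -[X in _ <= _ + X]mulr_sumr -mulrDr.
apply: ler_wpM2l => //.
rewrite [X in expR (X + k0)]big1 ?add0r//; last by move=> j _; rewrite mul0r.
Qed.

(* Shifting Z by - A^-1 m / u produces the density exp (<z, Z> / u), up to a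
   negligible factor; Z / u concentrates at b = A^T lam on the event, and the
   contribution of |Z_j - u b_j| > del u is bounded by exponential moments. *)
Lemma exceed_ratio (K1 K2 m : 'I_d -> R) (eps : R) : 0 < eps ->
  exists2 u0 : R, 1 <= u0 & forall u c, u0 <= u ->
    (forall i w, u * a i + K1 i <= c i + e i w <= u * a i + K2 i) ->
    (P (exceed (fun i => c i - m i / u)%R) <=
      (expR (\sum_i m i * lam i) + eps)%:E * P (exceed c))%E.
Proof.
move=> eps0; have [z zE] := solve m; have [c0 [C1 [c00 lbP]]] := exceed_lb K2.
have zb : \sum_j z j * b j = \sum_i m i * lam i.
  rewrite (eq_bigr (fun j => b j * z j)) => [|j _]; last by rewrite mulrC.
  by rewrite dot_mulf; apply: eq_bigr => i _; rewrite zE mulrC.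
set M0 := expR (\sum_i m i * lam i).
have M00 : 0 < M0 by exact: expR_gt0.
pose kap := \sum_i lam i * K1 i.
(* Chosen so that M0 exp eps1 = M0 + eps / 2. *)
pose eps1 := ln (1 + eps / (2 * M0)).
have e1 : expR eps1 = 1 + eps / (2 * M0).
  by rewrite lnK// posrE addr_gt0// divr_gt0// mulr_gt0.
have eps10 : 0 < eps1 by rewrite ln_gt0// ltrDl divr_gt0// mulr_gt0.
have nz0 : 0 < 1 + \sum_j `|z j| by rewrite ltr_wpDr// sumr_ge0.
pose del := eps1 / (1 + \sum_j `|z j|).
have del0 : 0 < del by rewrite divr_gt0.
(* N del exceeds |C1| + |kap| by 1: each exponential-moment term is then at most a constant times
   exp (- u) times the lower bound of [exceed_lb]. *)
pose N := (`|C1| + `|kap| + 1) / del.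
have N0 : 0 < N by rewrite divr_gt0// ltr_wpDl// addr_ge0.
pose Q0 := \sum_j z j ^+ 2 + N ^+ 2.
pose D := (2 * d%:R) * expR Q0 / c0.
have D0 : 0 <= D by rewrite divr_ge0 ?(ltW c00)// mulr_ge0 ?expR_ge0.
exists (Num.max 1 (2 * M0 * D / eps)); first by rewrite le_max lexx.
move=> u c; rewrite ge_max => /andP[u1 uD] hc.
have u0 : 0 < u by exact: lt_le_trans u1.
pose sg (s : bool) : R := if s then 1 else -1.
(* One additional tilt by N for each coordinate and sign. Wherever |Z_j - u b_j| > del u, the tilt
   with the matching sign dominates the original exponential. *)
pose ths (p : 'I_d * bool) (j : 'I_d) : R := z j / u + (if j == p.1 then sg p.2 * N else 0).
pose ks (p : 'I_d * bool) : R := - (u * \sum_j ths p j * b j) - N * del * u.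
have sumths p (y : 'I_d -> R) : \sum_j ths p j * y j =
    (\sum_j z j * y j) / u + sg p.2 * N * y p.1.
  rewrite (eq_bigr (fun j => z j * y j / u +
    (if j == p.1 then sg p.2 * N * y p.1 else 0))); last first.
    by move=> j _; rewrite /ths mulrDl mulrAC; case: eqP => [->//|_]; rewrite mul0r.
  by rewrite big_split/= mulr_suml -big_mkcond big_pred1_eq.
have step1 : (P (exceed (fun i => c i - m i / u)%R) <=
    M0%:E * exceed_mean c (fun j => z j / u)%R (- \sum_i m i * lam i)%R)%E.
  rewrite -exceed_meanZ -exceed_mean0 (exceed_mean_shift _ _ _ (fun j => - (z j / u))).
  apply: exceed_mean_le => w ev; split.
    move=> i; have := ev i; congr (_ + _ < _).
    rewrite /mulf (eq_bigr (fun j => - (A i j * z j / u))); last first.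
      by move=> j _; rewrite mulrN mulrA.
    by rewrite sumrN -mulr_suml opprK -/(mulf z i) zE subrK.
  rewrite addNr addr0 add0r.
  rewrite [X in _ + (X - _)]big1 => [|j _]; last by rewrite mul0r.
  rewrite sub0r (eq_bigr (fun j => z j / u * Z j w)); last first.
    by move=> j _; rewrite sub0r opprK.
  by rewrite gerDl oppr_le0 divr_ge0// sumr_ge0// => j _; rewrite sqr_ge0.
have step2 : (exceed_mean c (fun j => z j / u)%R (- \sum_i m i * lam i)%R <=
    (expR eps1)%:E * P (exceed c) +
    \sum_(p : 'I_d * bool) exceed_mean c (ths p) (ks p))%E.
  apply: exceed_mean_sum => w; pose Y j := Z j w - u * b j.
  have zY : \sum_j z j / u * Z j w - \sum_i m i * lam i = (\sum_j z j * Y j) / u.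
    rewrite -zb (eq_bigr (fun j => z j * Y j / u + z j * b j)); last first.
      by move=> j _; rewrite /Y; field; rewrite gt_eqF.
    by rewrite big_split/= -mulr_suml addrK.
  have thY p : \sum_j ths p j * Z j w + ks p =
      (\sum_j z j * Y j) / u + N * (sg p.2 * Y p.1 - del * u).
    rewrite /ks !sumths -zY zb /Y.
    rewrite (_ : \sum_j z j / u * Z j w = (\sum_j z j * Z j w) / u); last first.
      by rewrite mulr_suml; apply: eq_bigr => j _; rewrite mulrAC.
    by field; rewrite gt_eqF.
  rewrite zY; under [in leRHS]eq_bigr do rewrite thY.
  have sum0 (Q : pred ('I_d * bool)) : 0 <= \sum_(p | Q p)
      expR ((\sum_j z j * Y j) / u + N * (sg p.2 * Y p.1 - del * u)).
    by apply: sumr_ge0 => p _; exact: expR_ge0.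
  have [/forallP H|] := boolP [forall j, `|Y j| <= del * u].
    apply: (@le_trans _ _ (expR eps1)); last by rewrite lerDl.
    rewrite ler_expR ler_pdivrMr//.
    apply: (@le_trans _ _ (\sum_j `|z j| * (del * u))).
      apply: ler_sum => j _; apply: (le_trans (ler_norm _)).
      by rewrite normrM ler_wpM2l.
    rewrite -mulr_suml mulrA ler_pM2r// /del mulrCA ler_piMr ?(ltW eps10)//.
    by rewrite ler_pdivrMr// mul1r lerDr.
  rewrite negb_forall => /existsP[j]; rewrite -ltNge => Yj.
  pose s := 0 <= Y j.
  have sY : sg s * Y j = `|Y j|.
    rewrite /sg /s; case: (leP 0 (Y j)) => Y0; first by rewrite mul1r ger0_norm.
    by rewrite mulN1r ltr0_norm.
  rewrite (bigD1 (j, s))//= sY.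
  rewrite (@le_trans _ _ (expR ((\sum_j z j * Y j) / u +
    N * (`|Y j| - del * u))))//.
    by rewrite ler_expR lerDl mulr_ge0 ?(ltW N0)// subr_ge0 ltW.
  by rewrite addrCA lerDl addr_ge0// expR_ge0.
have step3 p : (exceed_mean c (ths p) (ks p) <=
    (expR (Q0 - u) * expR (- (u ^+ 2 * q / 2) - C1 * u))%:E)%E.
  rewrite /ks exceed_meanZ.
  have h1 i w : u * a i + K1 i <= c i + e i w by have /andP[] := hc i w.
  apply: (le_trans (lee_wpmul2l _ (exceed_mean_ub (ths p) (ltW u0) h1))).
    by rewrite lee_fin expR_ge0.
  rewrite -EFinM lee_fin -!expRD ler_expR -/kap.
  have NdE : N * del = `|C1| + `|kap| + 1 by rewrite /N divfK// gt_eqF.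
  rewrite NdE.
  have thsQ : \sum_j ths p j ^+ 2 <= 2 * Q0.
    rewrite /Q0 mulrDr mulr_sumr.
    rewrite (_ : 2 * N ^+ 2 = \sum_j (if j == p.1 then 2 * N ^+ 2 else 0)); last first.
      by rewrite -big_mkcond big_pred1_eq.
    rewrite -big_split/=; apply: ler_sum => j _; rewrite /ths.
    have zu : (z j / u) ^+ 2 <= z j ^+ 2.
      rewrite exprMn ler_piMr ?sqr_ge0// exprVn invf_le1 ?exprn_gt0//.
      by rewrite exprn_ege1.
    have sgN : (sg p.2 * N) ^+ 2 = N ^+ 2.
      by rewrite exprMn /sg; case: ifP => _; rewrite ?sqrrN expr1n mul1r.
    have sq2 (x y : R) : (x + y) ^+ 2 <= 2 * x ^+ 2 + 2 * y ^+ 2.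
      have := sqr_ge0 (x - y); nra.
    apply: (le_trans (sq2 _ _)); apply: lerD; first by rewrite ler_pM2l.
    by case: eqP => _; rewrite ?sgN// expr0n mulr0.
  have C1u : - (`|C1| * u) <= - C1 * u.
    by rewrite -mulNr ler_pM2r// lerN2 ler_norm.
  have ku : - (`|kap| * u) <= u * kap.
    by rewrite [u * kap]mulrC -mulNr ler_pM2r// lerNl -normrN ler_norm.
  lra.
have hc2 i w : c i + e i w <= u * a i + K2 i by have /andP[] := hc i w.
have Plb := lbP u c (ltW u0) hc2.
set Pc := fine (P (exceed c)).
have PcE : P (exceed c) = Pc%:E.
  by rewrite fineK// fin_num_measure//; exact: measurable_exceed.
apply: (le_trans step1).
apply: (@le_trans _ _ (M0%:E * ((expR eps1)%:E * Pc%:E +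
   (2 * d%:R * (expR (Q0 - u) * expR (- (u ^+ 2 * q / 2) - C1 * u)))%:E))%E).
  apply: lee_wpmul2l; first by rewrite lee_fin ltW.
  apply: (le_trans step2); rewrite PcE; apply: leeD => //.
  apply: (le_trans (lee_sum _ (fun p _ => step3 p))).
  rewrite sumEFin lee_fin sumr_const card_prod card_ord card_bool.
  by rewrite -[X in X <= _]mulr_natl natrM [d%:R * _]mulrC.
rewrite PcE -[((expR eps1)%:E * _)%E]EFinM -EFinD.
rewrite -[X in (X <= _)%E]EFinM -[X in (_ <= X)%E]EFinM lee_fin.
move: Plb; rewrite PcE lee_fin => Plb.
set X := expR (- (u ^+ 2 * q / 2) - C1 * u) in Plb *.
have XP : X <= Pc / c0 by rewrite ler_pdivlMr// mulrC.
have Pc0 : 0 <= Pc by rewrite fine_ge0.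
have Eu : expR (Q0 - u) <= expR Q0 / u.
  rewrite expRD ler_pM2l ?expR_gt0// expRN lef_pV2 ?posrE ?expR_gt0//.
  by rewrite (le_trans _ (expR_ge1Dx u))// lerDr.
have B1 : M0 * (2 * d%:R * (expR (Q0 - u) * X)) <= eps / 2 * Pc.
  apply: (@le_trans _ _ (M0 * (2 * d%:R * (expR Q0 / u * (Pc / c0))))).
    by rewrite !ler_wpM2l// ?(ltW M00)// ler_pM// ?expR_ge0.
  have -> : M0 * (2 * d%:R * (expR Q0 / u * (Pc / c0))) = M0 * D / u * Pc.
    by rewrite /D; field; rewrite !gt_eqF.
  apply: ler_wpM2r => //; rewrite ler_pdivrMr//.
  move: uD; rewrite ler_pdivrMr//; lra.
have B2 : M0 * (expR eps1 * Pc) = M0 * Pc + eps / 2 * Pc.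
  by rewrite e1; field; rewrite gt_eqF.
by rewrite mulrDr B2; move: B1; lra.
Qed.

End orthant.

(** * First passage over a finite grid *)

Lemma measurable_forall_lt {R : realType} {dsp} {T : measurableType dsp}
    {J : finType} (f g : J -> T -> R) :
  (forall j, measurable_fun setT (f j)) -> (forall j, measurable_fun setT (g j)) ->
  measurable [set w | forall j, f j w < g j w].
Proof.
move=> mf mg.
have := @measurable_forall _ T R J (fun j w => g j w - f j w)
  (fun=> `]0, +oo[%classic) (fun j => measurable_funB (mg j) (mf j))
  (fun=> measurable_itv _).
congr measurable; apply/seteqP; split=> w H j; have := H j;
  by rewrite /= in_itv/= andbT subr_gt0.
Qed.

Lemma measurable_mulf {R : realType} {dsp} {T : measurableType dsp} {d}
    (A : 'M[R]_d) (x : 'I_d -> T -> R) i : (forall j, measurable_fun setT (x j)) ->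
  measurable_fun setT (fun w => mulf A (x^~ w) i).
Proof. by move=> mx; apply: measurable_sum => j; exact: measurable_funM. Qed.

Lemma mulfZ {R : realType} {d} (A : 'M[R]_d) r x i :
  mulf A (fun j => r * x j) i = r * mulf A x i.
Proof. by rewrite /mulf mulr_sumr; apply: eq_bigr => j _; rewrite mulrCA. Qed.

Lemma mulfB {R : realType} {d} (A : 'M[R]_d) x y i :
  mulf A (fun j => x j - y j) i = mulf A x i - mulf A y i.
Proof. by rewrite -sumrB; apply: eq_bigr => j _; rewrite mulrBr. Qed.

Section increments.
Context {R : realType} {dsp} {T : measurableType dsp} (P : probability T R).
Context {d : nat} (X : 'I_d -> R -> T -> R) (e : 'I_d -> T -> R).
Hypothesis BM : brownian_model P X e.

Let mX i t := bm_measurable BM i t.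
Let me i := bm_measurable_drift BM i.

(** [bm_indep] asks for a grid that starts at 0 and increases strictly: multiples of t serve if s =
    0, otherwise 0, s, t followed by filler, the increment over [0, s] being left unconstrained. *)
Lemma increment_indep (s t : R) (E : 'I_d -> set R) : 0 <= s -> s < t ->
  (forall i, measurable (E i)) ->
  indep_normal P [set w | forall i, E i (e i w)]
    (fun i w => X i t w - X i s w) (fun=> Num.sqrt (t - s)).
Proof.
move=> s0 st mE U mU.
have [s_0|s_neq0] := eqVneq s 0.
  pose r (k : nat) : R := k%:R * t.
  have rS k : r k < r k.+1.
    by rewrite /r ltr_pM2r ?ltr_nat//; rewrite -s_0.
  have := @bm_indep _ _ _ _ _ _ _ BM 1 r (mul0r _) rS E mE
    (fun p => U p.1) (fun p => mU _).
  rewrite [X in P X](_ : _ = [set w | forall i, E i (e i w)] `&`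
      [set w | forall j, U j (X j t w - X j s w)]); last first.
    congr (_ `&` _); apply/seteqP; split=> [w H j|w H [j k]].
      by have := H (j, ord0); rewrite /= /r mul0r mul1r s_0.
    by have := H j; rewrite [k]ord1/= /r mul0r mul1r s_0.
  move=> ->; congr (_ * _)%E.
  rewrite -(pair_bigA _ (fun (i : 'I_d) (k : 'I_1) =>
    normal_prob 0 (Num.sqrt (r k.+1 - r k)) (U i)))/=.
  by apply: eq_bigr => i _; rewrite big_ord1 /r mul0r mul1r s_0.
have {s_neq0}s0 : 0 < s by rewrite lt_neqAle eq_sym s_neq0.
have [r [r_0 r_1 r_2 rS]] : exists r : nat -> R,
    [/\ r 0%N = 0, r 1%N = s, r 2%N = t & forall k, r k < r k.+1].
  exists (fun k => match k with 0 => 0 | 1 => s | k'.+2 => t + k'%:R end).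
  split=> //=; first by rewrite addr0.
  by move=> [|[|k]]//=; rewrite ?addr0// ltrD2l ltr_nat.
have := @bm_indep _ _ _ _ _ _ _ BM 2 r r_0 rS E mE
  (fun p => if p.2 == ord_max then U p.1 else setT).
move=> /(_ (fun p => _)) H; rewrite [LHS](_ : _ = P ([set w | forall i, E i (e i w)] `&`
    [set w | forall p : 'I_d * 'I_2, (if p.2 == ord_max then U p.1 else setT)
       (X p.1 (r p.2.+1) w - X p.1 (r p.2) w)])); last first.
  congr (P (_ `&` _)); apply/seteqP; split=> [w H' [j k]|w H' j] /=.
    by case: ifP => // /eqP ->; have := H' j; rewrite /= r_1 r_2.
  by have := H' (j, ord_max); rewrite /= r_1 r_2.
rewrite H => [|[j k]]; last by case: ifP.
congr (_ * _)%E.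
rewrite -(pair_bigA _ (fun (i : 'I_d) (k : 'I_2) =>
  normal_prob 0 (Num.sqrt (r k.+1 - r k)) (if k == ord_max then U i else setT)))/=.
apply: eq_bigr => i _.
apply: (@etrans _ _ (normal_prob 0 (Num.sqrt (r 1%N - r 0%N)) setT *
  normal_prob 0 (Num.sqrt (r 2%N - r 1%N)) (U i))%E).
  rewrite big_ord_recl big_ord1; congr (_ * _)%E.
rewrite [X in (X * _)%E](_ : _ = 1%E); last exact: probability_setT.
by rewrite mul1e r_1 r_2.
Qed.

Lemma increment_scaling (s t : R) (S : ('I_d -> R) -> ('I_d -> R) -> Prop) :
  0 <= s -> s < t ->
  measurable [set x : #|{: 'I_d + 'I_d}|.-tuple R |
    S (fun i => untuple x (inl i)) (fun i => untuple x (inr i))] ->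
  P [set w | S (e^~ w) (fun i => X i t w - X i s w)] =
  P [set w | S (e^~ w) (fun i => Num.sqrt (t - s) * X i 1 w)].
Proof.
move=> s0 st mS; pose S' (f : 'I_d + 'I_d -> R) := S (fun i => f (inl i)) (fun i => f (inr i)).
have r0 : 0 < Num.sqrt (t - s) by rewrite sqrtr_gt0 subr_gt0.
have := @indep_normal_law _ _ _ _ _ P P _ _ e (fun i w => X i t w - X i s w)
  e (fun i w => Num.sqrt (t - s) * X i 1 w) (fun=> Num.sqrt (t - s)) S' me me.
apply => //.
- by move=> i; exact: measurable_funB.
- by move=> i; exact: measurable_funM.
- by move=> E mE; exact: increment_indep.
move=> E mE U mU; pose V i := (fun x : R => Num.sqrt (t - s) * x) @^-1` U i.
have mV i : measurable (V i).
  have : measurable_fun setT (fun x : R => Num.sqrt (t - s) * x).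
    exact: mulrl_measurable.
  by rewrite -[X in measurable X]setTI; exact.
have := @increment_indep 0 1 E (lexx _) ltr01 mE V mV.
rewrite [X in P X](_ : _ = [set w | forall i, E i (e i w)] `&`
    [set w | forall j, U j (Num.sqrt (t - s) * X j 1 w)]); last first.
  by congr (_ `&` _); apply/seteqP; split=> w H j; have := H j;
    rewrite /V/= (bm_zero BM) subr0.
have hi i : normal_prob 0 (Num.sqrt (1 - 0)) (V i) =
    normal_prob 0 (Num.sqrt (t - s)) (U i).
  apply: (@etrans _ _ (normal_prob 0 1 (V i))).
    by congr (normal_prob 0 _ _); rewrite subr0 sqrtr1.
  apply: esym; apply: (@etrans _ _ (normal_prob 0 (Num.sqrt (t - s) * 1) (U i))).
    by congr (normal_prob 0 _ _); rewrite mulr1.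
  exact: (normal_prob_scale r0 ltr01).
move=> H; apply: (etrans H).
exact: (congr1 (fun y => (P [set w | forall i, E i (e i w)] * y)%E)
  (eq_bigr _ (fun i _ => hi i))).
Qed.

Section first_passage.
Variables (t : nat -> R) (n : nat).
Hypotheses (t0 : t 0%N = 0) (tS : forall k, t k < t k.+1).

(** The path [w.1] up to [t k], continued with the increments of the independent path [w.2]. *)
Definition splice (k : nat) (i : 'I_d) (j : nat) (w : T * T) : R :=
  if (j <= k)%N then X i (t j) w.1
  else X i (t k) w.1 + (X i (t j) w.2 - X i (t k) w.2).

Let measurable_incr (p : 'I_d * 'I_n) :
  measurable_fun setT (fun w => X p.1 (t p.2.+1) w - X p.1 (t p.2) w).
Proof. exact: measurable_funB. Qed.

Let Z (k : nat) (p : 'I_d * 'I_n) (w : T * T) : R :=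
  let w' := if (p.2 < k)%N then w.1 else w.2 in
  X p.1 (t p.2.+1) w' - X p.1 (t p.2) w'.

Let measurable_Z k p : measurable_fun setT (Z k p).
Proof.
rewrite /Z; case: (p.2 < k)%N.
  exact: (measurableT_comp (measurable_incr p) measurable_fst).
exact: (measurableT_comp (measurable_incr p) measurable_snd).
Qed.

Let indep_Z k (E : 'I_d -> set R) : (forall i, measurable (E i)) ->
  indep_normal (P \x P)%E [set w | forall i, E i (e i w.1)] (Z k)
    (fun p => Num.sqrt (t p.2.+1 - t p.2)).
Proof.
move=> mE U mU.
pose U1 (p : 'I_d * 'I_n) : set R := if (p.2 < k)%N then U p else setT.
pose U2 (p : 'I_d * 'I_n) : set R := if (p.2 < k)%N then setT else U p.
have mU1 p : measurable (U1 p) by rewrite /U1; case: ifP.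
have mU2 p : measurable (U2 p) by rewrite /U2; case: ifP.
pose C1 := [set w | forall i, E i (e i w)] `&` [set w | forall p : 'I_d * 'I_n,
  U1 p (X p.1 (t p.2.+1) w - X p.1 (t p.2) w)].
pose C2 := [set w | forall i : 'I_d, setT (e i w)] `&` [set w | forall p : 'I_d * 'I_n,
  U2 p (X p.1 (t p.2.+1) w - X p.1 (t p.2) w)].
have mC1 : measurable C1.
  apply: measurableI; first exact: measurable_forall.
  exact: (measurable_forall measurable_incr).
have mC2 : measurable C2.
  apply: measurableI; first exact: (measurable_forall me (fun=> measurableT)).
  exact: (measurable_forall measurable_incr).
rewrite [X in (X * _)%E](_ : _ = P [set w | forall i, E i (e i w)]); last first.
  rewrite (_ : mkset _ = [set w | forall i, E i (e i w)] `*` setT).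
    rewrite product_probabilityE//; last exact: measurable_forall.
    by rewrite [X in (_ * X)%E](probability_setT P) mule1.
  by apply/seteqP; split=> w //= [].
rewrite [X in _ X = _](_ : _ = C1 `*` C2); last first.
  apply/seteqP; split=> [w [Ew H]|w [[Ew H1] [_ H2]]]; last first.
    split=> // p; have := H1 p; have := H2 p; rewrite /U1 /U2 /Z; by case: ifP.
  split; split=> //= p; have := H p; rewrite /Z /U1 /U2 /=; by case: ifP.
have H1 := @bm_indep _ _ _ _ _ _ _ BM n t t0 tS E mE U1 mU1.
have H2 := @bm_indep _ _ _ _ _ _ _ BM n t t0 tS (fun=> setT) (fun=> measurableT) U2 mU2.
rewrite product_probabilityE//.
apply: (etrans (congr2 mule H1 H2)).
rewrite [X in (_ * (X * _))%E](_ : _ = 1%E); last first.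
  by rewrite -[RHS](probability_setT P); congr (P _); apply/seteqP; split.
rewrite mul1e -muleA -big_split/=.
have hi (p : 'I_d * 'I_n) : (normal_prob 0 (Num.sqrt (t p.2.+1 - t p.2)) (U1 p) *
    normal_prob 0 (Num.sqrt (t p.2.+1 - t p.2)) (U2 p) =
    normal_prob 0 (Num.sqrt (t p.2.+1 - t p.2)) (U p))%E.
  rewrite /U1 /U2; case: ifP => _.
    by rewrite [X in (_ * X)%E = _](probability_setT (normal_prob _ _)) mule1.
  by rewrite [X in (X * _)%E = _](probability_setT (normal_prob _ _)) mul1e.
exact: (congr1 (fun y => (P [set w | forall i, E i (e i w)] * y)%E)
  (eq_bigr _ (fun p _ => hi p))).
Qed.

Let sum_incr i k w : (k <= n)%N ->
  \sum_(l < n | (l < k)%N) (X i (t l.+1) w - X i (t l) w) = X i (t k) w.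
Proof.
move=> kn; rewrite -(big_ord_widen_cond n xpredT (fun l => X i (t l.+1) w - X i (t l) w))//.
rewrite -(big_mkord xpredT (fun l => X i (t l.+1) w - X i (t l) w)).
by rewrite telescope_sumr// t0 (bm_zero BM) subr0.
Qed.

Let sum_Z k i j w : (k <= n)%N -> (j <= n)%N ->
  \sum_(l < n | (l < j)%N) Z k (i, l) w = splice k i j w.
Proof.
move=> kn jn; rewrite /splice; case: leqP => [jk|kj].
  rewrite -(sum_incr i w.1 jn); apply: eq_bigr => l lj.
  by rewrite /Z/= (leq_trans lj).
rewrite -(sum_incr i w.1 kn) -(sum_incr i w.2 jn) -(sum_incr i w.2 kn).
rewrite [in RHS](bigID (fun l : 'I_n => (l < k)%N) (fun l : 'I_n => (l < j)%N))/=.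
rewrite [in LHS](bigID (fun l : 'I_n => (l < k)%N) (fun l : 'I_n => (l < j)%N))/=.
have kE (F : 'I_n -> R) : \sum_(l < n | (l < j)%N && (l < k)%N) F l = \sum_(l < n | (l < k)%N) F l.
  apply: eq_bigl => l; case: (ltnP l k) => lk; last by rewrite andbF.
  by rewrite (ltn_trans lk kj).
rewrite !kE addrAC subrr add0r; congr (_ + _).
  by apply: eq_bigr => l lk; rewrite /Z/= lk.
by apply: eq_bigr => l /andP[_ /negbTE lk]; rewrite /Z/= lk.
Qed.

(** Markov property at [t k]: replacing the later increments by those of an independent copy
    preserves the law on the grid, jointly with the drift. The index is capped by [minn j n] because
    only finitely many increments are involved. *)
Lemma splice_law (k : nat) (S : ('I_d -> R) -> ('I_d -> nat -> R) -> Prop) :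
  (k <= n)%N ->
  measurable [set x : #|{: 'I_d + 'I_d * 'I_n}|.-tuple R |
    S (fun i => untuple x (inl i))
      (fun i j => \sum_(l < n | (l < j)%N) untuple x (inr (i, l)))] ->
  P [set w | S (e^~ w) (fun i j => X i (t (minn j n)) w)] =
  (P \x P)%E [set w | S (e^~ w.1) (fun i j => splice k i (minn j n) w)].
Proof.
move=> kn mS.
pose S' (f : 'I_d + 'I_d * 'I_n -> R) := S (fun i => f (inl i))
  (fun i j => \sum_(l < n | (l < j)%N) f (inr (i, l))).
have me1 i : measurable_fun setT (fun w : T * T => e i w.1).
  exact: (measurableT_comp (me i)).
have ee (E : 'I_d -> set R) : (forall i, measurable (E i)) ->
    P [set w | forall i, E i (e i w)] = (P \x P)%E [set w | forall i, E i (e i w.1)].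
  move=> mE; have mE0 : measurable [set w | forall i, E i (e i w)].
    exact: measurable_forall.
  rewrite [X in _ = _ X](_ : _ = [set w | forall i, E i (e i w)] `*` setT).
    by rewrite product_probabilityE// [X in (_ * X)%E](probability_setT P) mule1.
  by apply/seteqP; split=> w //= [].
have := @indep_normal_law _ _ _ _ _ P (P \x P)%E _ _ e
  (fun (p : 'I_d * 'I_n) w => X p.1 (t p.2.+1) w - X p.1 (t p.2) w)
  (fun i w => e i w.1) (Z k) (fun p => Num.sqrt (t p.2.+1 - t p.2)) S' me me1
  measurable_incr (measurable_Z k) ee
  (fun E mE => @bm_indep _ _ _ _ _ _ _ BM n t t0 tS E mE)
  (fun E mE => indep_Z k mE) mS.
have minE (F : 'I_n -> R) j : \sum_(l < n | (l < minn j n)%N) F l = \sum_(l < n | (l < j)%N) F l.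
  by apply: eq_bigl => l; rewrite leq_min ltn_ord andbT.
rewrite [X in P X = _ -> _](_ : _ = [set w | S (e^~ w) (fun i j => X i (t (minn j n)) w)]); last first.
  apply/seteqP; split=> w; rewrite /S' /=; congr (S _ _);
    apply/funext => i; apply/funext => j;
    by rewrite -minE (sum_incr i w (geq_minr j n)).
move=> ->; congr (_ _); apply/seteqP; split=> w; rewrite /S' /=; congr (S _ _);
  apply/funext => i; apply/funext => j;
  by rewrite -minE (sum_Z i w kn (geq_minr j n)).
Qed.

Variable A : 'M[R]_d.

Definition above (b : 'I_d -> R) (s : R) : set T :=
  [set w | forall i, b i + s * e i w < mulf A (fun j => X j s w) i].

Lemma measurable_above b s : measurable (above b s).
Proof.
apply: measurable_forall_lt => i; last by apply: measurable_mulf => j; exact: mX.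
by apply: measurable_funD => //; exact: measurable_funM.
Qed.

(** After splicing at [t k], the past and the drift depend on the first sample only and the future
    increment on the second, so the event becomes a product set. *)
Let past_future (q : pred nat) (b D : 'I_d -> R) (k g : nat) : (k <= g <= n)%N ->
  let past := above b (t k) `&` [set w | forall k' : 'I_k, q k' -> ~ above b (t k') w] in
  let future := [set w | forall i, D i < mulf A (fun j => X j (t g) w - X j (t k) w) i] in
  P (past `&` future) = (P past * P future)%E.
Proof.
move=> /andP[kg gn] past future; have kn := leq_trans kg gn.
pose S1 (y : 'I_d -> R) (x : 'I_d -> nat -> R) :=
  (forall i, b i + t k * y i < mulf A (x^~ k) i) /\
  (forall k' : 'I_k, q k' -> ~ (forall i, b i + t k' * y i < mulf A (x^~ k') i)).
pose S2 (x : 'I_d -> nat -> R) := forall i, D i < mulf A (fun j => x j g - x j k) i.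
have mS1 dsp' (T' : measurableType dsp') (y : 'I_d -> T' -> R) (x : 'I_d -> nat -> T' -> R) :
    (forall i, measurable_fun setT (y i)) -> (forall i j, measurable_fun setT (x i j)) ->
    measurable [set w | S1 (y^~ w) (fun i j => x i j w)].
  move=> my mx.
  have m1 k' : measurable [set w | forall i, b i + t k' * y i w < mulf A (fun j => x j k' w) i].
    apply: measurable_forall_lt => i; last exact: measurable_mulf.
    by apply: measurable_funD => //; exact: measurable_funM.
  apply: measurableI; first exact: m1.
  rewrite [X in measurable X](_ : _ = \bigcap_(k' in [set: 'I_k]) (if q k' then
    ~` [set w | forall i, b i + t k' * y i w < mulf A (fun j => x j k' w) i] else setT)).
    by apply: fin_bigcap_measurable => // k' _; case: (q k') => //; exact: measurableC.
  apply/seteqP; split=> [w H k' _|w H k' qk']; first by have := H k'; case: (q k') => //; exact.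
  by have := H k' Logic.I; rewrite qk'.
have mS2 dsp' (T' : measurableType dsp') (x : 'I_d -> nat -> T' -> R) :
    (forall i j, measurable_fun setT (x i j)) ->
    measurable [set w | S2 (fun i j => x i j w)].
  move=> mx; apply: measurable_forall_lt => i //; apply: measurable_mulf => j.
  exact: measurable_funB.
pose S y x := S1 y x /\ S2 x.
have mS : measurable [set x : #|{: 'I_d + 'I_d * 'I_n}|.-tuple R |
    S (fun i => untuple x (inl i))
      (fun i j => \sum_(l < n | (l < j)%N) untuple x (inr (i, l)))].
  have mx i j : measurable_fun setT (fun x : #|{: 'I_d + 'I_d * 'I_n}|.-tuple R =>
      \sum_(l < n | (l < j)%N) untuple x (inr (i, l))).
    rewrite [X in measurable_fun _ X](_ : _ = fun x : _.-tuple R =>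
      \sum_(l < n) if (l < j)%N then untuple x (inr (i, l)) else 0).
      by apply: measurable_sum => l; case: (l < j)%N => //; exact: measurable_untuple.
    by apply/funext => x; rewrite -big_mkcond.
  apply: measurableI; first exact: (mS1 _ _ (fun i x => untuple x (inl i)) _
    (fun i => measurable_untuple (inl i)) mx).
  exact: (mS2 _ _ _ mx).
have mpast : measurable past by exact: (mS1 _ _ e (fun i j => X i (t j))).
have mfuture : measurable future by exact: (mS2 _ _ (fun i j => X i (t j))).
have mink k' : (k' <= k)%N -> minn k' n = k'.
  by move=> kk; apply/minn_idPl; exact: leq_trans kk kn.
have ming : minn g n = g by exact/minn_idPl.
have spl k' w : (k' <= k)%N -> (fun i => splice k i (minn k' n) w) = (fun i => X i (t k') w.1).
  by move=> kk; apply/funext => i; rewrite mink// /splice kk.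
have splg w : (fun i => splice k i (minn g n) w - splice k i (minn k n) w) =
    (fun i => X i (t g) w.2 - X i (t k) w.2).
  apply/funext => i; rewrite ming mink// /splice leqnn.
  case: leqP => [gk|_]; last by rewrite addrAC subrr add0r.
  by rewrite (_ : g = k) ?subrr//; apply/eqP; rewrite eqn_leq gk.
have := splice_law kn mS.
rewrite [X in P X = _](_ : _ = past `&` future); last first.
  apply/seteqP; split=> w; rewrite /S/S1/S2/past/future/above/=.
    rewrite ming (mink k)// => -[[H1 H2] H3]; split=> //; split=> // k' qk' H.
    by apply: (H2 k' qk'); rewrite mink// ltnW.
  move=> [[H1 H2] H3]; rewrite ming (mink k)//; split=> //; split=> // k' qk' H.
  by apply: (H2 k' qk'); move: H; rewrite mink// ltnW.
move=> ->; rewrite [X in _ X = _](_ : _ = past `*` future).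
  by rewrite product_probabilityE.
apply/seteqP; split=> w; rewrite /S/S1/S2/past/future/above/=.
  rewrite spl// splg => -[[H1 H2] H3]; split=> //; split=> // k' qk' H.
  by apply: (H2 k' qk'); rewrite spl// ltnW.
move=> [[H1 H2] H3]; rewrite spl// splg; split=> //; split=> // k' qk' H.
by apply: (H2 k' qk'); move: H; rewrite spl// ltnW.
Qed.

(* At the first grid time t k at which the process exceeds b, its increment up to
   t (g k) is independent of the past, so it stays above - kap with at least
   the probability of the first factor. *)
Lemma first_passage (q : pred nat) (g : nat -> nat) (b K2 : 'I_d -> R) (D kap : R) :
  0 < D -> 0 <= kap -> (forall i w, e i w <= K2 i) -> (forall i, 0 <= K2 i) ->
  (forall k, q k -> (k <= n)%N -> (k <= g k <= n)%N && (t (g k) - t k <= D)) ->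
  (P [set w | forall i, (Num.sqrt D * K2 i - kap / Num.sqrt D < mulf A (X^~ 1^~ w) i)%R] *
   P [set w | exists2 k, q k && (k <= n)%N & above b (t k) w] <=
   P [set w | exists2 k, q k && (k <= n)%N & above (fun i => b i - kap)%R (t (g k)) w])%E.
Proof.
move=> D0 kap0 eK2 K20 hg; set theta := P _.
pose F k := if q k && (k <= n)%N then above b (t k) else set0.
have mF k : measurable (F k) by rewrite /F; case: ifP => _ //; exact: measurable_above.
(* If [g k = k] the increment is 0, and the bound -1 makes [G k] certain. *)
pose Dg k i := if g k == k then -1 else (t (g k) - t k) * K2 i - kap.
pose G k := [set w | forall i, Dg k i < mulf A (fun j => X j (t (g k)) w - X j (t k) w) i].
have mG k : measurable (G k).
  apply: measurable_forall_lt => i //; apply: measurable_mulf => j; exact: measurable_funB.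
(* Disjointification yields the first-passage decomposition: [seqDU F k] says that [t k] is the
   first selected time at which [b] is exceeded. *)
have FE k : q k -> (k <= n)%N -> seqDU F k =
    above b (t k) `&` [set w | forall k' : 'I_k, q k' -> ~ above b (t k') w].
  move=> qk kn; rewrite /seqDU {1}/F qk kn setDE; congr (_ `&` _).
  apply/seteqP; split=> w.
    move=> H k' qk' ab; apply: H; rewrite -bigcup_mkord; exists (nat_of_ord k') => //=.
    by rewrite /F qk' (leq_trans (ltnW (ltn_ord k')) kn).
  move=> H; rewrite -bigcup_mkord => -[k' /= k'k]; rewrite /F.
  by case: ifP => // /andP[qk' _]; exact: (H (Ordinal k'k)).
have thetaG k : q k -> (k <= n)%N -> (theta <= P (G k))%E.
  move=> qk kn; have /andP[/andP[kg gn] tD] := hg k qk kn.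
  have [gk|gk] := eqVneq (g k) k.
    rewrite (_ : G k = setT).
      rewrite probability_setT probability_le1//.
      by apply: measurable_forall_lt => i //; exact: measurable_mulf.
    apply/seteqP; split=> // w _ i; rewrite /Dg gk eqxx.
    by rewrite mulfB subrr oppr_lt0.
  have tkg : t k < t (g k).
    by apply: (homo_ltn (@lt_trans _ _) tS); rewrite ltn_neqAle eq_sym gk.
  have tk0 : 0 <= t k.
    by rewrite -t0; apply: (homo_leq (@lexx _ _) (@le_trans _ _) (fun k => ltW (tS k))).
  pose S (y x : 'I_d -> R) := forall i, Dg k i < mulf A x i.
  have mS : measurable [set x : #|{: 'I_d + 'I_d}|.-tuple R |
      S (fun i => untuple x (inl i)) (fun i => untuple x (inr i))].
    apply: measurable_forall_lt => i //.
    exact: (measurable_mulf _ _ (fun j => measurable_untuple (inr j))).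
  rewrite [leRHS](increment_scaling tk0 tkg mS).
  set h := t (g k) - t k in tD *.
  have h0 : 0 < h by rewrite subr_gt0.
  apply: le_measure; rewrite ?inE.
  - by apply: measurable_forall_lt => i //; exact: measurable_mulf.
  - by apply: measurable_forall_lt => i //; apply: measurable_mulf => j; exact: measurable_funM.
  (* Divided by sqrt h, the bound is sqrt h K2 - kap / sqrt h, which is nondecreasing in h since
     [K2] and [kap] are nonnegative; hence h <= D allows comparison with the value at D. *)
  move=> w H i; rewrite mulfZ /Dg (negbTE gk) -/h -ltr_pdivrMl ?sqrtr_gt0//.
  apply: le_lt_trans (H i).
  have hE : h = Num.sqrt h * Num.sqrt h by rewrite -expr2 sqr_sqrtr// ltW.
  have sh0 : 0 < Num.sqrt h by rewrite sqrtr_gt0.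
  rewrite mulrBr {2}hE -mulrA mulKf ?gt_eqF//; apply: lerB.
    by rewrite ler_wpM2r// ler_wsqrtr.
  rewrite [leRHS]mulrC ler_wpM2l// lef_pV2 ?posrE ?sqrtr_gt0// ler_wsqrtr//.
rewrite (_ : [set w | exists2 k, _ & above b _ w] = \big[setU/set0]_(k < n.+1) seqDU F k); last first.
  rewrite -bigsetU_seqDU -bigcup_mkord; apply/seteqP; split=> w.
    by move=> [k /andP[qk kn] ab]; exists k => //=; rewrite /F qk kn.
  by move=> [k /= kn]; rewrite /F; case: ifP => // qk ab; exists k.
have mS k : measurable (seqDU F k).
  by apply: measurableD => //; apply: bigsetU_measurable.
have tD (i j : 'I_n.+1) : i != j -> seqDU F i `&` seqDU F j = set0.
  by have /trivIsetP := @trivIset_seqDU _ F; apply.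
rewrite measure_semi_additive_ord//; last 2 first.
- apply/trivIsetP => i j _ _ ij; exact: tD.
- by apply: bigsetU_measurable.
pose H k := seqDU F k `&` G k.
have mH k : measurable (H k) by exact: measurableI.
apply: (@le_trans _ _ (P (\big[setU/set0]_(k < n.+1) H k))).
  rewrite measure_semi_additive_ord//; last 2 first.
  - by apply/trivIsetP => i j _ _ ij; rewrite /H setIACA tD// set0I.
  - by apply: bigsetU_measurable.
  rewrite ge0_sume_distrr//; apply: lee_sum => k _.
  have [qk|qk] := boolP (q k); last first.
    by rewrite /seqDU {1}/F (negbTE qk) set0D measure0 mule0.
  have kn : (k <= n)%N by rewrite -ltnS.
  have /andP[kgn _] := hg k qk kn.
  rewrite /H FE// [leRHS](past_future q b (Dg k) kgn).
  by rewrite muleC lee_wpmul2l// thetaG.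
have mR : measurable [set w | exists2 k, q k && (k <= n)%N &
    above (fun i => b i - kap)%R (t (g k)) w].
  rewrite (_ : mkset _ = \bigcup_(k in [set k | q k && (k <= n)%N])
    above (fun i => b i - kap)%R (t (g k))).
    by apply: bigcup_measurable => k _; exact: measurable_above.
  by apply/seteqP; split=> w [k kq ab]; exists k.
apply: le_measure; rewrite ?inE//; first by apply: bigsetU_measurable.
rewrite -bigcup_mkord => w [k /= kn [Fk Gk]]; exists k.
  by case: Fk; rewrite /F; case: ifP.
have qk : q k by case: Fk; rewrite /F; case: ifP => // /andP[].
have {Fk}ab : above b (t k) w by case: Fk; rewrite /F; case: ifP.
move=> i; have := Gk i; have := ab i; rewrite /Dg mulfB.
have [->|gk] := eqVneq (g k) k; first by move=> lt_b _; lra.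
have /andP[/andP[kg _] _] := hg k qk kn.
have tkg : 0 <= t (g k) - t k.
  rewrite subr_ge0; exact: (homo_leq (@lexx _ _) (@le_trans _ _) (fun k => ltW (tS k))).
have := ler_wpM2l tkg (eK2 i w); rewrite /above; lra.
Qed.

End first_passage.
End increments.

(** * Exponential volume of unions of orthants *)

Lemma measurable_expRM {R : realType} (l : R) (D : set R) :
  measurable_fun D (fun x : R => expR (l * x)).
Proof.
have ml : measurable_fun setT (fun x : R => l * x) by exact: mulrl_measurable.
exact: measurable_funTS (measurableT_comp (@measurable_expR R) ml).
Qed.

(** Reflection turns the integrand into 1 / l times the exponential density, whose total mass is
    1. *)
Lemma integral_expR_half_line {R : realType} (l : R) : 0 < l ->
  (\int[lebesgue_measure]_(x in `]-oo, 0%R[) (expR (l * x))%:E = (l^-1)%:E)%E.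
Proof.
move=> l0.
have cexp : continuous (fun x : R^o => expR (l * x)).
  move=> x; apply: continuous_comp; last exact: continuous_expR.
  by apply: continuousM => //; exact: cst_continuous.
have mexp D : measurable_fun D (fun x : R => (expR (l * x))%:E).
  by apply/measurable_EFinP; exact: measurable_expRM.
rewrite integral_itv_bndo_bndc// -[0]oppr0 ge0_integration_by_substitutionNy; last 2 first.
- by apply: continuous_subspaceT.
- by move=> x _; exact: expR_ge0.
have := integral_exponential_pdf l0.
rewrite [X in X = _ -> _](_ : _ =
    (\int[lebesgue_measure]_(x in `[0%R, +oo[) (l%:E * (expR (l * - x))%:E))%E); last first.
  rewrite [RHS]integral_mkcond; apply: eq_integral => x _; rewrite patchE /exponential_pdf patchE.
  by case: ifP => // _; rewrite -EFinM mulrN mulNr.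
rewrite ge0_integralZl//; last 2 first.
- apply/measurable_EFinP; rewrite (_ : (fun x => _) = fun x => expR (- l * x)).
    exact: measurable_expRM.
  by apply/funext => x; rewrite mulrN mulNr.
- by rewrite lee_fin ltW.
move=> H; have /(congr1 (fun y => (l^-1)%:E * y)%E) := H.
by rewrite muleA -EFinM mulVf ?gt_eqF// mul1e mule1.
Qed.

Lemma integral_expR_lt {R : realType} (l m : R) : 0 < l ->
  (\int[lebesgue_measure]_x ((x < m)%R%:R * expR (l * x))%:E = (expR (l * m) / l)%:E)%E.
Proof.
move=> l0; rewrite (ge0_integral_shift m); last 2 first.
- apply/measurable_EFinP; apply: measurable_funM; last exact: measurable_expRM.
  rewrite (_ : (fun x => _) = \1_(`]-oo, m[%classic)); first exact: measurable_indic.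
  by apply/funext => x; rewrite indicE mem_setE in_itv.
- by move=> x; rewrite lee_fin mulr_ge0// expR_ge0.
transitivity (\int[lebesgue_measure]_(x in `]-oo, 0%R[)
    ((expR (l * m))%:E * (expR (l * x))%:E))%E.
  rewrite [RHS]integral_mkcond; apply: eq_integral => x _.
  rewrite patchE mem_setE in_itv/= gtrDr.
  by case: ifP => _; rewrite ?mul0r// mul1r -EFinM -expRD mulrDr addrC.
rewrite ge0_integralZl//; last by apply/measurable_EFinP; exact: measurable_expRM.
by rewrite integral_expR_half_line// -EFinM.
Qed.

Lemma ge0_integral_lebesgue_tuple_prod {R : realType} (n : nat) (f : 'I_n -> R -> R) :
  (forall k, measurable_fun setT (f k)) -> (forall k x, 0 <= f k x) ->
  (\int[lebesgue_tuple n]_x (\prod_k f k (tnth x k))%:E =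
   \prod_k \int[lebesgue_measure]_x (f k x)%:E)%E.
Proof.
elim: n f => [|n IH] f mf f0.
  rewrite big_ord0; under eq_integral do rewrite big_ord0.
  by rewrite integral_cst// mul1e; exact: diracT.
pose tcons (p : R * n.-tuple R) : n.+1.-tuple R := [tuple of p.1 :: p.2].
have mtcons : measurable_fun setT tcons by exact: measurable_cons.
pose F (x : n.+1.-tuple R) := (\prod_k f k (tnth x k))%:E.
have mprod n' (g : 'I_n' -> R -> R) : (forall k, measurable_fun setT (g k)) ->
    measurable_fun setT (fun x : n'.-tuple R => (\prod_k g k (tnth x k))%:E).
  move=> mg; apply/measurable_EFinP; apply: measurable_prod => k.
  by move=> _; exact: (measurableT_comp (mg k) (measurable_tnth k)).
have F0 x : (0 <= F x)%E by rewrite lee_fin prodr_ge0.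
transitivity (\int[(@lebesgue_measure R \x lebesgue_tuple n)%E]_p (F \o tcons) p)%E.
  rewrite -(@ge0_integral_pushforward _ _ (measurableTypeR R * n.-tuple R)%type
    _ _ tcons mtcons (@lebesgue_measure R \x lebesgue_tuple n)%E setT F measurableT
    (mprod _ _ mf) (fun x _ => F0 x)).
  by [].
rewrite (@fubini_tonelli1 _ _ (measurableTypeR R) (n.-tuple R) R); last 2 first.
- exact: (measurableT_comp (mprod _ _ mf)).
- by move=> x; exact: F0.
rewrite big_ord_recl -(IH (fun k => f (lift ord0 k)))//.
under eq_integral => x _.
  rewrite (_ : fubini_F _ _ x = (f ord0 x)%:E *
    \int[lebesgue_tuple n]_y (\prod_k f (lift ord0 k) (tnth y k))%:E)%E; first over.
  rewrite /fubini_F -ge0_integralZl//; last 3 first.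
  - exact: (mprod _ (fun k => f (lift ord0 k)) (fun k => mf _)).
  - by move=> y _; rewrite lee_fin prodr_ge0.
  - by rewrite lee_fin.
  apply: eq_integral => y _; rewrite /= /F big_ord_recl -EFinM tnth0.
  by congr (_ * _)%:E; apply: eq_bigr => k _; rewrite tnthS.
rewrite ge0_integralZr//.
- by apply/measurable_EFinP; exact: mf.
- by move=> x _; rewrite lee_fin.
by apply: integral_ge0 => y _; rewrite lee_fin prodr_ge0.
Qed.

Section hit.
Context {R : realType} {J : finType}.
Implicit Types (x m : J -> R) (l : seq (J -> R)).

(* x lies in the union of the orthants below the elements of l; the list
   map (minf m) l describes the intersection with the orthant below m. *)
Definition hit l x : bool := has (fun m => [forall j, x j < m j]) l.

Definition minf m m' (j : J) : R := Num.min (m j) (m' j).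

Lemma hit_minf m l x : hit (map (minf m) l) x = hit [:: m] x && hit l x.
Proof.
elim: l => [|m' l IH]; first by rewrite andbF.
rewrite /= IH andb_orr; congr (_ || _); rewrite orbF.
apply/forallP/andP => [H|[/forallP H1 /forallP H2] j]; last by rewrite lt_min H1 H2.
by split; apply/forallP => j; have := H j; rewrite lt_min => /andP[].
Qed.

(** Inclusion-exclusion for [m :: l] calls on both [l] and [map (minf m) l]. These have the same
    length, so induction on the length covers the two. *)
Lemma minf_ind (Q : seq (J -> R) -> Prop) : Q [::] ->
  (forall m l, Q l -> Q (map (minf m) l) -> Q (m :: l)) -> forall l, Q l.
Proof.
move=> Q0 QS l; have [n] := ubnP (size l); elim: n l => // n IH [//|m l].
by rewrite /= ltnS => ln; apply: QS; apply: IH; rewrite ?size_map.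
Qed.

Lemma measurable_hit {dsp} {T : measurableType dsp} l (x : J -> T -> R) :
  (forall j, measurable_fun setT (x j)) -> measurable [set w | hit l (x^~ w)].
Proof.
move=> mx; elim: l => [|m l IH].
  by rewrite (_ : mkset _ = set0)//; apply/seteqP; split.
rewrite (_ : mkset _ = [set w | forall j, x j w < m j] `|` [set w | hit l (x^~ w)]).
  by apply: measurableU => //; exact: measurable_forall_lt.
apply/seteqP; split=> w /=; first by move=> /orP[/forallP|]; [left|right].
by move=> [H|->]; rewrite ?orbT//; apply/orP; left; exact/forallP.
Qed.

Lemma measurable_fun_hit {dsp} {T : measurableType dsp} l (x : J -> T -> R) :
  (forall j, measurable_fun setT (x j)) ->
  measurable_fun setT (fun w => (hit l (x^~ w))%:R : R).
Proof.
move=> mx; rewrite (_ : (fun w => _) = \1_[set w | hit l (x^~ w)]).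
  by apply: measurable_indic; exact: measurable_hit.
by apply/funext => w; rewrite indicE; congr (nat_of_bool _)%:R; apply/idP/idP; rewrite inE.
Qed.

End hit.

Section exp_volume.
Context {R : realType} {n : nat} (lam : 'I_n -> R).
Hypothesis lam_gt0 : forall k, 0 < lam k.
Implicit Types (m : 'I_n -> R) (l : seq ('I_n -> R)).

Definition exp_volume l : \bar R := \int[lebesgue_tuple n]_x
  ((hit l (tnth x))%:R * expR (\sum_k lam k * tnth x k))%:E.

Lemma measurable_exp_volume l : measurable_fun setT (fun x : n.-tuple R =>
  ((hit l (tnth x))%:R * expR (\sum_k lam k * tnth x k))%:E).
Proof.
apply/measurable_EFinP; apply: measurable_funM.
  exact: (measurable_fun_hit l (fun k => measurable_tnth k)).
apply: measurableT_comp => //; apply: measurable_sum => k.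
by apply: measurable_funM => //; exact: measurable_tnth.
Qed.

Let ge0 l (x : n.-tuple R) :
  (0 <= ((hit l (tnth x))%:R * expR (\sum_k lam k * tnth x k))%:E)%E.
Proof. by rewrite lee_fin mulr_ge0// expR_ge0. Qed.

Lemma exp_volume_ge0 l : (0 <= exp_volume l)%E.
Proof. by apply: integral_ge0 => x _; exact: ge0. Qed.

Lemma exp_volume1 m :
  exp_volume [:: m] = (expR (\sum_k lam k * m k) / \prod_k lam k)%:E.
Proof.
transitivity (\int[lebesgue_tuple n]_x
    (\prod_k ((tnth x k < m k)%R%:R * expR (lam k * tnth x k)))%:E)%E.
  apply: eq_integral => x _; rewrite big_split/= -expR_sum; congr (_ * _)%:E.
  rewrite orbF; apply: esym; case: (boolP [forall k, _]) => [/forallP H|].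
    by rewrite big1// => k _; rewrite H.
  by rewrite negb_forall => /existsP[k kx]; rewrite (bigD1 k)//= (negbTE kx) mul0r.
rewrite (@ge0_integral_lebesgue_tuple_prod R n
  (fun k x => (x < m k)%R%:R * expR (lam k * x))); last 2 first.
- move=> k; apply: measurable_funM; last exact: measurable_expRM.
  rewrite (_ : (fun x => _) = \1_(`]-oo, m k[%classic)); first exact: measurable_indic.
  by apply/funext => x; rewrite indicE mem_setE in_itv.
- by move=> k x; rewrite mulr_ge0// expR_ge0.
rewrite (eq_bigr (fun k => (expR (lam k * m k) / lam k)%:E)); last first.
  by move=> k _; exact: integral_expR_lt.
by rewrite prodEFin big_split/= expR_sum prodfV.
Qed.

(** Inclusion-exclusion for two sets, stated with sums only, because finiteness is deduced from it
    in [exp_volume_fin]. *)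
Lemma exp_volume_cons m l :
  (exp_volume (m :: l) + exp_volume (map (minf m) l) =
   exp_volume [:: m] + exp_volume l)%E.
Proof.
rewrite -!ge0_integralD//; try exact: measurable_exp_volume; try by move=> x _; exact: ge0.
apply: eq_integral => x _; rewrite hit_minf /= orbF -!EFinD -!mulrDl; congr (_ * _)%:E.
by case: [forall j, _]; case: (hit l _); rewrite /= ?addr0 ?add0r.
Qed.

Lemma exp_volume_fin l : exp_volume l \is a fin_num.
Proof.
elim: l => [|m l IH].
  rewrite (_ : exp_volume _ = 0%E)//; apply: integral0_eq => x _ /=.
  by rewrite mul0r.
have : (exp_volume (m :: l) + exp_volume (map (minf m) l))%E \is a fin_num.
  by rewrite exp_volume_cons fin_numD IH andbT exp_volume1.
by rewrite fin_numD => /andP[].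
Qed.

End exp_volume.

(** * Passage to the limit under the integral *)

Section fatou_near.
Context {R : realType} {dsp} {T : measurableType dsp} (P : probability T R).

(** If the conclusion failed, some sequence of parameters tending to infinity would keep the
    integrals below [r], against Fatou's lemma along that sequence. *)
Lemma fatou_near (f : R -> T -> \bar R) (g : T -> \bar R) (r : \bar R) :
  (forall u, measurable_fun setT (f u)) -> (forall u x, (0 <= f u x)%E) ->
  (forall x, f u x @[u --> +oo] --> g x) ->
  (r < \int[P]_x g x)%E -> \forall u \near +oo, (r < \int[P]_x f u x)%E.
Proof.
move=> mf f0 fg rg; apply: contrapT => nr.
have /choice[v vP] : forall n : nat, exists u : R, n%:R <= u /\ (\int[P]_x f u x <= r)%E.
  move=> n; apply: contrapT => H; apply: nr.
  exists n%:R; split; first exact: num_real.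
  move=> u nu; rewrite ltNge; apply/negP => ur; apply: H; exists u; split => //.
  exact: ltW.
have vy : v n @[n --> \oo] --> +oo.
  apply/cvgryPge => M; near=> n; apply: le_trans (vP n).1.
  near: n; exact: nbhs_infty_ger.
have := @fatou _ _ _ P setT measurableT (fun n => f (v n)) (fun n => mf (v n)) (fun n x _ => f0 _ x).
apply/negP; rewrite -ltNge.
apply: (@le_lt_trans _ _ r).
  rewrite limn_einf_lim; apply: lime_le; first exact: is_cvg_einfs.
  apply: nearW => n; apply: le_trans (vP n).2.
  by apply: ereal_inf_lbound; exists n => //=.
rewrite (_ : (\int[P]_x limn_einf _)%E = (\int[P]_x g x)%E)//.
apply: eq_integral => x _; have /cvge_pinftyP/(_ v vy) fv := fg x.
by rewrite is_cvg_limn_einfE ?(cvg_lim _ fv)//; apply/cvg_ex; exists (g x).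
Unshelve. all: by end_near.
Qed.

(** Fatou's lemma for the nonnegative difference h - f bounds its integrals from below; subtracting
    this from the upper bound on the integrals of h bounds those of f. *)
Lemma pratt (f h : R -> T -> R) (fl hl : T -> R) (Hl Fl eps : R) :
  (forall u, measurable_fun setT (f u)) -> (forall u, measurable_fun setT (h u)) ->
  measurable_fun setT fl -> measurable_fun setT hl ->
  (forall u x, 0 <= f u x <= h u x) ->
  (forall x, f u x @[u --> +oo] --> fl x) -> (forall x, h u x @[u --> +oo] --> hl x) ->
  (\int[P]_x (fl x)%:E = Fl%:E)%E -> (\int[P]_x (hl x)%:E = Hl%:E)%E ->
  (forall eps', 0 < eps' -> \forall u \near +oo, (\int[P]_x (h u x)%:E <= (Hl + eps')%:E)%E) ->
  0 < eps -> \forall u \near +oo, (\int[P]_x (f u x)%:E <= (Fl + eps)%:E)%E.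
Proof.
move=> mf mh mfl mhl fh cf ch FlE HlE hub eps0.
have f0 u x : 0 <= f u x by have /andP[] := fh u x.
have h0 u x : 0 <= h u x by have /andP[? ?] := fh u x; exact: le_trans (f0 u x) _.
have hf0 u x : 0 <= h u x - f u x by have /andP[] := fh u x; rewrite subr_ge0.
have chf x : h u x - f u x @[u --> +oo] --> hl x - fl x by exact: cvgB.
have ny (F : R -> R) l : F u @[u --> +oo] --> l -> (forall u, 0 <= F u) -> 0 <= l.
  by move=> cF F0; apply: (cvgr_to_ge cF); exact: nearW.
have fl0 x : 0 <= fl x by apply: (ny _ _ (cf x)).
have hfl0 x : 0 <= hl x - fl x by apply: (ny _ _ (chf x)).
have hlfl : (\int[P]_x (hl x - fl x)%:E = (Hl - Fl)%:E)%E.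
  have : (\int[P]_x ((hl x - fl x)%:E + (fl x)%:E) = Hl%:E)%E.
    by rewrite -HlE; apply: eq_integral => x _; rewrite -EFinD subrK.
  rewrite ge0_integralD//; try by [move=> x _; rewrite lee_fin|
    apply/measurable_EFinP => //; exact: measurable_funB].
  rewrite FlE; case: (\int[P]_x (hl x - fl x)%:E)%E => [y| |]//.
  by rewrite -EFinD => -[<-]; rewrite addrK.
have := @fatou_near (fun u x => (h u x - f u x)%:E) (fun x => (hl x - fl x)%:E)
  (Hl - Fl - eps / 2)%:E.
rewrite hlfl => /(_ _ _ _ _) nr.
have {}nr : \forall u \near +oo, ((Hl - Fl - eps / 2)%:E < \int[P]_x (h u x - f u x)%:E)%E.
  apply: nr => //.
  - by move=> u; apply/measurable_EFinP; exact: measurable_funB.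
  - by move=> x; apply: cvg_EFin; [apply: nearW|exact: chf].
  - by rewrite lte_fin gtrBl divr_gt0.
near=> u.
have H1 : ((Hl - Fl - eps / 2)%:E < \int[P]_x (h u x - f u x)%:E)%E by near: u; exact: nr.
have H2 : (\int[P]_x (h u x)%:E <= (Hl + eps / 2)%:E)%E.
  by near: u; apply: hub; rewrite divr_gt0.
have : (\int[P]_x (h u x)%:E = \int[P]_x (h u x - f u x)%:E + \int[P]_x (f u x)%:E)%E.
  rewrite -ge0_integralD//; try by [move=> x _; rewrite lee_fin|
    apply/measurable_EFinP => //; exact: measurable_funB].
  by apply: eq_integral => x _; rewrite -EFinD subrK.
have : (0 <= \int[P]_x (f u x)%:E)%E by apply: integral_ge0 => x _; rewrite lee_fin.
have : (0 <= \int[P]_x (h u x - f u x)%:E)%E by apply: integral_ge0 => x _; rewrite lee_fin.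
move=> D0 F0 E; move: H2; rewrite E; move: D0 F0 H1.
case: (\int[P]_x (h u x - f u x)%:E)%E => [y'| |]//;
  case: (\int[P]_x (f u x)%:E)%E => [y''| |]//.
by rewrite -EFinD lte_fin !lee_fin => ? ? ? ?; lra.
Unshelve. all: by end_near.
Qed.

End fatou_near.

(** Both sides satisfy the inclusion-exclusion recursion, since [minf] commutes with a common shift;
    for a single orthant the value is explicit. *)
Lemma exp_volume_shift {R : realType} {n} (lam : 'I_n -> R) (c : R) l :
  (forall k, 0 < lam k) ->
  fine (exp_volume lam (map (fun m k => m k + c) l)) =
  expR (c * \sum_k lam k) * fine (exp_volume lam l).
Proof.
move=> lam_gt0; pose v l := fine (exp_volume lam l).
have vE l' : exp_volume lam l' = (v l')%:E by rewrite /v fineK// exp_volume_fin.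
have v1 m : v [:: m] = expR (\sum_k lam k * m k) / \prod_k lam k.
  by rewrite /v exp_volume1.
have vS m l' : v (m :: l') = v [:: m] + v l' - v (map (minf m) l').
  have := exp_volume_cons lam m l'; rewrite !vE -!EFinD => -[<-].
  by rewrite addrK.
rewrite -/(v _) -/(v l); apply: (@minf_ind R 'I_n (fun l =>
  v (map (fun m k => m k + c) l) = expR (c * \sum_k lam k) * v l)) l.
  by rewrite /v (_ : exp_volume _ _ = 0%E) ?mulr0//; apply: integral0_eq => x _; rewrite mul0r.
move=> m l IH1 IH2; rewrite /= vS IH1 -map_comp.
rewrite (_ : minf _ \o _ = (fun m k => m k + c) \o minf m); last first.
  by apply/funext => m'; apply/funext => k; rewrite /minf/= addr_minl.
rewrite map_comp IH2 [v (m :: l)]vS !mulrBr !mulrDr; congr (_ + _ - _).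
rewrite !v1 mulrA -expRD; congr (expR _ / _).
rewrite mulr_sumr -big_split/=; apply: eq_bigr => k _.
by rewrite mulrDr addrC [c * _]mulrC.
Qed.

(** * Fixed times and first passage over a finite set of times *)

Section paths.
Context {R : realType} {dsp} {T : measurableType dsp} (P : probability T R).
Context {d : nat} (X : 'I_d -> R -> T -> R) (e : 'I_d -> T -> R).
Hypothesis BM : brownian_model P X e.

Lemma normalized_indep (s : R) (E : 'I_d -> set R) : 0 < s ->
  (forall i, measurable (E i)) ->
  indep_normal P [set w | forall i, E i (e i w)]
    (fun i w => (Num.sqrt s)^-1 * X i s w) (fun=> 1).
Proof.
move=> s0 mE U mU; have r0 : 0 < Num.sqrt s by rewrite sqrtr_gt0.
pose V i := (fun x : R => (Num.sqrt s)^-1 * x) @^-1` U i.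
have mV i : measurable (V i).
  have : measurable_fun setT (fun x : R => (Num.sqrt s)^-1 * x).
    exact: mulrl_measurable.
  by rewrite -[X in measurable X]setTI; exact.
have := increment_indep BM (lexx 0) s0 mE mV.
rewrite [X in P X](_ : _ = [set w | forall i, E i (e i w)] `&`
    [set w | forall j, U j ((Num.sqrt s)^-1 * X j s w)]); last first.
  by congr (_ `&` _); apply/seteqP; split=> w H j; have := H j;
    rewrite /V/= (bm_zero BM) subr0.
have hi i : normal_prob 0 (Num.sqrt (s - 0)) (V i) = normal_prob 0 1 (U i).
  apply: (@etrans _ _ (normal_prob 0 (Num.sqrt s * 1) (V i))).
    by congr (normal_prob 0 _ _); rewrite subr0 mulr1.
  apply: (etrans (normal_prob_scale r0 ltr01 (mV i))).
  congr (normal_prob 0 _ _); apply/seteqP; split=> x; rewrite /V/= mulKf ?gt_eqF//.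
move=> H; apply: (etrans H).
exact: (congr1 (fun y => (P [set w | forall i, E i (e i w)] * y)%E)
  (eq_bigr _ (fun i _ => hi i))).
Qed.

Lemma exp_mean_time (th : 'I_d -> R) (s : R) : 0 <= s ->
  (\int[P]_w (expR (\sum_j th j * X j s w))%:E =
   (expR (s * (\sum_j th j ^+ 2) / 2))%:E)%E.
Proof.
rewrite le_eqVlt => /predU1P[<-|s0].
  rewrite mul0r mul0r expR0 (_ : (fun w => _) = cst 1%E).
    by rewrite (integral_cst P measurableT) [X in (_ * X)%E](probability_setT P) mule1.
  apply/funext => w; rewrite big1 ?expR0// => j _.
  by rewrite (bm_zero BM) mulr0.
have := @exp_mean _ _ _ P _ e (fun i w => (Num.sqrt s)^-1 * X i s w)
  (bm_measurable_drift BM) (fun i => measurable_funM (measurable_cst _) (bm_measurable BM i s))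
  (fun E mE => normalized_indep s0 mE) (fun j => Num.sqrt s * th j).
have r0 : Num.sqrt s != 0 by rewrite gt_eqF// sqrtr_gt0.
rewrite (_ : \sum_j (Num.sqrt s * th j) ^+ 2 = s * \sum_j th j ^+ 2); last first.
  by rewrite mulr_sumr; apply: eq_bigr => j _; rewrite exprMn sqr_sqrtr// ltW.
move=> <-; apply: eq_integral => w _; congr (expR _)%:E; apply: eq_bigr => j _.
by rewrite mulrACA divff// mul1r.
Qed.

Variable A : 'M[R]_d.

(** The finite set [F] and its image under [g] are sorted together with 0 into one increasing grid,
    to which [first_passage] applies; [g] becomes a map of indices. *)
Lemma first_passage_seq (F : seq R) (g : R -> R) (b K2 : 'I_d -> R) (D kap : R) :
  0 < D -> 0 <= kap -> (forall i w, e i w <= K2 i) -> (forall i, 0 <= K2 i) ->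
  (forall r, r \in F -> [/\ 0 <= r, r <= g r & g r - r <= D]) ->
  (P [set w | forall i, (Num.sqrt D * K2 i - kap / Num.sqrt D < mulf A (X^~ 1^~ w) i)%R] *
   P [set w | exists2 r, r \in F & above X e A b r w] <=
   P [set w | exists2 r, r \in F & above X e A (fun i => b i - kap)%R (g r) w])%E.
Proof.
move=> D0 kap0 eK2 K20 hF.
pose s0 := sort <=%R (undup (0 :: F ++ map g F)).
have ltS : sorted <%R s0 by rewrite sort_lt_sorted undup_uniq.
have ms0 x : (x \in s0) = (x \in 0 :: F ++ map g F) by rewrite mem_sort mem_undup.
have s0_ge0 x : x \in s0 -> 0 <= x.
  rewrite ms0 inE mem_cat => /orP[/eqP ->//|/orP[/hF[]//|/mapP[r /hF[r0 rg _] ->]]].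
  exact: le_trans rg.
have size0 : (0 < size s0)%N.
  by rewrite -has_predT; apply/hasP; exists 0; rewrite // ms0 mem_head.
pose n := (size s0).-1.
have nE : n.+1 = size s0 by rewrite prednK.
(* Past the last sorted time the grid continues with unit steps, merely to stay strictly
   increasing. *)
pose t k := if (k <= n)%N then nth 0 s0 k else nth 0 s0 n + (k - n)%:R.
have ts k : (k <= n)%N -> t k = nth 0 s0 k by rewrite /t => ->.
have tS k : t k < t k.+1.
  rewrite /t; case: ifP => kn; last first.
    have nk : (n <= k)%N by rewrite leqNgt; apply/negP => /ltnW; rewrite kn.
    rewrite ifF; last by apply/negP => /ltnW; rewrite kn.
    by rewrite ltrD2l ltr_nat subSn.
  case: ifP => kn1.
    have := sorted_ltn_nth (@lt_trans _ _) 0 ltS.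
    by move=> H; apply: H => //; rewrite inE -nE ltnS.
  have -> : k = n by apply/eqP; rewrite eqn_leq kn leqNgt kn1.
  by rewrite subSnn ltrDl.
have tmono i j : (t i <= t j) = (i <= j)%N.
  have tlt i' j' : (i' < j')%N -> t i' < t j' by exact: (homo_ltn (@lt_trans _ _) tS).
  case: (leqP i j) => [|/tlt]; last by move=> /lt_geF.
  by rewrite leq_eqVlt => /predU1P[->|/tlt/ltW]; first exact: lexx.
have idx x : x \in s0 -> t (index x s0) = x /\ (index x s0 <= n)%N.
  move=> xs; have : (index x s0 <= n)%N by rewrite -ltnS nE index_mem.
  by move=> h; split=> //; rewrite ts// nth_index.
have t0 : t 0%N = 0.
  apply/eqP; rewrite eq_le ts// s0_ge0 ?mem_nth// andbT -(ts 0%N)//.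
  have s00 : 0 \in s0 by rewrite ms0 mem_head.
  by have [{2}<- _] := idx 0 s00; rewrite tmono.
have Fs r : r \in F -> r \in s0 by move=> rF; rewrite ms0 inE mem_cat rF orbT.
have gs r : r \in F -> g r \in s0.
  by move=> rF; rewrite ms0 inE mem_cat map_f ?orbT.
pose q k := t k \in F.
pose g' k := index (g (t k)) s0.
have := @first_passage _ _ _ P _ X e BM t n t0 tS A q g' b K2 D kap D0 kap0 eK2 K20.
have H k : q k -> (k <= n)%N -> (k <= g' k <= n)%N && (t (g' k) - t k <= D).
  move=> qk kn; have [E gn] := idx _ (gs _ qk); have [_ rg gD] := hF _ qk.
  by rewrite /g' E gD andbT gn andbT -tmono E.
move=> /(_ H).
rewrite [X in (_ * P X <= _)%E](_ : _ = [set w | exists2 r, r \in F & above X e A b r w]); last first.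
  apply/seteqP; split=> w [x].
    by move=> /andP[qx xn] ab; exists (t x).
  move=> xF ab; have [E xn] := idx _ (Fs _ xF).
  by exists (index x s0); rewrite ?E//; rewrite /q E xF.
rewrite [X in (_ <= P X)%E](_ : _ = [set w | exists2 r, r \in F & above X e A (fun i => b i - kap)%R (g r) w])//.
apply/seteqP; split=> w [x].
  move=> /andP[qx xn] ab; exists (t x) => //; have [E _] := idx _ (gs _ qx).
  by rewrite -E.
move=> xF ab; have [E xn] := idx _ (Fs _ xF); have [E' _] := idx _ (gs _ xF).
by exists (index x s0); rewrite ?/g' ?E ?E'//; rewrite /q E xF.
Qed.

End paths.

(** * Dyadic times and measurability of the events *)

(** The dyadic floors of [t] tend to [t] and the strict inequalities persist by continuity.
    Approximation from below keeps the times within any bound that [t] satisfies. For t = 0 the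
    floor is 0 itself; for t > 0 two-sided continuity is available. [N0] serves grids whose horizon
    grows with [N]. *)
Lemma dyadic_below {R : realType} {d : nat} (f : 'I_d -> R -> R) (t : R) (N0 : nat) :
  (forall i, {within `[0, +oo[, continuous f i}) -> 0 <= t ->
  (forall i, 0 < f i t) ->
  exists N k : nat, [/\ (N0 <= N)%N, k%:R / 2 ^+ N <= t &
    forall i, 0 < f i (k%:R / 2 ^+ N)].
Proof.
move=> cf t0 ft.
pose y N : R := (Num.truncn (t * 2 ^+ N))%:R / 2 ^+ N.
have p2 N : 0 < 2 ^+ N :> R by rewrite exprn_gt0.
have yt N : y N <= t.
  rewrite ler_pdivrMr// truncn_le//; rewrite mulr_ge0// ltW//.
have ty N : t < y N + (2 ^+ N)^-1.
  rewrite -[X in _ + X]mul1r -mulrDl ltr_pdivlMr// natr1.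
  by apply: truncnS_gt.
have cy : y N @[N --> \oo] --> t.
  apply/cvgrPdist_le => eps eps0.
  have H : \forall N \near \oo, `|0 - 2^-1 ^+ N| <= eps :> R.
    have /cvgrPdist_le : (2^-1 : R) ^+ N @[N --> \oo] --> (0 : R).
      by apply: cvg_expr; rewrite gtr0_norm// invf_lt1// ltr1n.
    exact.
  near=> N; have : `|0 - 2^-1 ^+ N| <= eps :> R by near: N.
  rewrite sub0r normrN exprVn gtr0_norm ?invr_gt0// => le_eps.
  have := ty N; have := yt N; rewrite ger0_norm ?subr_ge0//; lra.
have H : \forall N \near \oo, forall i, 0 < f i (y N).
  apply: filter_forall => i.
  move: t0; rewrite le_eqVlt => /predU1P[t_0|t_gt0].
    apply: nearW => N; rewrite /y -t_0 mul0r (_ : Num.truncn 0 = 0%N).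
      by rewrite mul0r; have := ft i; rewrite -t_0.
    by apply/eqP; rewrite -leqn0 -(ler_nat R) truncn_le.
  have /continuous_within_itvcyP[cfi _] := cf i.
  have cfy : f i (y N) @[N --> \oo] --> f i t.
    by apply: (cvg_comp _ _ cy); apply: cfi; rewrite in_itv/= t_gt0.
  exact: (cvgr_gt _ cfy).
near \oo => N.
exists N, (Num.truncn (t * 2 ^+ N)); split; [|exact: yt|].
  by near: N; exact: nbhs_infty_ge.
by near: N.
Unshelve. all: by end_near.
Qed.

(** By [dyadic_below] the uncountable union over times is a countable one; that [Q] is closed
    downwards keeps the approximating times admissible. *)
Lemma measurable_exists_time {R : realType} {dsp} {T : measurableType dsp} {d : nat}
    (Y : R -> 'I_d -> T -> R) (Q : set R) :
  (forall t i, measurable_fun setT (Y t i)) ->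
  (forall i w, {within `[0, +oo[, continuous (fun t => Y t i w)}) ->
  (forall r t, 0 <= r -> r <= t -> Q t -> Q r) ->
  measurable [set w | exists2 t, 0 <= t /\ Q t & forall i, 0 < Y t i w].
Proof.
move=> mY cY downQ.
pose dy N k : R := k%:R / 2 ^+ N.
have dy0 N k : 0 <= dy N k by rewrite divr_ge0// exprn_ge0.
rewrite (_ : mkset _ = \bigcup_N \bigcup_(k in [set k | Q (dy N k)])
    [set w | forall i, 0 < Y (dy N k) i w]).
  apply: bigcup_measurable => N _; apply: bigcup_measurable => k _.
  exact: measurable_forall_lt.
apply/seteqP; split=> w.
  move=> [t [t0 Qt] H].
  have [N [k [_ kt Hk]]] := dyadic_below 0 (fun i => cY i w) t0 H.
  by exists N => //; exists k => //; exact: downQ Qt.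
by move=> [N _ [k Qk H]]; exists (dy N k).
Qed.

Lemma within_continuous_id {R : realType} (D : set R) :
  {within D, continuous (fun t : R => t)}.
Proof. by apply: continuous_subspaceT => t. Qed.

Section events.
Context {R : realType} {dsp} {T : measurableType dsp} {d : nat}.
Variables (X : 'I_d -> R -> T -> R) (A : 'M[R]_d) (a : 'I_d -> R).

Definition crossing (I : {set 'I_d}) (x : 'I_#|I| -> R) : set T :=
  [set w | exists2 t, 0 <= t &
    forall k, x k < mulf A (fun j => X j t w) (enum_val k) - t * a (enum_val k)].

Definition hitting_event (e : 'I_d -> T -> R) (u : R) : set T :=
  [set w | exists2 t, 0 <= t <= 1 & above X e A (fun i => u * a i) t w].

Hypotheses (mX : forall i t, measurable_fun setT (X i t))
  (cX : forall i w, {within `[0, +oo[, continuous (X i ^~ w)}).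

Lemma mulf_continuous i w : {within `[0, +oo[, continuous (fun t => mulf A (fun j => X j t w) i)}.
Proof.
rewrite (_ : (fun t => _) = (fun t => \sum_j A i j * X j t w))//.
move=> t; apply: cvg_big => [|j _]; first exact: add_continuous.
by apply: cvgM; [exact: cvg_cst|exact: cX].
Qed.

Lemma measurable_crossing_event (I : {set 'I_d}) (x : 'I_#|I| -> R) :
  measurable (crossing x).
Proof.
have := @measurable_exists_time R _ T #|I| (fun t k w =>
  mulf A (fun j => X j t w) (enum_val k) - t * a (enum_val k) - x k) setT.
rewrite [X in _ -> _ -> _ -> measurable X](_ : _ = crossing x).
  apply=> // [t k|k w].
    apply: measurable_funB => //; apply: measurable_funB => //.
    exact: measurable_mulf.
  move=> t; apply: cvgB; last exact: cvg_cst.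
  apply: cvgB; first exact: mulf_continuous.
  by apply: cvgM; [exact: within_continuous_id|exact: cvg_cst].
apply/seteqP; split=> w [t]; first by move=> [t0 _] H; exists t => // k; rewrite -subr_gt0.
by move=> t0 H; exists t => // k; rewrite subr_gt0.
Qed.

Lemma measurable_hitting (e : 'I_d -> T -> R) (u : R) :
  (forall i, measurable_fun setT (e i)) -> measurable (hitting_event e u).
Proof.
move=> me; have := @measurable_exists_time R _ T d (fun t i w =>
  mulf A (fun j => X j t w) i - (u * a i + t * e i w)) [set t | t <= 1].
rewrite [X in _ -> _ -> _ -> measurable X](_ : _ = hitting_event e u).
  apply=> // [t i|i w|r t _ rt /(le_trans rt)//].
    apply: measurable_funB; first exact: measurable_mulf.
    by apply: measurable_funD => //; exact: measurable_funM.
  move=> t; apply: cvgB; first exact: mulf_continuous.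
  apply: cvgD; first exact: cvg_cst.
  by apply: cvgM; [exact: within_continuous_id|exact: cvg_cst].
apply/seteqP; split=> w [t].
  by move=> [t0 t1] H; exists t; [rewrite t0|move=> i; rewrite -subr_gt0].
by move=> /andP[t0 t1] H; exists t => // i; rewrite subr_gt0.
Qed.

End events.

(** * Asymptotics for a bounded drift *)

Section asymptotics.
Context {R : realType} {dsp} {T : measurableType dsp} (P : probability T R).
Context {d : nat} (X : 'I_d -> R -> T -> R) (e : 'I_d -> T -> R).
Hypothesis BM : brownian_model P X e.
Variables (A : 'M[R]_d) (K1 K2 : 'I_d -> R).
Hypotheses (eK1 : forall i w, K1 i <= e i w) (eK2 : forall i w, e i w <= K2 i).
Variables (a at_ lam b : 'I_d -> R).
Hypotheses (bE : forall j, b j = \sum_i A i j * lam i)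
  (atE : forall i, at_ i = mulf A b i) (le_a : forall i, a i <= at_ i)
  (lam_ge0 : forall i, 0 <= lam i)
  (slack : forall i, lam i * (at_ i - a i) = 0)
  (unitA : A \in unitmx).

Let mX i t := bm_measurable BM i t.
Let me i := bm_measurable_drift BM i.
Let Z i := X i 1.

Let indepZ (E : 'I_d -> set R) : (forall i, measurable (E i)) ->
  indep_normal P [set w | forall i, E i (e i w)] Z (fun=> 1).
Proof.
move=> mE; have := increment_indep BM (lexx 0) ltr01 mE.
apply: eq_indep_normal => i => [w|]; first by rewrite (bm_zero BM) subr0.
by rewrite subr0 sqrtr1.
Qed.

Let mexceed c : measurable (exceed e Z A c).
Proof. by apply: measurable_exceed => // i; exact: mX. Qed.

Definition tail_prob (c : 'I_d -> R) : R := fine (P (exceed e Z A c)).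
Local Notation H u := (tail_prob (fun i => u * a i)).

Let tail_probE c : P (exceed e Z A c) = (tail_prob c)%:E.
Proof. by rewrite fineK// fin_num_measure. Qed.

Lemma tail_prob_ge0 c : 0 <= tail_prob c.
Proof. exact: fine_ge0. Qed.

Lemma tail_prob_gt0 u : 0 <= u -> 0 < H u.
Proof.
move=> u0; have [c0 [C1 [c00 lb]]] :=
  exceed_lb me (fun i => mX i 1) indepZ atE le_a unitA K2.
have := lb u (fun i => u * a i) u0 (fun i w => lerD (lexx _) (eK2 i w)).
rewrite tail_probE lee_fin; apply: lt_le_trans; by rewrite mulr_gt0// expR_gt0.
Qed.

Let ratio (K1' K2' m : 'I_d -> R) eps : 0 < eps ->
  exists2 u0 : R, 1 <= u0 & forall u c, u0 <= u ->
    (forall i w, u * a i + K1' i <= c i + e i w <= u * a i + K2' i) ->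
    tail_prob (fun i => c i - m i / u) <=
    (expR (\sum_i m i * lam i) + eps) * tail_prob c.
Proof.
move=> eps0; have [u0 u1 Hu] := exceed_ratio me (fun i => mX i 1) indepZ bE
  atE le_a lam_ge0 slack unitA K1' K2' m eps0.
exists u0 => // u c uu hc; have := Hu u c uu hc.
by rewrite !tail_probE -EFinM lee_fin.
Qed.

(** The upper bound is [exceed_ratio]. The lower bound is the same estimate with -m, started from
    the lowered level, so that the two probabilities exchange roles; the bounds K1 and K2 are
    widened by |m| for this. *)
Lemma tail_prob_ratio (m : 'I_d -> R) :
  tail_prob (fun i => u * a i - m i / u) / H u @[u --> +oo] -->
  expR (\sum_i m i * lam i).
Proof.
set L := \sum_i _; apply/cvgrPdist_le => eps eps0.
have [u0 u01 H1] := ratio K1 K2 m eps0.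
(* With this choice (exp L - eps) (exp (- L) + eps1) = 1 - (eps exp (- L))^2 <= 1, which inverts the
   reversed inequality. *)
pose eps1 := eps * expR (- L) ^+ 2.
have eps10 : 0 < eps1 by rewrite mulr_gt0// exprn_gt0// expR_gt0.
have [v0 v01 H2] := ratio (fun i => K1 i - `|m i|) (fun i => K2 i + `|m i|)
  (fun i => - m i) eps10.
near=> u.
have u0u : u0 <= u by near: u; apply: nbhs_pinfty_ge; exact: num_real.
have v0u : v0 <= u by near: u; apply: nbhs_pinfty_ge; exact: num_real.
have u1 := le_trans u01 u0u; have u_gt0 : 0 < u by exact: lt_le_trans u1.
have Hu := tail_prob_gt0 (ltW u_gt0).
rewrite ler_distlC; apply/andP; split; last first.
  rewrite ler_pdivrMr//; apply: H1 => // i w.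
  by rewrite !lerD2l eK1 eK2.
rewrite ler_pdivlMr//.
have := H2 u (fun i => u * a i - m i / u) v0u.
rewrite (_ : (fun i => _ - _ / u - _) = fun i => u * a i); last first.
  by apply/funext => i; rewrite mulNr opprK subrK.
set G := tail_prob (fun i => u * a i - m i / u) => H3.
have {}H3 : H u <= (expR (- L) + eps1) * G.
  rewrite -sumrN (eq_bigr (fun i => - m i * lam i)) => [|i _]; last by rewrite mulNr.
  apply: H3 => i w; have mu : `|m i / u| <= `|m i|.
    rewrite normrM ler_piMr// normfV gtr0_norm// invf_le1//.
  have := eK1 i w; have := eK2 i w; move: mu; rewrite ler_norml => /andP[]; lra.
have EL : expR L * expR (- L) = 1 by rewrite -expRD subrr expR0.
have G0 : 0 <= G by exact: tail_prob_ge0.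
have EL0 := expR_gt0 L; have ELN0 := expR_gt0 (- L).
have : (expR L - eps) * H u <= (expR L - eps) * ((expR (- L) + eps1) * G) \/
   expR L - eps <= 0.
  by case: (leP 0 (expR L - eps)) => h; [left; rewrite ler_wpM2l|right; exact: ltW].
case=> [h|h]; last by apply: le_trans (G0); rewrite mulr_le0_ge0// ltW.
apply: (le_trans h); rewrite mulrA ler_piMl//.
have -> : (expR L - eps) * (expR (- L) + eps1) = expR L * expR (- L) +
    (expR L * expR (- L) - 1) * (eps * expR (- L)) - (eps * expR (- L)) ^+ 2.
  by rewrite /eps1; ring.
by rewrite EL subrr mul0r addr0 gerBl sqr_ge0.
Unshelve. all: by end_near.
Qed.

Variable I : {set 'I_d}.
Hypotheses (lam_gt0 : forall i, i \in I -> 0 < lam i)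
  (lam_eq0 : forall i, i \notin I -> lam i = 0).

Let restr (m : 'I_d -> R) (k : 'I_#|I|) : R := m (enum_val k).

Let restr_lam_gt0 k : 0 < restr lam k.
Proof. by apply: lam_gt0; exact: enum_valP. Qed.

Let sum_lam (m : 'I_d -> R) : \sum_i m i * lam i = \sum_k restr lam k * restr m k.
Proof.
rewrite (bigID (mem I))/= [X in _ + X]big1 ?addr0; last first.
  by move=> i /lam_eq0 ->; rewrite mulr0.
by rewrite big_enum_val; apply: eq_bigr => k _; rewrite mulrC.
Qed.

Definition gap (u : R) (i : 'I_d) (w : T) : R :=
  u * (u * a i + e i w - mulf A (Z^~ w) i).

Let measurable_gap u i : measurable_fun setT (gap u i).
Proof.
apply: measurable_funM => //; apply: measurable_funB; first exact: measurable_funD.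
by apply: measurable_mulf => j; exact: mX.
Qed.

Definition hit_prob (l : seq ('I_d -> R)) (u : R) : R :=
  fine (P [set w | hit l ((gap u)^~ w)]).

Let hit_prob1 m u : 0 < u -> hit_prob [:: m] u = tail_prob (fun i => u * a i - m i / u).
Proof.
move=> u0; rewrite /hit_prob /tail_prob; congr (fine (P _)).
have H (x y : R) : (u * x < y) = (x < y / u) by rewrite ltr_pdivlMr// mulrC.
apply/seteqP; split=> w; rewrite /= orbF.
  move=> /forallP G i; have := G i; rewrite /gap H; lra.
by move=> G; apply/forallP => i; have := G i; rewrite /gap H; lra.
Qed.

Let hit_prob_cons m l u :
  hit_prob (m :: l) u = hit_prob [:: m] u + hit_prob l u - hit_prob (map (minf m) l) u.
Proof.
have mh l' : measurable [set w | hit l' ((gap u)^~ w)] by exact: measurable_hit.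
rewrite /hit_prob (_ : [set w | hit (m :: l) _] =
  [set w | hit [:: m] ((gap u)^~ w)] `|` [set w | hit l ((gap u)^~ w)]); last first.
  by apply/seteqP; split=> w /=; rewrite orbF => /orP.
rewrite measureUfinr//; last by rewrite ltey_eq fin_num_measure.
rewrite (_ : _ `&` _ = [set w | hit (map (minf m) l) ((gap u)^~ w)]); last first.
  by apply/seteqP; split=> w; rewrite [X in _ -> X]/mkset [X in X -> _]/= hit_minf => /andP.
by rewrite fineB ?fineD ?fin_numD ?fin_num_measure.
Qed.

(** Both sides obey the same inclusion-exclusion recursion, and one orthant is the case of
    [tail_prob_ratio]. As [lam] vanishes outside [I], only the restrictions of the corners to [I]
    survive in the limit; the product of the [lam i] cancels the denominator in [exp_volume1]. *)
Lemma hit_prob_cvg l : hit_prob l u / H u @[u --> +oo] -->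
  (\prod_(i in I) lam i) * fine (exp_volume (restr lam) (map restr l)).
Proof.
apply: (@minf_ind R 'I_d (fun l => hit_prob l u / H u @[u --> +oo] -->
  (\prod_(i in I) lam i) * fine (exp_volume (restr lam) (map restr l)))) l =>
  [|m {}l IH1 IH2].
  rewrite (_ : exp_volume _ _ = 0%E); last first.
    by apply: integral0_eq => x _ /=; rewrite mul0r.
  rewrite mulr0 (_ : (fun u => _) = cst 0); first exact: cvg_cst.
  apply/funext => u; rewrite /hit_prob (_ : mkset _ = set0) ?measure0 ?mul0r//.
  by apply/seteqP; split.
have fin := exp_volume_fin restr_lam_gt0.
have -> : (\prod_(i in I) lam i) * fine (exp_volume (restr lam) (map restr (m :: l))) =
    expR (\sum_i m i * lam i) +
    (\prod_(i in I) lam i) * fine (exp_volume (restr lam) (map restr l)) -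
    (\prod_(i in I) lam i) * fine (exp_volume (restr lam) (map restr (map (minf m) l))).
  pose v l' := fine (exp_volume (restr lam) l').
  have vE l' : exp_volume (restr lam) l' = (v l')%:E by rewrite /v fineK.
  have := exp_volume_cons (restr lam) (restr m) (map restr l).
  rewrite !vE -!EFinD => -[]; rewrite -!map_comp.
  rewrite (_ : minf (restr m) \o restr = restr \o minf m)// => E.
  have := exp_volume1 restr_lam_gt0 (restr m); rewrite vE -sum_lam => -[E1].
  rewrite -/(v _) -/(v _) -/(v _).
  have pE : \prod_(i in I) lam i = \prod_k restr lam k by rewrite big_enum_val.
  have p0 : \prod_k restr lam k != 0 by rewrite gt_eqF// prodr_gt0.
  rewrite pE -[expR _](mulfVK p0) -E1 [v [:: _] * _]mulrC -mulrDr -mulrBr.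
  by congr (_ * _); rewrite -E addrK.
under eq_cvg do rewrite hit_prob_cons mulrBl mulrDl.
apply: cvgB => //; apply: cvgD => //.
have := @tail_prob_ratio m; apply: cvg_trans; apply: near_eq_cvg; near=> u.
rewrite hit_prob1//; near: u; apply: nbhs_pinfty_gt; exact: num_real.
Unshelve. all: by end_near.
Qed.

(** The corner of the orthant attached to [s]. Lowering the level by kap at the corresponding
    inverted time amounts to c = u kap (1 + s / u^2). *)
Definition level (s c : R) (w : T) (i : 'I_d) : R :=
  mulf A (fun j => X j s w) i - s * a i + c.

Lemma measurable_level s c i : measurable_fun setT (fun w => level s c w i).
Proof.
apply: measurable_funD => //; apply: measurable_funB => //.
by apply: measurable_mulf => j; exact: mX.
Qed.

Let product_ysection (E : set (T * T)) : measurable E ->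
  ((P \x P) E = \int[P]_y P [set x | E (x, y)])%E.
Proof.
move=> mE; have := @indic_fubini_tonelli2 _ _ _ _ _ P P E mE.
have := @indic_fubini_tonelli1 _ _ _ _ _ P P E mE.
have := @indic_fubini_tonelli _ _ _ _ _ P P E mE => H H1 H2.
transitivity (\int[(P \x P)%E]_z (\1_E z)%:E)%E.
  by rewrite integral_indic// setIT.
rewrite H1 H indic_fubini_tonelli_GE//.
apply: eq_integral => y _ /=; congr (P _).
by apply/seteqP; split=> x; rewrite /ysection/= inE.
Qed.

(** * Hitting on a grid as an integral over the independent copy *)

Section inversion.
Variables (s : nat -> R) (n : nat).
Hypotheses (s0 : s 0%N = 0) (sS : forall k, s k < s k.+1).
Implicit Types (q : pred nat) (c : nat -> R).

Let s_ge0 k : 0 <= s k.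
Proof. by elim: k => [|k IH]; rewrite ?s0// (le_trans IH)// ltW. Qed.

Definition levels q c (w : T) : seq ('I_d -> R) :=
  [seq level (s k) (c k) w | k <- iota 0 n.+1 & q k].

Lemma hit_levels q c w (x : 'I_d -> R) :
  hit (levels q c w) x <->
  exists2 k, q k && (k <= n)%N & forall i, x i < level (s k) (c k) w i.
Proof.
rewrite /hit /levels has_map; split.
  move=> /hasP[k]; rewrite mem_filter mem_iota => /andP[qk kn] /forallP H.
  by exists k => //; rewrite qk -ltnS.
move=> [k /andP[qk kn] H]; apply/hasP; exists k; last exact/forallP.
by rewrite mem_filter qk mem_iota /= add0n ltnS.
Qed.

Lemma measurable_levels {dsp'} {T' : measurableType dsp'} q c (f : T' -> T)
    (x : 'I_d -> T' -> R) : measurable_fun setT f ->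
  (forall i, measurable_fun setT (x i)) ->
  measurable [set w | hit (levels q c (f w)) (x^~ w)].
Proof.
move=> mf mx.
rewrite (_ : mkset _ = \bigcup_(k in [set k | q k && (k <= n)%N])
    [set w | forall i, x i w < level (s k) (c k) (f w) i]).
  apply: bigcup_measurable => k _; apply: measurable_forall_lt => // i.
  exact: (measurableT_comp (measurable_level _ _ i) mf).
apply/seteqP; split=> w /=.
  by rewrite hit_levels => -[k qk H]; exists k.
by move=> [k qk H]; rewrite hit_levels; exists k.
Qed.

(** [time_inversion] moves the event to the product space, and Tonelli fixes the second path. The
    first path then enters only through [gap]. *)
Lemma inversion u q kap : 0 < u ->
  (P [set w | exists2 k, q k && (k <= n)%N &
      above X e A (fun i => u * a i - kap k)%R (inverted_time u (s k)) w] =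
   \int[P]_w (hit_prob (levels q (fun k => u * kap k * (1 + s k / u ^+ 2))%R w) u)%:E)%E.
Proof.
move=> u0; pose tt k := inverted_time u (s k).
have tt0 k : 0 < 1 + s k / u ^+ 2.
  by rewrite ltr_wpDr// divr_ge0// exprn_ge0// ltW.
pose S (y : 'I_d -> R) (x : 'I_d -> 'I_n.+1 -> R) := exists2 k : 'I_n.+1, q k &
  forall i, u * a i - kap k + tt k * y i < mulf A (x^~ k) i.
have mS : measurable [set t : #|{: 'I_d + 'I_d * 'I_n.+1}|.-tuple R |
    S (fun i => untuple t (inl i)) (fun i k => untuple t (inr (i, k)))].
  rewrite (_ : mkset _ = \bigcup_(k in [set k : 'I_n.+1 | q k])
    [set t : #|{: 'I_d + 'I_d * 'I_n.+1}|.-tuple R |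
      forall i, u * a i - kap k + tt k * untuple t (inl i) <
        mulf A (fun i => untuple t (inr (i, k))) i]).
    apply: fin_bigcup_measurable => // k _; apply: measurable_forall_lt => i.
      apply: measurable_funD => //; apply: measurable_funM => //.
      exact: measurable_untuple.
    exact: (measurable_mulf _ _ (fun j => measurable_untuple (inr (j, k)))).
  by apply/seteqP; split=> t; [case=> k qk H; exists k|case=> k qk H; exists k].
pose c k := u * kap k * (1 + s k / u ^+ 2).
pose E := [set w : T * T | hit (levels q c w.2) (fun i => gap u i w.1)].
have mE : measurable E.
  apply: measurable_levels => // i.
  exact: (measurableT_comp (measurable_gap u i)).
transitivity ((P \x P)%E E); last first.
  rewrite product_ysection//; apply: eq_integral => w' _.
  rewrite /hit_prob fineK// fin_num_measure//; exact: measurable_hit.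
have := time_inversion BM u0 s0 sS mS.
rewrite [X in P X = _ -> _](_ : _ = [set w | exists2 k, q k && (k <= n)%N &
    above X e A (fun i => u * a i - kap k) (inverted_time u (s k)) w]); last first.
  apply/seteqP; split=> w.
    by move=> [k qk H]; exists (nat_of_ord k); rewrite ?qk//= -ltnS.
  by move=> [k /andP[qk kn] H]; exists (Ordinal (kn : (k < n.+1)%N)).
move=> ->; congr (_ _).
(* Divide by [tt k] and multiply by u. The factor [tt k] in front of the drift cancels exactly, so
   [e] enters [gap] without a factor depending on s, while u^2 a s / u^2 produces the term s a of
   [level]. *)
have key k w i : (u * a i - kap k + tt k * e i w.1 < mulf A (fun j => inverted X u s j k w) i) =
    (gap u i w.1 < level (s k) (c k) w.2 i).
  rewrite (_ : mulf A (fun j => inverted X u s j k w) i =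
    tt k * (mulf A (fun j => Z j w.1) i + mulf A (fun j => X j (s k) w.2) i / u)); last first.
    rewrite /mulf mulr_suml -big_split/= mulr_sumr; apply: eq_bigr => j _.
    by rewrite /inverted -/(tt k) mulrCA mulrDr mulrA.
  rewrite /tt /inverted_time /gap /level /c.
  set x := mulf _ _ _; set y := mulf _ _ _.
  have t0 := tt0 k; set t := 1 + _ in t0 *.
  have su : s k = u ^+ 2 * (t - 1) by rewrite /t; field; rewrite gt_eqF.
  rewrite su -(ltr_pM2l t0) -[RHS](ltr_pM2l (x := u^-1)) ?invr_gt0//.
  rewrite -subr_gt0 -[RHS]subr_gt0; congr (0 < _).
  by field; rewrite !gt_eqF.
apply/seteqP; split=> w.
  move=> [k qk H]; apply/hit_levels; exists (nat_of_ord k).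
    by rewrite qk -ltnS ltn_ord.
  by move=> i; have := H i; rewrite -key.
move=> /hit_levels [k /andP[qk kn] H]; exists (Ordinal (kn : (k < n.+1)%N)) => // i.
by have := H i; rewrite -key.
Qed.

Lemma measurable_hit_prob q c u : measurable_fun setT (fun w => hit_prob (levels q c w) u).
Proof.
pose E := [set w : T * T | hit (levels q c w.2) (fun i => gap u i w.1)].
have mE : measurable E.
  apply: measurable_levels => // i.
  exact: (measurableT_comp (measurable_gap u i)).
have := @measurable_fun_ysection _ _ T T R P E mE.
move=> /(measurableT_comp (fine_measurable (@measurableT _ (\bar R)))).
congr measurable_fun; apply/funext => w /=; congr (fine (P _)).
by apply/seteqP; split=> x; rewrite /ysection/= inE.
Qed.

End inversion.

Let Lam : R := \prod_(i in I) lam i.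

Let Lam_gt0 : 0 < Lam.
Proof. by rewrite /Lam prodr_gt0// => i; exact: lam_gt0. Qed.

Section grid_volume.
Variables (s : nat -> R) (n : nat).
Hypotheses (s0 : s 0%N = 0) (sS : forall k, s k < s k.+1).
Implicit Types (q : pred nat) (c : nat -> R).

Definition volume q c (w : T) : R :=
  fine (exp_volume (restr lam) (map restr (levels s n q c w))).

Definition grid_volume q c : \bar R := \int[lebesgue_tuple #|I|]_x
  (P [set w | hit (map restr (levels s n q c w)) (tnth x)] *
   (expR (\sum_k restr lam k * tnth x k))%:E).

Let volumeE q c w : exp_volume (restr lam) (map restr (levels s n q c w)) = (volume q c w)%:E.
Proof. by rewrite fineK// exp_volume_fin. Qed.

Lemma hit_restr_levels q c w (x : 'I_#|I| -> R) :
  hit (map restr (levels s n q c w)) x <->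
  exists2 k, q k && (k <= n)%N & forall j, x j < level (s k) (c k) w (enum_val j).
Proof.
rewrite /hit /levels !has_map; split.
  move=> /hasP[k]; rewrite mem_filter mem_iota => /andP[qk kn] /forallP H.
  by exists k => //; rewrite qk -ltnS.
move=> [k /andP[qk kn] H]; apply/hasP; exists k; last exact/forallP.
by rewrite mem_filter qk mem_iota /= add0n ltnS.
Qed.

Lemma measurable_hit_restr q c : measurable
  [set z : T * #|I|.-tuple R | hit (map restr (levels s n q c z.1)) (tnth z.2)].
Proof.
rewrite (_ : mkset _ = \bigcup_(k in [set k | q k && (k <= n)%N])
    [set z : T * #|I|.-tuple R |
      forall j, tnth z.2 j < level (s k) (c k) z.1 (enum_val j)]).
  apply: bigcup_measurable => k _; apply: measurable_forall_lt => j.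
    exact: (measurableT_comp (measurable_tnth j)).
  exact: (measurableT_comp (measurable_level _ _ _)).
apply/seteqP; split=> z /=.
  by rewrite hit_restr_levels => -[k qk H]; exists k.
by move=> [k qk H]; rewrite hit_restr_levels; exists k.
Qed.

Let f q c (z : T * #|I|.-tuple R) : \bar R :=
  ((hit (map restr (levels s n q c z.1)) (tnth z.2))%:R *
    expR (\sum_k restr lam k * tnth z.2 k))%:E.

Let measurable_f q c : measurable_fun setT (f q c).
Proof.
apply/measurable_EFinP; apply: measurable_funM; last first.
  apply: measurableT_comp => //; apply: measurable_sum => k.
  apply: measurable_funM => //; exact: (measurableT_comp (measurable_tnth k)).
rewrite (_ : (fun z => _) = \1_[set z : T * #|I|.-tuple R |
  hit (map restr (levels s n q c z.1)) (tnth z.2)]).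
  by apply: measurable_indic; exact: measurable_hit_restr.
by apply/funext => z; rewrite indicE; congr (nat_of_bool _)%:R; apply/idP/idP; rewrite inE.
Qed.

Let f0 q c z : (0 <= f q c z)%E.
Proof. by rewrite lee_fin mulr_ge0// expR_ge0. Qed.

Lemma measurable_volume q c : measurable_fun setT (volume q c).
Proof.
have := @measurable_fun_fubini_tonelli_F _ _ T (#|I|.-tuple R) R
  (lebesgue_tuple #|I|) (f q c) (measurable_f q c) (f0 q c).
move=> /(measurableT_comp (fine_measurable (@measurableT _ (\bar R)))).
by apply: eq_measurable_fun => w _.
Qed.

Lemma volume_ge0 q c w : 0 <= volume q c w.
Proof. by rewrite fine_ge0// exp_volume_ge0. Qed.

Lemma integral_volume q c : (\int[P]_w (volume q c w)%:E = grid_volume q c)%E.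
Proof.
transitivity (\int[P]_w \int[lebesgue_tuple #|I|]_x f q c (w, x))%E.
  by apply: eq_integral => w _; rewrite -volumeE.
have -> := @fubini_tonelli _ _ T (#|I|.-tuple R) R P (lebesgue_tuple #|I|)
  (f q c) (measurable_f q c) (f0 q c).
apply: eq_integral => x _.
have mh : measurable [set w | hit (map restr (levels s n q c w)) (tnth x)].
  have := measurable_ysection x (@measurable_hit_restr q c).
  by congr measurable; apply/seteqP; split=> w; rewrite /ysection/= inE.
transitivity (\int[P]_w ((\1_[set w | hit (map restr (levels s n q c w)) (tnth x)] w)%:E *
    (expR (\sum_k restr lam k * tnth x k))%:E))%E.
  apply: eq_integral => w _; rewrite /f -EFinM indicE; congr (_ * _)%:E.
  by congr (nat_of_bool _)%:R; apply/idP/idP; rewrite inE.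
rewrite ge0_integralZr//; last by apply/measurable_EFinP; exact: measurable_indic.
by rewrite integral_indic// setIT.
Qed.

Lemma hitting_lb q (r : R) : (r%:E < Lam%:E * grid_volume q (fun=> 0%R))%E ->
  \forall u \near +oo, ((r * H u)%:E < P [set w | exists2 k, q k && (k <= n)%N &
      above X e A (fun i => u * a i)%R (inverted_time u (s k)) w])%E.
Proof.
move=> rlt.
have := @fatou_near R _ T P (fun u w => (hit_prob (levels s n q (fun=> 0) w) u / H u)%:E)
  (fun w => (Lam * volume q (fun=> 0) w)%:E) r%:E.
have m1 u : measurable_fun setT (fun w => (hit_prob (levels s n q (fun=> 0) w) u / H u)%:E).
  by apply/measurable_EFinP; apply: measurable_funM => //; exact: measurable_hit_prob.
have m2 u w : (0 <= (hit_prob (levels s n q (fun=> 0) w) u / H u)%:E)%E.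
  by rewrite lee_fin divr_ge0 ?tail_prob_ge0// fine_ge0.
have m3 w : (hit_prob (levels s n q (fun=> 0) w) u / H u)%:E @[u --> +oo] -->
    (Lam * volume q (fun=> 0) w)%:E.
  by apply: cvg_EFin; [exact: nearW|exact: hit_prob_cvg].
have m4 : (r%:E < \int[P]_w (Lam * volume q (fun=> 0) w)%:E)%E.
  apply: (lt_le_trans rlt).
  under [leRHS]eq_integral do rewrite EFinM.
  rewrite ge0_integralZl ?integral_volume//.
  - by apply/measurable_EFinP; exact: measurable_volume.
  - by move=> w _; rewrite lee_fin volume_ge0.
  - by rewrite lee_fin ltW.
move=> /(_ m1 m2 m3 m4) nr; near=> u.
have u0 : 0 < u by near: u; apply: nbhs_pinfty_gt; exact: num_real.
have Hu : 0 < H u by exact: tail_prob_gt0 (ltW u0).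
have : (r%:E < \int[P]_w (hit_prob (levels s n q (fun=> 0) w) u / H u)%:E)%E.
  by near: u.
under eq_integral do rewrite EFinM.
rewrite ge0_integralZr//; last 3 first.
- by apply/measurable_EFinP; exact: measurable_hit_prob.
- by move=> w _; rewrite lee_fin fine_ge0.
- by rewrite lee_fin invr_ge0 ltW.
have := @inversion s n s0 sS u q (fun=> 0) u0.
rewrite (_ : (fun k => u * 0 * _) = fun=> 0); last first.
  by apply/funext => k; rewrite mulr0 mul0r.
move=> <-; rewrite (_ : (fun i => u * a i - 0) = fun i => u * a i); last first.
  by apply/funext => i; rewrite subr0.
by rewrite EFinM lte_pdivlMr.
Unshelve. all: by end_near.
Qed.

End grid_volume.

(** * Single times and the union bound *)

Let qv : R := min_value b.

(** By complementary slackness [a] may be replaced by [at_] = A b in the pairing with [lam], which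
    leaves the squared norm of b. *)
Let sum_lam_a : \sum_i lam i * a i = qv.
Proof.
rewrite /qv /min_value; transitivity (\sum_i lam i * mulf A b i).
  apply: eq_bigr => i _; rewrite -atE; have /eqP := slack i.
  by rewrite mulrBr subr_eq0 => /eqP ->.
rewrite -(dot_mulf bE); by apply: eq_bigr => j _; rewrite expr2.
Qed.

Lemma above_scaled (c t : R) (b' : 'I_d -> R) : 0 < t ->
  P (above X e A b' t) =
  P [set w | forall i, b' i + t * e i w < Num.sqrt t * mulf A (Z^~ w) i].
Proof.
move=> t0; pose S (y x : 'I_d -> R) := forall i, b' i + t * y i < mulf A x i.
have mS : measurable [set x : #|{: 'I_d + 'I_d}|.-tuple R |
    S (fun i => untuple x (inl i)) (fun i => untuple x (inr i))].
  apply: measurable_forall_lt => i.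
    apply: measurable_funD => //; apply: measurable_funM => //; exact: measurable_untuple.
  exact: (measurable_mulf _ _ (fun j => measurable_untuple (inr j))).
have := increment_scaling BM (lexx 0) t0 mS.
rewrite [X in P X = _ -> _](_ : _ = above X e A b' t); last first.
  apply/seteqP; split=> w H i; have := H i; rewrite /S;
    congr (_ < mulf A _ _); apply/funext => j; by rewrite (bm_zero BM) subr0.
move=> ->; congr (P _); apply/seteqP; split=> w H i; have := H i;
  by rewrite /S mulfZ subr0.
Qed.

(** By Brownian scaling and division by sqrt t the level becomes u a / sqrt t, larger than u a by
    about s a / (2 u) because 1 / sqrt t = sqrt (1 + s / u^2). The margin [eta] absorbs the
    second-order term and the change of the drift, both controlled through [C]. *)
Lemma scaled_tail (s c eta : R) : 0 <= s -> 0 <= c -> 0 < eta ->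
  \forall u \near +oo,
  (P (above X e A (fun i => u * a i - c * inverted_time u s / u)%R (inverted_time u s)) <=
   (tail_prob (fun i => u * a i - (c + eta - s * a i / 2) / u)%R)%:E)%E.
Proof.
move=> s0 c0 eta0.
pose C : R := \sum_i (`|a i| * s ^+ 2 + s * (`|K1 i| + `|K2 i|)).
near=> u.
have u1 : 1 <= u by near: u; apply: nbhs_pinfty_ge; exact: num_real.
have uC : C / eta <= u by near: u; apply: nbhs_pinfty_ge; exact: num_real.
have u0 : 0 < u by exact: lt_le_trans u1.
pose x := s / u ^+ 2; have x0 : 0 <= x by rewrite divr_ge0// exprn_ge0// ltW.
set t := inverted_time u s; have tE : t = (1 + x)^-1 by [].
have t0 : 0 < t by rewrite tE invr_gt0 ltr_wpDr.
pose rho := Num.sqrt t; have rho0 : 0 < rho by rewrite sqrtr_gt0.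
have rho2 : rho ^+ 2 = t by rewrite sqr_sqrtr// ltW.
(* In terms of y, s = u^2 (2 y + y^2) is polynomial and no square root remains. *)
pose y := rho^-1 - 1.
have rE : rho = (1 + y)^-1 by rewrite /y addrC subrK invrK.
have rho1 : rho <= 1 by rewrite -[1]sqrtr1 ler_wsqrtr// tE invf_le1 ?lerDl// ltr_wpDr.
have y0 : 0 <= y by rewrite subr_ge0 invf_ge1.
have xE : x = 2 * y + y ^+ 2.
  have : (1 + y) ^+ 2 = 1 + x.
    by rewrite /y addrC subrK exprVn rho2 tE invrK.
  lra.
have sE : s = u ^+ 2 * (2 * y + y ^+ 2).
  by rewrite -xE /x mulrC divfK// gt_eqF// exprn_gt0.
rewrite above_scaled// -/rho -tail_probE; apply: le_measure; rewrite ?inE//.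
  apply: measurable_forall_lt => i.
    by apply: measurable_funD => //; exact: measurable_funM.
  by apply: measurable_funM => //; apply: measurable_mulf => j; exact: mX.
move=> w H i; have {H} := H i; rewrite -/t -[Z^~ w]/((X^~ 1)^~ w).
set W := mulf _ _ _ => H.
have Ci : `|a i| * s ^+ 2 + s * (`|K1 i| + `|K2 i|) <= eta * u.
  rewrite [eta * u]mulrC -ler_pdivrMr//; apply: (le_trans _ uC); rewrite ler_pM2r ?invr_gt0//.
  by rewrite /C (bigD1 i)//= lerDl sumr_ge0// => k _; rewrite addr_ge0// mulr_ge0// ?sqr_ge0// addr_ge0.
have ei : `|e i w| <= `|K1 i| + `|K2 i|.
  have := eK1 i w; have := eK2 i w; have := ler_norm (K2 i); have := ler_norm (- K1 i).
  rewrite normrN ler_norml => ? ? ? ?; have := normr_ge0 (K1 i); have := normr_ge0 (K2 i).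
  by move=> ? ?; apply/andP; split; lra.
set Ke := `|K1 i| + `|K2 i| in Ci ei.
have Ke0 : 0 <= Ke by exact: le_trans (normr_ge0 _) ei.
pose v := u * y; have v0 : 0 <= v by rewrite mulr_ge0// ltW.
have vs : v * u <= s by rewrite sE /v; have := sqr_ge0 (u * y); nra.
have bound : `|a i| * v ^+ 2 + v * Ke <= eta.
  rewrite -(ler_pM2r u0); apply: (le_trans _ Ci); rewrite mulrDl; apply: lerD.
    rewrite -mulrA ler_wpM2l//; apply: (@le_trans _ _ ((v * u) ^+ 2)).
      by rewrite [leRHS]exprMn ler_wpM2l ?sqr_ge0// expr2 ler_peMr// ltW.
    by rewrite ler_pXn2r// nnegrE mulr_ge0// ltW.
  by rewrite mulrAC ler_wpM2r.
have rhoy : 1 - rho = rho * y by rewrite rE; field; rewrite gt_eqF// ltr_wpDr.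
have e1 : (1 - rho) * e i w * u <= v * Ke.
  apply: (@le_trans _ _ (y * Ke * u)); last by rewrite /v mulrAC [u * y]mulrC.
  rewrite ler_pM2r//; apply: (@le_trans _ _ ((1 - rho) * Ke)).
    by rewrite ler_wpM2l ?subr_ge0//; apply: le_trans (ler_norm _) ei.
  by rewrite ler_wpM2r// rhoy ler_piMl.
have e2 : a i * v ^+ 2 <= `|a i| * v ^+ 2 by rewrite ler_wpM2r ?sqr_ge0// ler_norm.
have e3 : 0 <= `|a i| * v ^+ 2 by rewrite mulr_ge0// sqr_ge0.
have e4 : 0 <= c * (1 - rho) by rewrite mulr_ge0// subr_ge0.
have rho_y : rho * (1 + y) = 1 by rewrite rE mulVf// gt_eqF// ltr_wpDr.
have y1 : 0 < 1 + y by rewrite ltr_wpDr.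
have {}H : u * a i * (1 + y) - c * rho / u + rho * e i w < W.
  have := H; rewrite -(ltr_pM2r y1) -rho2.
  have -> : rho * W * (1 + y) = W by rewrite mulrAC rho_y mul1r.
  congr (_ < _); rewrite mulrDl mulrBl; congr (_ - _ + _).
    rewrite (_ : c * rho ^+ 2 / u * (1 + y) = c * rho / u * (rho * (1 + y))); last by ring.
    by rewrite rho_y mulr1.
  rewrite (_ : rho ^+ 2 * e i w * (1 + y) = rho * e i w * (rho * (1 + y))); last by ring.
  by rewrite rho_y mulr1.
apply: (le_lt_trans _ H); rewrite -subr_ge0.
have -> : u * a i * (1 + y) - c * rho / u + rho * e i w -
    (u * a i - (c + eta - s * a i / 2) / u + e i w) =
  (eta + c * (1 - rho) - a i * v ^+ 2 / 2 - (1 - rho) * e i w * u) / u.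
  by rewrite sE /v; field; rewrite gt_eqF.
apply: divr_ge0; last exact: ltW.
move: e1 e2 e3 e4 bound; lra.
Unshelve. all: by end_near.
Qed.

Let sl : R := \sum_i lam i.

(** [scaled_tail] followed by [tail_prob_ratio], where <lam, a> = qv gives the exponent (c + eta) sl
    - s qv / 2; [eta] is then taken small. The decay in [s] is what makes times far from 1
    negligible. *)
Lemma above_ub (s c eps : R) : 0 <= s -> 0 <= c -> 0 < eps ->
  \forall u \near +oo,
  (P (above X e A (fun i => u * a i - c * inverted_time u s / u)%R (inverted_time u s)) <=
   ((expR (c * sl - s * qv / 2) + eps) * H u)%:E)%E.
Proof.
move=> s0 c0 eps0.
have [eta eta0 etaP] : exists2 eta : R, 0 < eta &
    expR ((c + eta) * sl - s * qv / 2) <= expR (c * sl - s * qv / 2) + eps / 2.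
  have : expR ((c + x) * sl - s * qv / 2) @[x --> 0^'+] --> expR ((c + 0) * sl - s * qv / 2).
    apply: cvg_at_right_filter; apply: (@continuous_comp _ _ _
      (fun x : R => (c + x) * sl - s * qv / 2) expR); last exact: continuous_expR.
    apply: cvgB; last exact: cvg_cst.
    by apply: cvgM; [apply: cvgD; [exact: cvg_cst|exact: cvg_id]|exact: cvg_cst].
  rewrite addr0 => /cvgrPdist_le/(_ (eps / 2)) H.
  have e20 : 0 < eps / 2 by rewrite divr_gt0.
  near (0 : R)^'+ => eta; exists eta; first by near: eta; exact: nbhs_right_gt.
  have : `|expR (c * sl - s * qv / 2) - expR ((c + eta) * sl - s * qv / 2)| <= eps / 2.
    by near: eta; exact: H.
  by rewrite ler_distlC => /andP[].
pose m i := c + eta - s * a i / 2.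
have mE : \sum_i m i * lam i = (c + eta) * sl - s * qv / 2.
  rewrite -sum_lam_a /sl mulr_sumr mulr_sumr mulr_suml -sumrB.
  by apply: eq_bigr => i _; rewrite /m; field.
have := @tail_prob_ratio m; rewrite mE => /cvgrPdist_le/(_ (eps / 2)) tr.
near=> u.
have u0 : 0 < u by near: u; apply: nbhs_pinfty_gt; exact: num_real.
have Hu : 0 < H u by exact: tail_prob_gt0 (ltW u0).
apply: (@le_trans _ _ (tail_prob (fun i => u * a i - m i / u))%:E).
  near: u; exact: scaled_tail.
have : `|expR ((c + eta) * sl - s * qv / 2) -
    tail_prob (fun i => u * a i - m i / u) / H u| <= eps / 2.
  by near: u; apply: tr; rewrite divr_gt0.
rewrite ler_distlC => /andP[_ le_u]; rewrite lee_fin -ler_pdivrMr//.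
by apply: (le_trans le_u); move: etaP; lra.
Unshelve. all: by end_near.
Qed.

Section hitting_ub.
Variables (s : nat -> R) (n : nat).
Hypotheses (s0 : s 0%N = 0) (sS : forall k, s k < s k.+1).
Implicit Types (q : pred nat) (c : R).

Let s_ge0 k : 0 <= s k.
Proof. by elim: k => [|k IH]; rewrite ?s0// (le_trans IH)// ltW. Qed.

Let levels1 k (c : nat -> R) w : (k <= n)%N ->
  levels s n (pred1 k) c w = [:: level (s k) (c k) w].
Proof.
move=> kn; rewrite /levels (_ : [seq k0 <- _ | _] = [:: k])//.
by rewrite filter_pred1_uniq ?iota_uniq// mem_iota /= add0n ltnS.
Qed.

(** The term - s a of the level contributes exp (- s qv), and the Gaussian moment exp (s qv / 2).
    The result is the constant of [above_ub]: this coincidence is what Pratt's lemma requires of the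
    majorant. *)
Let level_mean k c : (\int[P]_w (expR (\sum_i level (s k) c w i * lam i))%:E =
  (expR (c * sl - s k * qv / 2))%:E)%E.
Proof.
have E w : expR (\sum_i level (s k) c w i * lam i) =
    expR (c * sl - s k * qv) * expR (\sum_j b j * X j (s k) w).
  rewrite -expRD (dot_mulf bE) -sum_lam_a /sl !mulr_sumr -sumrB -big_split/=.
  by congr expR; apply: eq_bigr => i _; rewrite /level; ring.
under eq_integral do rewrite E EFinM.
rewrite ge0_integralZl//; last first.
  apply/measurable_EFinP; apply: measurableT_comp => //; apply: measurable_sum => j.
  exact: measurable_funM.
rewrite (exp_mean_time BM)// -EFinM -expRD; congr (expR _)%:E.
by rewrite /qv /min_value; field.
Qed.

Let volume1 k c w : (k <= n)%N ->
  Lam * volume s n (pred1 k) (fun=> c) w = expR (\sum_i level (s k) c w i * lam i).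
Proof.
move=> kn; rewrite /volume levels1//= (exp_volume1 restr_lam_gt0)/= sum_lam.
have pE : Lam = \prod_k restr lam k by rewrite /Lam big_enum_val.
by rewrite -pE mulrC divfK// gt_eqF.
Qed.

Let sub_hit_prob q c w u : hit_prob (levels s n q (fun=> c) w) u <=
  \sum_(k < n.+1) hit_prob (levels s n (pred1 (k : nat)) (fun=> c) w) u.
Proof.
have mh l : measurable [set x | hit l (fun i => gap u i x)].
  by apply: measurable_hit => i; exact: measurable_gap.
rewrite -lee_fin -sumEFin /hit_prob fineK ?fin_num_measure//.
under eq_bigr do rewrite fineK ?fin_num_measure//.
pose F k := [set x | hit (levels s n (pred1 k) (fun=> c) w) (fun i => gap u i x)].
have mF k : (k < n.+1)%N -> measurable (F k) by move=> _; exact: mh.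
apply: (le_trans _ (Boole_inequality P mF)).
apply: le_measure; rewrite ?inE//.
  by apply: bigsetU_measurable => k _; exact: mh.
rewrite -bigcup_mkord => x /= /hit_levels[k /andP[qk kn] H].
exists k; first by rewrite /= ltnS.
by apply/hit_levels; exists k; rewrite //= eqxx.
Qed.

Let single_ub k c eps : 0 <= c -> 0 < eps -> (k <= n)%N ->
  \forall u \near +oo,
  (\int[P]_w (hit_prob (levels s n (pred1 k) (fun=> c) w) u / H u)%:E <=
   (expR (c * sl - s k * qv / 2) + eps)%:E)%E.
Proof.
move=> c0 eps0 kn.
near=> u.
have u0 : 0 < u by near: u; apply: nbhs_pinfty_gt; exact: num_real.
have Hu : 0 < H u by exact: tail_prob_gt0 (ltW u0).
under eq_integral do rewrite EFinM.
rewrite ge0_integralZr//; last 3 first.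
- by apply/measurable_EFinP; exact: measurable_hit_prob.
- by move=> w _; rewrite lee_fin fine_ge0.
- by rewrite lee_fin invr_ge0 ltW.
(* This lowering is chosen so that u kap (1 + s k / u^2) is the constant c. *)
have := @inversion s n s0 sS u (pred1 k) (fun k => c * inverted_time u (s k) / u) u0.
rewrite (_ : (fun k => u * _ * _) = fun=> c); last first.
  apply/funext => j; rewrite /inverted_time; field; rewrite gt_eqF//=.
  by rewrite gt_eqF// ltr_pwDl// exprn_gt0.
move=> <-; rewrite [X in P X](_ : _ = above X e A
    (fun i => u * a i - c * inverted_time u (s k) / u) (inverted_time u (s k))); last first.
  apply/seteqP; split=> w; first by move=> [j /andP[/eqP -> _]].
  by move=> ab; exists k => //=; rewrite eqxx.
rewrite lee_pdivrMr//; near: u; exact: above_ub.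
Unshelve. all: by end_near.
Qed.

(** Pratt's lemma with the sum over single times as majorant. The integral of its limit comes from
    [level_mean], the upper bound for its integrals from [single_ub], and both give [Hl]. Finiteness
    of the grid volume follows from the same majorant. *)
Lemma hitting_ub q c eps : 0 <= c -> 0 < eps ->
  grid_volume s n q (fun=> c) \is a fin_num /\
  \forall u \near +oo,
  (\int[P]_w (hit_prob (levels s n q (fun=> c) w) u)%:E <=
   ((Lam * fine (grid_volume s n q (fun=> c)) + eps) * H u)%:E)%E.
Proof.
move=> c0 eps0.
pose f u w := hit_prob (levels s n q (fun=> c) w) u / H u.
pose h u w := \sum_(k < n.+1) hit_prob (levels s n (pred1 (k : nat)) (fun=> c) w) u / H u.
pose fl w := Lam * volume s n q (fun=> c) w.
pose hl w := \sum_(k < n.+1) Lam * volume s n (pred1 (k : nat)) (fun=> c) w.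
have mf u : measurable_fun setT (f u).
  by apply: measurable_funM => //; exact: measurable_hit_prob.
have mh1 u (k : 'I_n.+1) : measurable_fun setT (fun w =>
    hit_prob (levels s n (pred1 (k : nat)) (fun=> c) w) u / H u).
  by apply: measurable_funM => //; exact: measurable_hit_prob.
have mh u : measurable_fun setT (h u) by exact: measurable_sum.
have mfl : measurable_fun setT fl.
  by apply: measurable_funM => //; exact: measurable_volume.
have mhl1 (k : 'I_n.+1) : measurable_fun setT (fun w =>
    Lam * volume s n (pred1 (k : nat)) (fun=> c) w).
  by apply: measurable_funM => //; exact: measurable_volume.
have mhl : measurable_fun setT hl by exact: measurable_sum.
have cf w : f u w @[u --> +oo] --> fl w by exact: hit_prob_cvg.
have ch w : h u w @[u --> +oo] --> hl w.
  by apply: cvg_big => [|k _]; [exact: add_continuous|exact: hit_prob_cvg].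
have fh u w : 0 <= f u w <= h u w.
  rewrite divr_ge0 ?tail_prob_ge0 ?fine_ge0//= /h -mulr_suml.
  by rewrite ler_wpM2r ?invr_ge0 ?tail_prob_ge0// sub_hit_prob.
have fl0 w : 0 <= fl w by rewrite mulr_ge0 ?volume_ge0// ltW.
have flhl w : fl w <= hl w.
  rewrite -subr_ge0; apply: (cvgr_to_ge (cvgB (ch w) (cf w))).
  by apply: nearW => u /=; rewrite subr_ge0; have /andP[] := fh u w.
pose Hl : R := \sum_(k < n.+1) expR (c * sl - s k * qv / 2).
have HlE : (\int[P]_w (hl w)%:E = Hl%:E)%E.
  rewrite -sumEFin; under eq_integral do rewrite -sumEFin.
  rewrite ge0_integral_sum//; last 2 first.
  - by move=> k; apply/measurable_EFinP; exact: mhl1.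
  - by move=> k w _; rewrite lee_fin mulr_ge0 ?volume_ge0// ltW.
  apply: eq_bigr => k _; rewrite -level_mean; apply: eq_integral => w _.
  by rewrite volume1// -ltnS.
have flE : (\int[P]_w (fl w)%:E = Lam%:E * grid_volume s n q (fun=> c))%E.
  under eq_integral do rewrite EFinM.
  rewrite ge0_integralZl ?integral_volume//.
  - by apply/measurable_EFinP; exact: measurable_volume.
  - by move=> w _; rewrite lee_fin volume_ge0.
  - by rewrite lee_fin ltW.
have g0 : (0 <= grid_volume s n q (fun=> c))%E.
  by rewrite -integral_volume; apply: integral_ge0 => w _; rewrite lee_fin volume_ge0.
have gfin : grid_volume s n q (fun=> c) \is a fin_num.
  have : (Lam%:E * grid_volume s n q (fun=> c) <= Hl%:E)%E.
    rewrite -flE -HlE; apply: ge0_le_integral => //.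
    - by move=> w _; rewrite lee_fin.
    - exact/measurable_EFinP.
    - exact/measurable_EFinP.
    - by move=> w _; rewrite lee_fin.
  move: g0; case: (grid_volume _ _ _ _) => [r| |]// _.
  by rewrite gt0_muley ?lte_fin// leye_eq.
split=> //.
have hub eps' : 0 < eps' -> \forall u \near +oo, (\int[P]_w (h u w)%:E <= (Hl + eps')%:E)%E.
  move=> eps'0; have e'0 : 0 < eps' / n.+1%:R by rewrite divr_gt0.
  have H1 : \forall u \near +oo, forall k : 'I_n.+1,
      (\int[P]_w (hit_prob (levels s n (pred1 (k : nat)) (fun=> c) w) u / H u)%:E <=
      (expR (c * sl - s k * qv / 2) + eps' / n.+1%:R)%:E)%E.
    by apply: filter_forall => k; apply: single_ub => //; rewrite -ltnS.
  near=> u.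
  have H2 : forall k : 'I_n.+1,
      (\int[P]_w (hit_prob (levels s n (pred1 (k : nat)) (fun=> c) w) u / H u)%:E <=
      (expR (c * sl - s k * qv / 2) + eps' / n.+1%:R)%:E)%E by near: u.
  under eq_integral do rewrite -sumEFin.
  rewrite ge0_integral_sum//; last 2 first.
  - by move=> k; apply/measurable_EFinP; exact: mh1.
  - by move=> k w _; rewrite lee_fin divr_ge0 ?tail_prob_ge0 ?fine_ge0.
  apply: (le_trans (lee_sum _ (fun k _ => H2 k))).
  rewrite sumEFin lee_fin big_split/= sumr_const card_ord lerD2l.
  by rewrite -[leLHS]mulr_natr divfK.
have FlE : (\int[P]_w (fl w)%:E = (Lam * fine (grid_volume s n q (fun=> c)))%:E)%E.
  by rewrite flE EFinM fineK.
have := @pratt R _ T P f h fl hl Hl _ eps mf mh mfl mhl fh cf ch FlE HlE hub eps0.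
move=> Hpratt; near=> u.
have u0 : 0 < u by near: u; apply: nbhs_pinfty_gt; exact: num_real.
have Hu : 0 < H u by exact: tail_prob_gt0 (ltW u0).
have : (\int[P]_w (f u w)%:E <= (Lam * fine (grid_volume s n q (fun=> c)) + eps)%:E)%E.
  by near: u.
under eq_integral do rewrite /f EFinM.
rewrite ge0_integralZr//; last 3 first.
- by apply/measurable_EFinP; exact: measurable_hit_prob.
- by move=> w _; rewrite lee_fin fine_ge0.
- by rewrite lee_fin invr_ge0 ltW.
by rewrite [X in _ -> (_ <= X)%E]EFinM lee_pdivrMr.
Unshelve. all: by end_near.
Qed.

End hitting_ub.

(** * The constant of the theorem as a limit over dyadic grids *)

Definition crossing_volume : \bar R := \int[lebesgue_tuple #|I|]_x
  (P (crossing X A a (tnth x)) * (expR (\sum_k restr lam k * tnth x k))%:E).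

Let dyad N (k : nat) : R := k%:R / 2 ^+ N.

Let dyad0 N : dyad N 0 = 0.
Proof. by rewrite /dyad mul0r. Qed.

Let dyadS N k : dyad N k < dyad N k.+1.
Proof. by rewrite ltr_pM2r ?ltr_nat// invr_gt0 exprn_gt0. Qed.

Let dyad_double N k : dyad N.+1 k.*2 = dyad N k.
Proof.
rewrite /dyad exprS -muln2 natrM; field.
by rewrite gt_eqF// exprn_gt0.
Qed.

Let cX i w : {within `[0, +oo[, continuous (X i ^~ w)}.
Proof. exact: (bm_continuous BM). Qed.

Let X_cont i w : {within `[0, +oo[, continuous (fun t => mulf A (fun j => X j t w) i)}.
Proof. exact: (@mulf_continuous _ _ _ _ X A cX i w). Qed.

(** Mesh 2^-N on [0, N]: the grids are nested and exhaust the dyadic times, so these events increase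
    to the crossing event. *)
Let cross_grid N : set (T * #|I|.-tuple R) := [set z |
  hit (map restr (levels (dyad N) (N * 2 ^ N) xpredT (fun=> 0) z.1)) (tnth z.2)].

Let measurable_cross_grid N : measurable (cross_grid N).
Proof. exact: measurable_hit_restr. Qed.

Let cross_grid_homo : {homo cross_grid : M N / (M <= N)%N >-> (M <= N)%O}.
Proof.
apply/nondecreasing_seqP => N; apply/subsetPset => z /hit_restr_levels[k kn H].
apply/hit_restr_levels; exists k.*2.
  rewrite /= -muln2 (leq_trans (leq_mul (kn : (k <= _)%N) (leqnn 2)))//.
  by rewrite -mulnA -expnSr leq_mul.
by move=> j; have := H j; rewrite dyad_double.
Qed.

Let cross_grid_bigcup : \bigcup_N cross_grid N = [set z | crossing X A a (tnth z.2) z.1].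
Proof.
apply/seteqP; split=> z /=.
  move=> [N _ /hit_restr_levels[k _ H]].
  exists (dyad N k); first by rewrite divr_ge0// exprn_ge0.
  by move=> j; have := H j; rewrite /level addr0.
move=> [t t0 H].
pose f (k : 'I_#|I|) (t : R) := mulf A (fun j => X j t z.1) (enum_val k) -
  t * a (enum_val k) - tnth z.2 k.
have cf k : {within `[0, +oo[, continuous f k}.
  move=> y; apply: cvgB; last exact: cvg_cst.
  apply: cvgB; first exact: X_cont.
  by apply: cvgM; [exact: within_continuous_id|exact: cvg_cst].
have f0 k : 0 < f k t by rewrite subr_gt0.
have [N [k [tN kt Hk]]] := dyadic_below (Num.truncn t).+1 cf t0 f0.
exists N => //; apply/hit_restr_levels; exists k.
  rewrite /= -(ler_nat R) natrM natrX.
  move: kt; rewrite ler_pdivrMr ?exprn_gt0// => /le_trans -> //.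
  rewrite ler_wpM2r ?exprn_ge0//; apply: le_trans (ltW (truncnS_gt t)) _.
  by rewrite ler_nat.
by move=> j; have := Hk j; rewrite subr_gt0 /level addr0.
Qed.

Let exp_ge0 (x : #|I|.-tuple R) : (0 <= (expR (\sum_k restr lam k * tnth x k))%:E)%E.
Proof. by rewrite lee_fin expR_ge0. Qed.

Let measurable_exp : measurable_fun [set: #|I|.-tuple R]
  (fun x => (expR (\sum_k restr lam k * tnth x k))%:E).
Proof.
apply/measurable_EFinP; apply: measurableT_comp => //; apply: measurable_sum => k.
apply: measurable_funM => //; exact: measurable_tnth.
Qed.

Let ysectionE (E : set (T * #|I|.-tuple R)) x : ysection E x = [set w | E (w, x)].
Proof. by apply/seteqP; split=> w; rewrite /ysection/= inE. Qed.

Let mcrossing (x : #|I|.-tuple R) : measurable (crossing X A a (tnth x)).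
Proof. exact: (measurable_crossing_event _ _ mX cX). Qed.

Let measurable_P_section (E : set (T * #|I|.-tuple R)) : measurable E ->
  measurable_fun setT (fun x => P [set w | E (w, x)]).
Proof.
move=> mE; have := @measurable_fun_ysection _ _ T (#|I|.-tuple R) R P E mE.
by apply: eq_measurable_fun => x _ /=; rewrite ysectionE.
Qed.

(** Monotone convergence along the nested grids: a common bound on all the grid volumes would pass
    to [crossing_volume]. *)
Lemma crossing_volume_sup (r : \bar R) : (r < crossing_volume)%E ->
  exists N, (r < grid_volume (dyad N) (N * 2 ^ N) xpredT (fun=> 0%R))%E.
Proof.
move=> rV; apply: contrapT => nr.
have {}nr N : (grid_volume (dyad N) (N * 2 ^ N) xpredT (fun=> 0%R) <= r)%E.
  by rewrite leNgt; apply/negP => ?; apply: nr; exists N.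
pose g N x : \bar R := (P [set w | cross_grid N (w, x)] *
  (expR (\sum_k restr lam k * tnth x k))%:E)%E.
have mg N : measurable_fun setT (g N).
  by apply: emeasurable_funM => //; exact: measurable_P_section.
have g0 N x : setT x -> (0 <= g N x)%E by move=> _; exact: mule_ge0.
have ndg x : setT x -> nondecreasing_seq (g ^~ x).
  move=> _ M N MN; apply: lee_wpmul2r => //; apply: le_measure; rewrite ?inE.
  - by have := measurable_ysection x (measurable_cross_grid M); rewrite ysectionE.
  - by have := measurable_ysection x (measurable_cross_grid N); rewrite ysectionE.
  by move=> w; have /subsetPset := cross_grid_homo MN; apply.
have gl x : limn (g ^~ x) = (P (crossing X A a (tnth x)) *
    (expR (\sum_k restr lam k * tnth x k))%:E)%E.
  apply/cvg_lim => //; apply: cvgeZr => //.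
  rewrite (_ : crossing _ _ _ _ = \bigcup_N [set w | cross_grid N (w, x)]).
    apply: nondecreasing_cvg_mu.
    - by move=> N; have := measurable_ysection x (measurable_cross_grid N); rewrite ysectionE.
    - apply: bigcup_measurable => N _.
      by have := measurable_ysection x (measurable_cross_grid N); rewrite ysectionE.
    - move=> M N MN; apply/subsetPset => w.
      by have /subsetPset := cross_grid_homo MN; apply.
  have := cross_grid_bigcup => /seteqP[H1 H2].
  apply/seteqP; split=> w; first by move=> /(H2 (w, x))[N _ H]; exists N.
  by move=> [N _ H]; apply: (H1 (w, x)); exists N.
have := @cvg_monotone_convergence _ _ R (lebesgue_tuple #|I|) setT measurableT g mg g0 ndg.
move=> cv; have : (\int[lebesgue_tuple #|I|]_x limn (g^~ x) <= r)%E.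
  by apply: (cvge_to_le cv); exact: nearW.
rewrite leNgt => /negP; apply.
by under eq_integral do rewrite gl.
Qed.

Lemma grid_volume_le (s : nat -> R) n q : s 0%N = 0 -> (forall k, s k < s k.+1) ->
  (grid_volume s n q (fun=> 0%R) <= crossing_volume)%E.
Proof.
move=> s0 sS.
have s_ge0 k : 0 <= s k by elim: k => [|k IH]; rewrite ?s0// (le_trans IH)// ltW.
have mh x : measurable [set w | hit (map restr (levels s n q (fun=> 0) w)) (tnth x)].
  have := measurable_ysection x (@measurable_hit_restr s n q (fun=> 0)).
  by rewrite ysectionE.
apply: ge0_le_integral => //.
- by move=> x _; exact: mule_ge0.
- apply: emeasurable_funM => //.
  exact: (measurable_P_section (@measurable_hit_restr s n q (fun=> 0))).
- apply: emeasurable_funM => //.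
  apply: (@measurable_P_section [set z | crossing X A a (tnth z.2) z.1]).
  by rewrite -cross_grid_bigcup; exact: bigcup_measurable.
move=> x _; apply: lee_wpmul2r => //; apply: le_measure; rewrite ?inE//.
move=> w /= /hit_restr_levels[k _ H]; exists (s k) => // j.
by have := H j; rewrite /level addr0.
Qed.

Let hitting_grid u N : set T := [set w | exists2 r, r \in [seq dyad N k | k <- iota 0 (2 ^ N).+1] &
  above X e A (fun i => u * a i) r w].

Let mem_grid N r : r \in [seq dyad N k | k <- iota 0 (2 ^ N).+1] ->
  exists2 k, (k <= 2 ^ N)%N & r = dyad N k.
Proof. by move=> /mapP[k]; rewrite mem_iota /= add0n ltnS => kN ->; exists k. Qed.

Let dyad_mem N k : (k <= 2 ^ N)%N -> dyad N k \in [seq dyad N k | k <- iota 0 (2 ^ N).+1].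
Proof. by move=> kN; apply: map_f; rewrite mem_iota /= add0n ltnS. Qed.

Lemma measurable_exists_above (F : seq R) b' :
  measurable [set w | exists2 r, r \in F & above X e A b' r w].
Proof.
rewrite (_ : mkset _ = \big[setU/set0]_(r <- F) above X e A b' r).
  by apply: bigsetU_measurable => r _; exact: (measurable_above BM).
elim: F => [|r F IH]; first by rewrite big_nil; apply/seteqP; split=> w [].
rewrite big_cons -IH; apply/seteqP; split=> w.
  by move=> [r']; rewrite inE => /orP[/eqP ->|rF] ab; [left|right; exists r'].
by move=> [ab|[r' rF ab]]; [exists r; rewrite ?mem_head|exists r'; rewrite ?inE ?rF ?orbT].
Qed.

Let hitting_bigcup u : hitting_event X A a e u = \bigcup_N hitting_grid u N.
Proof.
apply/seteqP; split=> w.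
  move=> [t /andP[t0 t1] H].
  pose f i (t : R) := mulf A (fun j => X j t w) i - (u * a i + t * e i w).
  have cf i : {within `[0, +oo[, continuous f i}.
    move=> y; apply: cvgB; first exact: X_cont.
    apply: cvgD; first exact: cvg_cst.
    by apply: cvgM; [exact: within_continuous_id|exact: cvg_cst].
  have f0 i : 0 < f i t by rewrite subr_gt0.
  have [N [k [_ kt Hk]]] := dyadic_below 0 cf t0 f0.
  exists N => //; exists (dyad N k); last by move=> i; have := Hk i; rewrite subr_gt0.
  apply: dyad_mem; have := le_trans kt t1.
  by rewrite ler_pdivrMr ?exprn_gt0// mul1r -natrX ler_nat.
move=> [N _ [r /mem_grid[k kN ->] H]]; exists (dyad N k) => //.
rewrite divr_ge0 ?exprn_ge0//= ler_pdivrMr ?exprn_gt0// mul1r -natrX ler_nat//.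
Qed.

Lemma measurable_hitting_event u : measurable (hitting_event X A a e u).
Proof. exact: (measurable_hitting _ _ mX cX). Qed.

(** The event is the increasing union of its dyadic versions, so a bound uniform over finite sets of
    times passes to it by continuity from below. *)
Lemma hitting_event_le u (C : \bar R) :
  (forall F : seq R, (forall r, r \in F -> 0 <= r <= 1) ->
    (P [set w | exists2 r, r \in F & above X e A (fun i => u * a i)%R r w] <= C)%E) ->
  (P (hitting_event X A a e u) <= C)%E.
Proof.
move=> H; rewrite hitting_bigcup.
have : P (hitting_grid u N) @[N --> \oo] --> P (\bigcup_N hitting_grid u N).
  apply: nondecreasing_cvg_mu.
  - by move=> N; exact: measurable_exists_above.
  - by apply: bigcup_measurable => N _; exact: measurable_exists_above.
  apply/nondecreasing_seqP => N; apply/subsetPset => w [r /mem_grid[k kN ->] ab].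
  exists (dyad N k) => //; rewrite -dyad_double; apply: dyad_mem.
  by rewrite -muln2 expnSr leq_mul.
move=> cv; apply: (cvge_to_le cv); apply: nearW => N; apply: H => r /mem_grid[k kN ->].
by rewrite divr_ge0 ?exprn_ge0//= ler_pdivrMr ?exprn_gt0// mul1r -natrX ler_nat.
Qed.

(** * Early times, the coarse grid and the two bounds *)

Hypothesis a_pos : exists i, 0 < a i.

Let qv_gt0 : 0 < qv.
Proof.
rewrite lt_neqAle eq_sym sumr_ge0 ?andbT; last by move=> j _; exact: sqr_ge0.
apply/negP => /eqP q0; have [i ai] := a_pos.
suff : at_ i = 0 by move=> ati; have := le_a i; rewrite ati leNgt ai.
rewrite atE /mulf big1// => j _; suff -> : b j = 0 by rewrite mulr0.
have /eqP := q0; rewrite psumr_eq0; last by move=> ? _; exact: sqr_ge0.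
by move=> /allP/(_ j (mem_index_enum j))/=; rewrite sqrf_eq0 => /eqP.
Qed.

(** [first_passage] asks for a nonnegative upper bound on the drift. *)
Let Kp i := Num.max 0 (K2 i).

Let Kp_ge0 i : 0 <= Kp i.
Proof. by rewrite le_max lexx. Qed.

Let eKp i w : e i w <= Kp i.
Proof. by rewrite le_max eK2 orbT. Qed.

Let orthant_set (c : 'I_d -> R) : set T :=
  [set w | forall i, c i < mulf A ((X^~ 1)^~ w) i].

Let measurable_orthant_set c : measurable (orthant_set c).
Proof. by apply: measurable_forall_lt => i //; apply: measurable_mulf => j; exact: mX. Qed.

(** [exceed_lb] at u = 0 for the level c - K1: since e >= K1, that exceedance event is contained in
    the orthant set. *)
Let orthant_set_gt0 c : (0 < P (orthant_set c))%E.
Proof.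
have [c0 [C1 [c00 lb]]] := exceed_lb me (fun i => mX i 1) indepZ atE le_a unitA
  (fun i => c i - K1 i + K2 i).
have := lb 0 (fun i => c i - K1 i) (lexx 0).
rewrite expr0n/= mul0r mul0r oppr0 mulr0 subr0 expR0 mulr1 => {}lb.
apply: (@lt_le_trans _ _ (P (exceed e Z A (fun i => c i - K1 i)))).
  apply: (lt_le_trans _ (lb _)); first by rewrite lte_fin.
  by move=> i w; rewrite mul0r add0r lerD2l.
apply: le_measure; rewrite ?inE// => w H i; apply: le_lt_trans (H i).
by rewrite -addrA lerDl addrC subr_ge0.
Qed.

Let above1 u : above X e A (fun i => u * a i) 1 = exceed e Z A (fun i => u * a i).
Proof. by apply/seteqP; split=> w H i; have := H i; rewrite mul1r. Qed.

Let exists_le_above (F : seq R) b' t :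
  (P [set w | exists2 r, r \in F & above X e A b' t w] <= P (above X e A b' t))%E.
Proof.
apply: le_measure; rewrite ?inE; last by move=> w [].
  rewrite (_ : mkset _ = if nilp F then set0 else above X e A b' t).
    by case: ifP => // _; exact: (measurable_above BM).
  case: F => [|r F]/=; apply/seteqP; split=> w //; try by move=> [].
  by move=> ab; exists r; rewrite ?mem_head.
exact: (measurable_above BM).
Qed.

(** First passage with the common target time [t], duration bound 1 and no lowering. [C] is the
    inverse of the probability that a Gaussian vector overcomes the bound on the drift, so it
    depends neither on u nor on t nor on F. *)
Let early_passage : exists2 C : R, 0 < C & forall u t (F : seq R), t <= 1 ->
  (forall r, r \in F -> 0 <= r <= t) ->
  (P [set w | exists2 r, r \in F & above X e A (fun i => u * a i)%R r w] <=
   C%:E * P (above X e A (fun i => u * a i)%R t))%E.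
Proof.
pose c i := Num.sqrt 1 * Kp i - 0 / Num.sqrt 1.
have fin : P (orthant_set c) = (fine (P (orthant_set c)))%:E.
  by rewrite fineK// fin_num_measure.
set th := fine _ in fin.
have th0 : 0 < th by rewrite -lte_fin -fin orthant_set_gt0.
exists th^-1; first by rewrite invr_gt0.
move=> u t F t1 hF.
have := @first_passage_seq _ _ _ P _ X e BM A F (fun=> t) (fun i => u * a i) Kp 1 0
  ltr01 (lexx 0) eKp Kp_ge0.
have H r : r \in F -> [/\ 0 <= r, r <= t & t - r <= 1].
  by move=> /hF/andP[r0 rt]; split=> //; lra.
move=> /(_ H); rewrite -/(orthant_set c) fin => fp.
rewrite lee_pdivlMl//; apply: (le_trans fp).
rewrite (_ : (fun i => u * a i - 0) = (fun i => u * a i)); last first.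
  by apply/funext => i; rewrite subr0.
exact: exists_le_above.
Qed.

Let crossing_volume_ge0 : (0 <= crossing_volume)%E.
Proof. by apply: integral_ge0 => x _; exact: mule_ge0. Qed.

(** If Lam times some grid volume exceeded C, [hitting_lb] would push the probability of hitting on
    that grid above C H u for large u, against [early_passage] at t = 1. Hence C / Lam bounds all
    grid volumes, and by [crossing_volume_sup] their limit. *)
Let crossing_volume_fin : crossing_volume \is a fin_num.
Proof.
have [C C0 early] := early_passage.
have gv N : (Lam%:E * grid_volume (dyad N) (N * 2 ^ N) xpredT (fun=> 0%R) <= C%:E)%E.
  rewrite leNgt; apply/negP => /(hitting_lb (dyad0 N) (dyadS N)) ltC.
  near (+oo : set_system R) => u.
  have u0 : 0 < u by near: u; apply: nbhs_pinfty_gt; exact: num_real.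
  have : ((C * H u)%:E < P [set w | exists2 k, xpredT k && (k <= N * 2 ^ N)%N &
      above X e A (fun i => u * a i)%R (inverted_time u (dyad N k)) w])%E by near: u.
  apply/negP; rewrite -leNgt EFinM -tail_probE -above1.
  pose F := [seq inverted_time u (dyad N k) | k <- iota 0 (N * 2 ^ N).+1].
  apply: (le_trans _ (early u 1 F (lexx 1) _)).
    apply: le_measure; rewrite ?inE; last 2 first.
    - exact: measurable_exists_above.
    - move=> w [k kn ab]; exists (inverted_time u (dyad N k)) => //.
      by apply/mapP; exists k; rewrite // mem_iota /= add0n ltnS.
    rewrite (_ : mkset _ = \bigcup_(k in [set k | (k <= N * 2 ^ N)%N])
      above X e A (fun i => u * a i) (inverted_time u (dyad N k))).
      by apply: bigcup_measurable => k _; exact: (measurable_above BM).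
    by apply/seteqP; split=> w [k kn ab]; exists k.
  move=> r /mapP[k _ ->]; rewrite /inverted_time.
  have x0 : 0 <= dyad N k / u ^+ 2.
    by rewrite divr_ge0// ?exprn_ge0// ?divr_ge0// ?exprn_ge0// ltW.
  by rewrite invr_ge0 addr_ge0//= invf_le1 ?lerDl// ltr_pwDl.
rewrite ge0_fin_numE//; rewrite ltNge; apply/negP => Voo.
have : ((C / Lam)%:E < crossing_volume)%E by apply: lt_le_trans Voo; rewrite ltry.
move=> /crossing_volume_sup[N]; apply/negP; rewrite -leNgt.
by rewrite mulrC EFinM lee_pdivlMl.
Unshelve. all: by end_near.
Qed.

Let V : R := fine crossing_volume.

Let VE : crossing_volume = V%:E.
Proof. by rewrite fineK. Qed.

Let early_tail (eps : R) : 0 < eps -> exists2 T0 : R, 0 <= T0 & forall s, T0 <= s ->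
  \forall u \near +oo, forall F : seq R,
  (forall r, r \in F -> 0 <= r <= inverted_time u s) ->
  (P [set w | exists2 r, r \in F & above X e A (fun i => u * a i)%R r w] <=
   (eps * H u)%:E)%E.
Proof.
move=> eps0; have [C C0 early] := early_passage.
pose eps1 := eps / (2 * C).
have eps10 : 0 < eps1 by rewrite divr_gt0// mulr_gt0.
(* From exp (- x) <= 1 / (1 + x) with x = s qv / 2 >= 1 / eps1, it follows that exp (- s qv / 2) <=
   eps1. *)
exists (2 / (qv * eps1)); first by rewrite divr_ge0// ltW// mulr_gt0.
move=> s Ts.
have s0 : 0 < s by apply: lt_le_trans Ts; rewrite divr_gt0// mulr_gt0.
have expE : expR (0 * sl - s * qv / 2) <= eps1.
  rewrite mul0r sub0r expRN invf_ple ?posrE ?expR_gt0//.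
  apply: le_trans (expR_ge1Dx _); apply: (@le_trans _ _ (s * qv / 2)); last by rewrite lerDr.
  move: Ts; rewrite ler_pdivrMr; last exact: mulr_gt0.
  by move=> Ts; rewrite -[leLHS]div1r ler_pdivrMr//; move: Ts; lra.
near=> u => F hF.
have u0 : 0 < u by near: u; apply: nbhs_pinfty_gt; exact: num_real.
have Hu : 0 < H u by exact: tail_prob_gt0 (ltW u0).
have t1 : inverted_time u s <= 1.
  have x0 : 0 <= s / u ^+ 2 by rewrite divr_ge0 ?exprn_ge0// ltW.
  by rewrite invf_le1 ?lerDl// ltr_pwDl.
apply: (le_trans (early u _ F t1 hF)).
have : (P (above X e A (fun i => u * a i - 0 * inverted_time u s / u)%R (inverted_time u s)) <=
   ((expR (0 * sl - s * qv / 2) + eps1) * H u)%:E)%E.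
  near: u; exact: (above_ub (ltW s0) (lexx 0) eps10).
rewrite (_ : (fun i => u * a i - _) = (fun i => u * a i)); last first.
  by apply/funext => i; rewrite !mul0r subr0.
move=> ab; apply: (@le_trans _ _ (C%:E * ((eps1 + eps1) * H u)%:E)%E).
  apply: lee_wpmul2l; first by rewrite lee_fin ltW.
  by apply: (le_trans ab); rewrite lee_fin ler_pM2r// lerD2r.
rewrite -EFinM lee_fin mulrA ler_pM2r// /eps1.
by rewrite (_ : C * _ = eps)//; field; rewrite gt_eqF.
Unshelve. all: by end_near.
Qed.

Let del (j : nat) : R := j.+1%:R^-1.

Let del_gt0 j : 0 < del j.
Proof. by rewrite invr_gt0. Qed.

(** With duration del^4 / u^2 and lowering del / u, the first-passage event has threshold del^2 Kp /
    u - 1 / del. For u >= 1 it contains this set, which does not depend on u. *)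
Let theta_set j := orthant_set (fun i => del j ^+ 2 * Kp i - (del j)^-1).

Let theta j : R := fine (P (theta_set j)).

Let thetaE j : P (theta_set j) = (theta j)%:E.
Proof.
by rewrite /theta fineK// fin_num_measure//; exact: measurable_orthant_set.
Qed.

Let theta_gt0 j : 0 < theta j.
Proof. by rewrite -lte_fin -thetaE orthant_set_gt0. Qed.

Let del_cvg0 : del j @[j --> \oo] --> (0 : R).
Proof. exact: cvg_harmonic. Qed.

(** As del decreases, the thresholds decrease to minus infinity, so the events increase to the whole
    space. *)
Let theta_cvg1 : theta j @[j --> \oo] --> (1 : R).
Proof.
have := @nondecreasing_cvg_mu _ _ _ P theta_set (fun=> measurable_orthant_set _).
rewrite (_ : \bigcup_j theta_set j = setT).
  move=> /(_ measurableT) H.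
  have : P (theta_set j) @[j --> \oo] --> 1%:E.
    rewrite (_ : 1%:E = P setT); last exact: esym (probability_setT P).
    apply: H; apply/nondecreasing_seqP => j; apply/subsetPset => w Hw i.
    apply: le_lt_trans (Hw i); apply: lerB; last by rewrite /del !invrK ler_nat.
    rewrite ler_wpM2r// ler_pXn2r ?nnegrE ?invr_ge0//.
    by rewrite lef_pV2 ?posrE// ler_nat.
  by move=> /fine_cvg.
apply/seteqP; split=> // w _.
pose M := \sum_i (Kp i + `|mulf A ((X^~ 1)^~ w) i|).
exists (Num.truncn M) => //= i; rewrite /del invrK.
set N := (Num.truncn M).+1.
have MN : M < N%:R by exact: truncnS_gt.
have Mi : Kp i + `|mulf A ((X^~ 1)^~ w) i| <= M.
  by rewrite /M (bigD1 i)//= lerDl sumr_ge0// => j _; rewrite addr_ge0.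
have KN : N%:R^-1 ^+ 2 * Kp i <= Kp i.
  by rewrite ler_piMl// exprn_ile1 ?invr_ge0// invf_le1 ?ltr0n// ler1n.
have := ler_norm (- mulf A ((X^~ 1)^~ w) i); rewrite normrN.
move: KN Mi MN; lra.
Qed.

(* The coarse grid has step del^4 in s, hence at most del^4 / u^2 in t, where the
   fluctuations are of order del^2 / u, negligible against the lowering del / u. *)
Let main_region (j n : nat) (eps : R) : 0 < eps ->
  \forall u \near +oo, forall F : seq R,
  (forall r, r \in F -> inverted_time u (n%:R * del j ^+ 4) <= r <= 1) ->
  ((theta j)%:E * P [set w | exists2 r, r \in F & above X e A (fun i => u * a i)%R r w] <=
   ((Lam * (expR (2 * del j * sl) * V) + eps) * H u)%:E)%E.
Proof.
move=> eps0; set D := del j; have D0 : 0 < D by exact: del_gt0.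
pose s (k : nat) : R := k%:R * D ^+ 4.
have D40 : 0 < D ^+ 4 by rewrite exprn_gt0.
have s0 : s 0%N = 0 by rewrite /s mul0r.
have sS k : s k < s k.+1 by rewrite /s ltr_pM2r// ltr_nat.
have s_ge0 k : 0 <= s k by rewrite /s mulr_ge0// ltW.
have c0 : 0 <= 2 * D by rewrite mulr_ge0// ltW.
(* The lowering del / u moves the corner by del (1 + s / u^2), at most 2 del once s n <= u^2. *)
have [_ ub] := @hitting_ub s n s0 sS xpredT (2 * D) eps c0 eps0.
have gvE : (fine (grid_volume s n xpredT (fun=> 2 * D)) <= expR (2 * D * sl) * V)%R.
  have vE w : volume s n xpredT (fun=> 2 * D) w =
      expR (2 * D * sl) * volume s n xpredT (fun=> 0) w.
    have slE : sl = \sum_k restr lam k.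
      transitivity (\sum_i 1 * lam i); first by apply: eq_bigr => i _; rewrite mul1r.
      by rewrite (sum_lam (fun=> 1)); apply: eq_bigr => k _; rewrite /restr mulr1.
    rewrite /volume slE -exp_volume_shift//; congr (fine (exp_volume _ _)).
    rewrite /levels -!map_comp; apply: eq_map => k; apply/funext => i.
    by rewrite /= /restr /level addr0.
  have -> : grid_volume s n xpredT (fun=> 2 * D) =
      ((expR (2 * D * sl))%:E * grid_volume s n xpredT (fun=> 0%R))%E.
    rewrite -!integral_volume -ge0_integralZl//.
    - by apply: eq_integral => w _; rewrite vE EFinM.
    - by apply/measurable_EFinP; exact: measurable_volume.
    - by move=> w _; rewrite lee_fin volume_ge0.
  have gle := grid_volume_le n xpredT s0 sS.
  have g0 : (0 <= grid_volume s n xpredT (fun=> 0%R))%E.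
    by rewrite -integral_volume; apply: integral_ge0 => w _; rewrite lee_fin volume_ge0.
  have gf : grid_volume s n xpredT (fun=> 0%R) \is a fin_num.
    by rewrite ge0_fin_numE// (le_lt_trans gle)// VE ltry.
  by rewrite fineM// ler_wpM2l ?expR_ge0// fine_le.
near=> u => F hF.
have u1 : 1 <= u by near: u; apply: nbhs_pinfty_ge; exact: num_real.
have usn : s n <= u by near: u; apply: nbhs_pinfty_ge; exact: num_real.
have u0 : 0 < u by exact: lt_le_trans u1.
have Hu : 0 < H u by exact: tail_prob_gt0 (ltW u0).
have u20 : 0 < u ^+ 2 by rewrite exprn_gt0.
have usn2 : s n / u ^+ 2 <= 1.
  by rewrite ler_pdivrMr// mul1r (le_trans usn)// expr2 ler_peMr// ltW.
(* [sr] inverts [inverted_time]. Rounding down to the mesh in s gives a later time, so [g r] is the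
   first coarse time at or after [r]. *)
pose sr r := u ^+ 2 * (r^-1 - 1).
pose kr r := Num.truncn (sr r / D ^+ 4).
pose g r := inverted_time u (s (kr r)).
have Fr r : r \in F -> [/\ 0 < r, r <= 1, 0 <= sr r & sr r <= s n].
  move=> /hF/andP[tr r1].
  have t0 : 0 < inverted_time u (n%:R * D ^+ 4).
    by rewrite invr_gt0 ltr_pwDl// divr_ge0 ?(ltW u20)//; exact: (s_ge0 n).
  have r0 : 0 < r by exact: lt_le_trans tr.
  split=> //; first by rewrite /sr mulr_ge0 ?(ltW u20)// subr_ge0 invf_ge1.
  rewrite /sr -ler_pdivlMl// [_ * s n]mulrC lerBlDl.
  by rewrite -[leRHS]invrK lef_pV2 ?posrE.
have krP r : r \in F -> s (kr r) <= sr r < s (kr r) + D ^+ 4.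
  move=> /Fr[r0 r1 sr0 _]; have q0 : 0 <= sr r / D ^+ 4 by rewrite divr_ge0// ltW.
  have /andP[h1 h2] := truncn_itv q0; apply/andP; split.
    by rewrite /s -ler_pdivlMr.
  by rewrite /s -[X in _ + X]mul1r -mulrDl natr1 -ltr_pdivrMr.
have rE r : r \in F -> r = inverted_time u (sr r).
  move=> /Fr[r0 _ _ _]; rewrite /inverted_time /sr mulrAC divff ?gt_eqF// mul1r.
  by rewrite addrC subrK invrK.
have gF r : r \in F -> [/\ 0 <= r, r <= g r & g r - r <= D ^+ 4 / u ^+ 2].
  move=> rF; have [r0 r1 sr0 _] := Fr r rF; have /andP[h1 h2] := krP r rF.
  split; first exact: ltW.
    rewrite {1}(rE r rF) /g /inverted_time lef_pV2 ?posrE ?ltr_pwDl ?divr_ge0 ?(ltW u20)//.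
    by rewrite lerD2l ler_pM2r ?invr_gt0.
  rewrite {2}(rE r rF) /g /inverted_time.
  have inv_lip (x y : R) : 0 <= x -> x <= y -> (1 + x)^-1 - (1 + y)^-1 <= y - x.
    move=> x0 xy; have y0 := le_trans x0 xy.
    have -> : (1 + x)^-1 - (1 + y)^-1 = (y - x) / ((1 + x) * (1 + y)).
      by field; rewrite !gt_eqF// ltr_pwDl.
    rewrite ler_pdivrMr ?mulr_gt0 ?ltr_pwDl// ler_peMr ?subr_ge0//.
    by rewrite mulr_ege1// lerDl.
  apply: (le_trans (inv_lip _ _ _ _)).
  - by rewrite divr_ge0 ?(ltW u20).
  - by rewrite ler_pM2r ?invr_gt0.
  by rewrite -mulrBl ler_pM2r ?invr_gt0//; move: h1 h2; lra.
have := @first_passage_seq _ _ _ P _ X e BM A F g (fun i => u * a i) Kp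
  (D ^+ 4 / u ^+ 2) (D / u) (divr_gt0 D40 u20) (ltW (divr_gt0 D0 u0)) eKp Kp_ge0 gF.
set th := P [set w | _] => fp.
have sqD : Num.sqrt (D ^+ 4 / u ^+ 2) = D ^+ 2 / u.
  rewrite (_ : D ^+ 4 / u ^+ 2 = (D ^+ 2 / u) ^+ 2); last by field; rewrite gt_eqF.
  by rewrite sqrtr_sqr ger0_norm// divr_ge0 ?sqr_ge0// ltW.
have thle : ((theta j)%:E <= th)%E.
  rewrite -thetaE; apply: le_measure; rewrite ?inE.
  - exact: measurable_orthant_set.
  - exact: (measurable_orthant_set (fun i => Num.sqrt (D ^+ 4 / u ^+ 2) * Kp i -
      D / u / Num.sqrt (D ^+ 4 / u ^+ 2))).
  move=> w Hw i; apply: le_lt_trans (Hw i); rewrite sqD -/D; apply: lerB.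
    by rewrite ler_wpM2r// ler_pdivrMr// ler_peMr// sqr_ge0.
  rewrite (_ : D / u / (D ^+ 2 / u) = D^-1)//; field.
  by rewrite !gt_eqF.
apply: (le_trans (lee_wpmul2r _ thle)) => //; apply: (le_trans fp).
apply: (@le_trans _ _ (P [set w | exists2 k, xpredT k && (k <= n)%N &
    above X e A (fun i => u * a i - D / u)%R (inverted_time u (s k)) w])).
  apply: le_measure; rewrite ?inE.
  - rewrite (_ : mkset _ = \bigcup_(r in [set` F])
      above X e A (fun i => u * a i - D / u) (g r)).
      apply: fin_bigcup_measurable => // r _; exact: (measurable_above BM).
    by apply/seteqP; split=> w [r rF ab]; exists r.
  - rewrite (_ : mkset _ = \bigcup_(k in [set k | (k <= n)%N])
      above X e A (fun i => u * a i - D / u) (inverted_time u (s k))).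
      by apply: bigcup_measurable => k _; exact: (measurable_above BM).
    by apply/seteqP; split=> w [k kn ab]; exists k.
  move=> w [r rF ab]; exists (kr r) => //=.
  have [_ _ _ srn] := Fr r rF; have /andP[h1 _] := krP r rF.
  have := le_trans h1 srn; by rewrite /s ler_pM2r// ler_nat.
have -> := @inversion s n s0 sS u xpredT (fun=> D / u) u0.
have : (\int[P]_w (hit_prob (levels s n xpredT (fun=> 2 * D) w) u)%:E <=
   ((Lam * fine (grid_volume s n xpredT (fun=> 2 * D)) + eps) * H u)%:E)%E.
  near: u; exact: ub.
move=> ubu; apply: (@le_trans _ _ (\int[P]_w (hit_prob (levels s n xpredT (fun=> 2 * D) w) u)%:E)%E).
  apply: ge0_le_integral => //.
  - by move=> w _; rewrite lee_fin fine_ge0.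
  - by apply/measurable_EFinP; exact: measurable_hit_prob.
  - by apply/measurable_EFinP; exact: measurable_hit_prob.
  move=> w _; rewrite lee_fin fine_le ?fin_num_measure//;
    try by apply: measurable_hit => i; exact: measurable_gap.
  apply: le_measure; rewrite ?inE; try by apply: measurable_hit => i; exact: measurable_gap.
  move=> x /hit_levels[k /andP[_ kn] Hk]; apply/hit_levels; exists k => // i.
  apply: (lt_le_trans (Hk i)); rewrite lerD2l mulrC.
  rewrite (_ : u * (D / u) = D); last by rewrite mulrC divfK// gt_eqF.
  rewrite ler_pM2r// -[leRHS]/(1 + 1 : R) lerD2l; apply: (le_trans _ usn2).
  by rewrite ler_pM2r ?invr_gt0// /s ler_pM2r// ler_nat.
apply: (le_trans ubu); rewrite lee_fin ler_pM2r// lerD2r ler_pM2l//.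
Unshelve. all: by end_near.
Qed.

(** The index j is fixed such that dividing by theta j, the factor exp (2 del sl) and the additive
    error del together cost at most eps / 2. Then n is taken with n del^4 >= T0, so that the times
    with larger s cost another eps / 2. *)
Let hitting_event_ub (eps : R) : 0 < eps -> \forall u \near +oo,
  (P (hitting_event X A a e u) <= ((Lam * V + eps) * H u)%:E)%E.
Proof.
move=> eps0; have e20 : 0 < eps / 2 by rewrite divr_gt0.
have cv : (Lam * (expR (2 * del j * sl) * V) + del j) / theta j @[j --> \oo] -->
    (Lam * (expR (2 * 0 * sl) * V) + 0) / 1.
  apply: cvgM; last by apply: cvgV => //; exact: oner_neq0.
  apply: cvgD => //; apply: cvgM; first exact: cvg_cst.
  apply: cvgM; last exact: cvg_cst.
  apply: continuous_cvg; first exact: continuous_expR.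
  by apply: cvgM; [apply: cvgM => //; exact: cvg_cst|exact: cvg_cst].
rewrite mulr0 mul0r expR0 mul1r addr0 divr1 in cv.
have [j jP] : exists j, (Lam * (expR (2 * del j * sl) * V) + del j) / theta j <=
    Lam * V + eps / 2.
  have /cvgrPdist_le/(_ _ e20)[N _ HN] := cv; exists N.
  by have := HN N (leqnn N); rewrite /= ler_distlC => /andP[].
have [T0 T00 early] := early_tail e20.
have D40 : 0 < del j ^+ 4 by rewrite exprn_gt0.
pose n := (Num.truncn (T0 / del j ^+ 4)).+1.
have nT : T0 <= n%:R * del j ^+ 4.
  by rewrite -ler_pdivrMr// ltW// truncnS_gt.
have H1 := early _ nT; have H2 := main_region j n (del_gt0 j).
near=> u.
have u0 : 0 < u by near: u; apply: nbhs_pinfty_gt; exact: num_real.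
have Hu : 0 < H u by exact: tail_prob_gt0 (ltW u0).
have E1 : forall F : seq R, (forall r, r \in F -> 0 <= r <= inverted_time u (n%:R * del j ^+ 4)) ->
  (P [set w | exists2 r, r \in F & above X e A (fun i => u * a i)%R r w] <=
   (eps / 2 * H u)%:E)%E by near: u.
have E2 : forall F : seq R, (forall r, r \in F -> inverted_time u (n%:R * del j ^+ 4) <= r <= 1) ->
  ((theta j)%:E * P [set w | exists2 r, r \in F & above X e A (fun i => u * a i)%R r w] <=
   ((Lam * (expR (2 * del j * sl) * V) + del j) * H u)%:E)%E by near: u.
apply: hitting_event_le => F hF.
set t0 := inverted_time u (n%:R * del j ^+ 4) in E1 E2.
have F1 r : r \in [seq r <- F | r <= t0] -> 0 <= r <= t0.
  by rewrite mem_filter => /andP[-> /hF/andP[->]].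
have F2 r : r \in [seq r <- F | t0 < r] -> t0 <= r <= 1.
  by rewrite mem_filter => /andP[/ltW -> /hF/andP[_]].
have {}E1 := E1 _ F1; have {}E2 := E2 _ F2.
apply: (@le_trans _ _
  (P [set w | exists2 r, r \in [seq r <- F | (r <= t0)%R] &
       above X e A (fun i => u * a i)%R r w] +
   P [set w | exists2 r, r \in [seq r <- F | (t0 < r)%R] &
       above X e A (fun i => u * a i)%R r w])%E).
  have mF F' := @measurable_exists_above F' (fun i => u * a i).
  have := @measureU2 _ _ _ P _ _ (mF [seq r <- F | r <= t0]) (mF [seq r <- F | t0 < r]).
  apply: le_trans; apply: le_measure; rewrite ?inE; [exact: mF|exact: measurableU|].
  move=> w [r rF ab]; case: (leP r t0) => rt; [left|right]; exists r => //;
    by rewrite mem_filter rt.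
have -> : ((Lam * V + eps) * H u)%:E =
    ((eps / 2 * H u)%:E + ((Lam * V + eps / 2) * H u)%:E)%E.
  by rewrite -EFinD; congr EFin; field.
apply: leeD => //; move: E2; rewrite -lee_pdivlMl// => /le_trans; apply.
rewrite -EFinM lee_fin [leLHS]mulrA ler_pM2r// [leLHS]mulrC; exact: jP.
Unshelve. all: by end_near.
Qed.

Let hitting_event_lb (eps : R) : 0 < eps -> \forall u \near +oo,
  (((Lam * V - eps) * H u)%:E <= P (hitting_event X A a e u))%E.
Proof.
move=> eps0.
have : ((V - eps / Lam)%:E < crossing_volume)%E.
  by rewrite VE lte_fin gtrBl divr_gt0.
move=> /crossing_volume_sup[N NV].
have : ((Lam * V - eps)%:E < Lam%:E * grid_volume (dyad N) (N * 2 ^ N) xpredT (fun=> 0%R))%E.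
  have -> : (Lam * V - eps)%:E = (Lam%:E * (V - eps / Lam)%:E)%E.
    by rewrite -EFinM mulrBr mulrCA divff ?mulr1// gt_eqF.
  by rewrite lte_pmul2l// lte_fin.
move=> /(hitting_lb (dyad0 N) (dyadS N)) lb; near=> u.
have u0 : 0 < u by near: u; apply: nbhs_pinfty_gt; exact: num_real.
have : (((Lam * V - eps) * H u)%:E < P [set w | exists2 k, xpredT k && (k <= N * 2 ^ N)%N &
    above X e A (fun i => u * a i)%R (inverted_time u (dyad N k)) w])%E by near: u.
move=> /ltW/le_trans; apply; apply: le_measure; rewrite ?inE.
- rewrite (_ : mkset _ = \bigcup_(k in [set k | (k <= N * 2 ^ N)%N])
    above X e A (fun i => u * a i) (inverted_time u (dyad N k))).
    by apply: bigcup_measurable => k _; exact: (measurable_above BM).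
  by apply/seteqP; split=> w [k kn ab]; exists k.
- exact: measurable_hitting_event.
move=> w [k kn ab]; exists (inverted_time u (dyad N k)) => //.
have x0 : 0 <= dyad N k / u ^+ 2.
  by rewrite divr_ge0// ?exprn_ge0// ?divr_ge0// ?exprn_ge0// ltW.
by rewrite /inverted_time invr_ge0 addr_ge0//= invf_le1 ?lerDl// ltr_pwDl.
Unshelve. all: by end_near.
Qed.

Theorem hitting_asymptotics : (0 < crossing_volume < +oo)%E /\
  fine (P (hitting_event X A a e u)) / (Lam * fine crossing_volume * H u) @[u --> +oo] --> (1 : R).
Proof.
have fE u : P (hitting_event X A a e u) = (fine (P (hitting_event X A a e u)))%:E.
  by rewrite fineK// fin_num_measure//; exact: measurable_hitting_event.
(* If V were 0, the upper bound would give at most H u / 2 for large u, although the event at t = 1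
   alone already has probability H u. *)
have V0 : 0 < V.
  rewrite lt_neqAle -lee_fin -VE crossing_volume_ge0 andbT; apply/eqP => V_0.
  near (+oo : set_system R) => u.
  have u0 : 0 < u by near: u; apply: nbhs_pinfty_gt; exact: num_real.
  have Hu : 0 < H u by exact: tail_prob_gt0 (ltW u0).
  have : (P (hitting_event X A a e u) <= ((Lam * V + 2^-1) * H u)%:E)%E.
    by near: u; apply: hitting_event_ub; rewrite invr_gt0.
  apply/negP; rewrite -ltNge -V_0 mulr0 add0r.
  apply: (@lt_le_trans _ _ (H u)%:E).
    by rewrite lte_fin -[ltRHS]mul1r ltr_pM2r// invf_lt1// ltr1n.
  rewrite -tail_probE -above1; apply: le_measure; rewrite ?inE.
  - exact: (measurable_above BM).
  - exact: measurable_hitting_event.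
  by move=> w ab; exists 1 => //; rewrite ler01 lexx.
split; first by rewrite VE lte_fin V0 ltry.
have LV : 0 < Lam * V by rewrite mulr_gt0.
apply/cvgrPdist_le => eps eps0.
have e0 : 0 < eps * (Lam * V) by rewrite mulr_gt0.
near=> u.
have u0 : 0 < u by near: u; apply: nbhs_pinfty_gt; exact: num_real.
have Hu : 0 < H u by exact: tail_prob_gt0 (ltW u0).
have LVH : 0 < Lam * V * H u by rewrite mulr_gt0.
have ub : (P (hitting_event X A a e u) <= ((Lam * V + eps * (Lam * V)) * H u)%:E)%E.
  by near: u; exact: hitting_event_ub.
have lb : (((Lam * V - eps * (Lam * V)) * H u)%:E <= P (hitting_event X A a e u))%E.
  by near: u; exact: hitting_event_lb.
move: ub lb; rewrite fE !lee_fin -/V => ub lb.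
rewrite ler_distlC ler_pdivlMr// ler_pdivrMr//.
have E (r : R) : (1 + r) * (Lam * V * H u) = (Lam * V + r * (Lam * V)) * H u by ring.
by rewrite !E ub mulNr lb.
Unshelve. all: by end_near.
Qed.

End asymptotics.

(** * Reduction to the model *)

Section qp.
Context {R : realType} {d : nat} (A : 'M[R]_d) (I : {set 'I_d}).
Hypothesis unitA : A \in unitmx.
Let Sigma := A *m A^T.

(** Extension by zero outside [I]: the sum has at most one term, since [enum_val] is injective. *)
Let extend (v : 'I_#|I| -> R) (i : 'I_d) : R :=
  \sum_(k | enum_val k == i) v k.

Let extend_in v k : extend v (enum_val k) = v k.
Proof.
rewrite /extend (eq_bigl (pred1 k)) ?big_pred1_eq// => k' /=.
by rewrite (inj_eq enum_val_inj).
Qed.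

Let extend_notin v i : i \notin I -> extend v i = 0.
Proof.
by move=> iI; rewrite /extend big1// => k /eqP ki; rewrite -ki enum_valP in iI.
Qed.

Let sum_extend v (f : 'I_d -> R) : \sum_i f i * extend v i = \sum_k f (enum_val k) * v k.
Proof.
rewrite (bigID (mem I))/= [X in _ + X]big1 ?addr0; last first.
  by move=> i iI; rewrite extend_notin// mulr0.
by rewrite big_enum_val; apply: eq_bigr => k _; rewrite extend_in.
Qed.

(** For a row vector v in the kernel with zero extension x, the form v Sigma_II v^T is the squared
    norm of A^T x. So x A = 0, and x = 0 because A is invertible. *)
Lemma submatrix_unit : submatrix I I Sigma \in unitmx.
Proof.
rewrite -row_free_unit; apply: inj_row_free => v vS.
pose x i := extend (v 0) i.
pose y j := \sum_i A i j * x i.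
have yE j : y j = \sum_k A (enum_val k) j * v 0 k by rewrite /y sum_extend.
have : \sum_j y j ^+ 2 = 0.
  transitivity ((v *m submatrix I I Sigma *m v^T) 0 0); last by rewrite vS mul0mx mxE.
  rewrite !mxE; transitivity (\sum_j \sum_k A (enum_val k) j * v 0 k * y j).
    by apply: eq_bigr => j _; rewrite expr2 {1}yE mulr_suml.
  rewrite exchange_big/=; apply: eq_bigr => k _.
  rewrite !mxE mulr_suml.
  transitivity (\sum_j \sum_l A (enum_val k) j * v 0 k * (A (enum_val l) j * v 0 l)).
    by apply: eq_bigr => j _; rewrite yE mulr_sumr.
  rewrite exchange_big/=; apply: eq_bigr => l _.
  rewrite !mxE mulr_sumr mulr_suml; apply: eq_bigr => j _; rewrite !mxE; ring.
move=> /eqP; rewrite psumr_eq0 => [/allP y0|j _]; last exact: sqr_ge0.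
have xA : (\row_i x i) *m A = 0.
  apply/rowP => j; rewrite !mxE; have /implyP/(_ isT) := y0 j (mem_index_enum j).
  rewrite sqrf_eq0 => /eqP yj0; transitivity (y j) => //.
  by apply: eq_bigr => i _; rewrite !mxE mulrC.
have x0 : \row_i x i = 0 by rewrite -(mulmxK unitA (\row_i x i)) xA mul0mx.
apply/rowP => k; have /rowP/(_ (enum_val k)) := x0.
by rewrite !mxE /x extend_in.
Qed.

(** Let mu be the zero extension of (Sigma_II)^-1 a_I. The two blocks of the index conditions say
    precisely that Sigma mu = atil, whence lambda = mu. *)
Lemma qp_multiplier (a atil : 'cV[R]_d) : qp_index Sigma a atil I ->
  let lam := invmx Sigma *m atil in
  [/\ forall i, i \in I -> 0 < lam i 0, forall i, i \notin I -> lam i 0 = 0 &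
      forall i, i \in I -> atil i 0 = a i 0].
Proof.
move=> [_ eqI]; set v := _ *m subv I a => v0 eqIc.
have unitS : Sigma \in unitmx by rewrite unitmx_mul unitmx_tr unitA.
pose mu : 'cV[R]_d := \col_i extend (fun k => v k 0) i.
have aI i : i \in I -> atil i 0 = a i 0.
  move=> iI; have /colP/(_ (enum_rank_in iI i)) := eqI.
  by rewrite !mxE enum_rankK_in.
have Smu : Sigma *m mu = atil.
  apply/colP => i; rewrite [LHS]mxE (eq_bigr (fun j => Sigma i j * extend (v^~ 0) j)).
    rewrite sum_extend; have [iI|iI] := boolP (i \in I).
      rewrite aI//; have /colP/(_ (enum_rank_in iI i)) := mulKVmx submatrix_unit (subv I a).
      rewrite -/v [X in X = _ -> _]mxE [X in _ = X -> _]mxE enum_rankK_in// => <-.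
      by apply: eq_bigr => k _; rewrite [submatrix _ _ _ _ _]mxE enum_rankK_in.
    have iIc : i \in ~: I by rewrite inE.
    have /eqIc[/colP/(_ (enum_rank_in iIc i)) + _] : ~: I != finset.set0.
      by apply/set0Pn; exists i.
    rewrite [X in X = _ -> _]mxE [X in _ = X -> _]mxE enum_rankK_in// => ->.
    by apply: eq_bigr => k _; rewrite [submatrix _ _ _ _ _]mxE enum_rankK_in.
  by move=> j _; rewrite [mu j 0]mxE.
have lamE : invmx Sigma *m atil = mu by rewrite -Smu mulKmx.
rewrite /= lamE; split=> // i iI; rewrite mxE; last exact: extend_notin.
rewrite -(enum_rankK_in iI iI) extend_in.
by have := v0 (enum_rank_in iI i); rewrite mxE.
Qed.

End qp.

Section ae.
Context {R : realType} {dsp} {T : measurableType dsp} (P : probability T R).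

Lemma ae_eq_probability (C D : set T) : measurable C -> measurable D ->
  {ae P, forall w, C w <-> D w} -> P C = P D.
Proof.
move=> + + [N [mN N0 sub]].
have le C' D' : measurable C' -> measurable D' -> (forall w, ~ N w -> C' w -> D' w) ->
    (P C' <= P D')%E.
  move=> mC mD CD; apply: (@le_trans _ _ (P (D' `|` N))).
    apply: le_measure; rewrite ?inE//; first exact: measurableU.
    by move=> w Cw; have [Nw|Nw] := pselect (N w); [right|left; exact: CD].
  apply: (le_trans (measureU2 P mD mN)).
  by rewrite [X in (_ + X)%E](_ : _ = 0%E) ?adde0//; exact: N0.
have CDN w : ~ N w -> (C w <-> D w).
  by move=> Nw; apply: contrapT => H; apply: Nw; exact: sub.
move=> mC mD; apply/eqP; rewrite eq_le !le//; by move=> w /CDN[].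
Qed.

Lemma ae_probability1 (C : set T) : measurable C -> P C = 1%E ->
  {ae P, forall w, C w}.
Proof.
move=> mC C1; exists (~` C); split => //; first exact: measurableC.
by rewrite probability_setC// C1 subee.
Qed.

Lemma measurable_sigma_generated {J : Type} {d'} {U : measurableType d'} (D : set J)
    (Y : J -> T -> U) (j : J) : D j ->
  measurable_fun setT (Y j : g_sigma_algebraType
    (\bigcup_(j in D) preimage_set_system [set: T] (Y j) measurable) -> U).
Proof.
move=> Dj _ C mC; apply: sub_sigma_algebra; exists j => //.
by exists C.
Qed.

Lemma sigma_generated_increments {J : Type} {K : finType} (D : set J) (Y : J -> T -> R)
    (p q : K -> J) (U : K -> set R) :
  (forall k, D (p k)) -> (forall k, D (q k)) -> (forall k, measurable (U k)) ->
  sigma_generated D Y [set w | forall k, U k (Y (p k) w - Y (q k) w)].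
Proof.
move=> Dp Dq mU.
apply: (@measurable_forall _ (g_sigma_algebraType
  (\bigcup_(j in D) preimage_set_system [set: T] (Y j) measurable)) R K
  (fun k w => Y (p k) w - Y (q k) w)) => // k.
by apply: measurable_funB; exact: measurable_sigma_generated.
Qed.

End ae.

Section model.
Context {R : realType} {dsp} {T : measurableType dsp} (P : probability T R).
Context {d : nat} (B : 'I_d -> R -> {RV P >-> R}) (eta : {RV P >-> d.-tuple R}).
Variables (K1 K2 : 'cV[R]_d).
Hypotheses (BB : brownian_motion_indep B) (eta_indep : independent_of_process eta B).

(** Subtracting the initial value makes every path start at 0, not only almost every one, and leaves
    the increments unchanged. *)
Definition centered (i : 'I_d) (t : R) (w : T) : R := B i t w - B i 0 w.

(* The drift eta is only almost surely bounded; truncating it makes the bounds hold everywhere. *)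
Definition clamp (i : 'I_d) (x : R) : R :=
  Num.min (Num.max x (K1 i 0)) (Num.max (K1 i 0) (K2 i 0)).

Definition drift (i : 'I_d) (w : T) : R := clamp i (tnth (eta w) i).

Lemma drift_ge i w : K1 i 0 <= drift i w.
Proof. by rewrite /drift /clamp le_min !le_max lexx orbT. Qed.

Lemma drift_le i w : drift i w <= Num.max (K1 i 0) (K2 i 0).
Proof. by rewrite /drift /clamp ge_min lexx orbT. Qed.

Let measurable_clamp i : measurable_fun setT (clamp i).
Proof. by apply: measurable_minr => //; exact: measurable_maxr. Qed.

Let measurable_drift i : measurable_fun setT (drift i).
Proof.
apply: measurableT_comp => //.
apply: (measurableT_comp (measurable_tnth i)); exact: measurable_funP.
Qed.

(** The probability factorizes in three stages: the drift against the whole process, then the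
    coordinates against each other, then the increments within one coordinate. *)
Lemma centered_brownian_model : brownian_model P centered drift.
Proof.
have [BM BI] := BB; split.
- by move=> i t; apply: measurable_funB; exact: measurable_funP.
- exact: measurable_drift.
- by move=> i w; rewrite /centered subrr.
- move=> i w t; have [_ _ _ /(_ w) cB] := BM i.
  by apply: cvgB; [exact: cB|exact: cvg_cst].
move=> n t t0 tS E mE U mU.
have t_ge0 k : 0 <= t k by elim: k => [|k IH]; rewrite ?t0// (le_trans IH)// ltW.
pose incr (p : 'I_d * 'I_n) w := B p.1 (t p.2.+1) w - B p.1 (t p.2) w.
pose G := [set w | forall p, U p (incr p w)].
rewrite [X in P (_ `&` X)](_ : _ = G); last first.
  by apply/seteqP; split=> w H p; have := H p; rewrite /centered /incr opprB addrA subrK.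
have -> : P ([set w | forall i, E i (drift i w)] `&` G) =
    (P [set w | forall i, E i (drift i w)] * P G)%E.
  apply: eta_indep.
    exists [set x | forall i, E i (clamp i (tnth x i))]; last by rewrite setTI.
    apply: measurable_forall => // i; apply: measurableT_comp => //.
    exact: measurable_tnth.
  exact: (@sigma_generated_increments R _ T ('I_d * R)%type ('I_d * 'I_n)%type
    [set p | 0 <= p.2] (fun p => B p.1 p.2 : T -> R)
    (fun p => (p.1, t p.2.+1)) (fun p => (p.1, t p.2)) U
    (fun p => t_ge0 p.2.+1) (fun p => t_ge0 p.2) mU).
pose Gi i := [set w | forall k : 'I_n, U (i, k) (incr (i, k) w)].
have -> : P G = (\prod_i P (Gi i))%E.
  have := BI [set: 'I_d]%SET Gi.
  rewrite [X in P X](_ : _ = G).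
    move=> ->; first by apply: eq_bigl => i; rewrite inE.
    move=> i; exact: (@sigma_generated_increments R _ T R 'I_n [set t | 0 <= t]
      (fun t => B i t : T -> R) (fun k : 'I_n => t k.+1) (fun k : 'I_n => t k)
      (fun k => U (i, k)) (fun k => t_ge0 k.+1) (fun k => t_ge0 k) (fun k => mU (i, k))).
  apply/seteqP; split=> w.
    by move=> H [i k]; apply: (H i); rewrite /= inE.
  by move=> H i _ k; exact: (H (i, k)).
have Gprod i : P (Gi i) =
    (\prod_(k < n) normal_prob 0 (Num.sqrt (t k.+1 - t k)) (U (i, k)))%E.
  have [_ BIi BN _] := BM i.
  pose F (k : 'I_n) := incr (i, k) @^-1` U (i, k).
  have := BIi n t (t_ge0 0%N) (fun k => ltW (tS k)) [set: 'I_n]%SET F.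
  rewrite [X in P X](_ : _ = Gi i).
    move=> -> => [|k]; last by exists (U (i, k)) => //; rewrite setTI.
    apply: (@etrans _ _ (\prod_(k < n) P (F k))%E).
      by apply: eq_bigl => k; rewrite inE.
    by apply: eq_bigr => k _; exact: BN (t_ge0 k) (tS k) _ (mU _).
  apply/seteqP; split=> w.
    by move=> H k; apply: (H k); rewrite /= inE.
  by move=> H k _; exact: (H k).
rewrite (eq_bigr _ (fun i _ => Gprod i)).
have pairE (p : 'I_d * 'I_n) :
    normal_prob 0 (Num.sqrt (t p.2.+1 - t p.2)) (U (p.1, p.2)) =
    normal_prob 0 (Num.sqrt (t p.2.+1 - t p.2)) (U p) by case: p.
exact: (congr1 (fun y => (P [set w | forall i, E i (drift i w)] * y)%E)
  (etrans (pair_bigA _ (fun (i : 'I_d) (k : 'I_n) =>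
    normal_prob 0 (Num.sqrt (t k.+1 - t k)) (U (i, k))))
  (eq_bigr _ (fun p _ => pairE p)))).
Qed.

Hypothesis eta_bounded :
  P [set w | vle K1 (col_of_tuple (eta w)) /\ vle (col_of_tuple (eta w)) K2] = 1%E.

Lemma ae_model : {ae P, forall w,
  (forall i t, centered i t w = B i t w) /\ (forall i, drift i w = tnth (eta w) i)}.
Proof.
have [BM _] := BB.
have m : measurable [set w | vle K1 (col_of_tuple (eta w)) /\ vle (col_of_tuple (eta w)) K2].
  pose f i w := tnth (eta w) i.
  have mf i : measurable_fun setT (f i).
    by apply: (measurableT_comp (measurable_tnth i)); exact: measurable_funP.
  rewrite (_ : mkset _ = [set w | forall i, `[K1 i 0, K2 i 0]%classic (f i w)]).
    exact: (measurable_forall mf (fun i => measurable_itv _)).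
  apply/seteqP; split=> w.
    by move=> [h1 h2] i; have := h1 i; have := h2 i; rewrite /= in_itv/= !mxE => -> ->.
  by move=> H; split=> i; have := H i; rewrite /= in_itv/= !mxE => /andP[].
have aeB : {ae P, forall w, forall i, B i 0 w = 0}.
  by apply: filter_forall => i; have [] := BM i.
have aeeta := ae_probability1 m eta_bounded.
apply: filterS2 aeB aeeta => w B0 [le1 le2]; split=> [i t|i].
  by rewrite /centered B0 subr0.
have := le1 i; have := le2 i; rewrite /drift /clamp !mxE => h2 h1.
by rewrite (max_l h1) min_l// le_max h2 orbT.
Qed.

End model.

Section event_congruence.
Context {R : realType} {dsp} {T : measurableType dsp} {d : nat}.
Variables (X X' : 'I_d -> R -> T -> R) (e e' : 'I_d -> T -> R) (A : 'M[R]_d).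
Variables (a : 'I_d -> R) (w : T).
Hypotheses (XX' : forall i t, X i t w = X' i t w) (ee' : forall i, e i w = e' i w).

Let mulf_eq t i : mulf A (fun j => X j t w) i = mulf A (fun j => X' j t w) i.
Proof. by apply: eq_bigr => j _; rewrite XX'. Qed.

Lemma hitting_event_congr u : hitting_event X A a e u w <-> hitting_event X' A a e' u w.
Proof.
by split=> -[t t01 H]; exists t => // i; have := H i; rewrite /above mulf_eq ee'.
Qed.

Lemma crossing_congr (I : {set 'I_d}) (x : 'I_#|I| -> R) :
  crossing X A a x w <-> crossing X' A a x w.
Proof. by split=> -[t t0 H]; exists t => // k; have := H k; rewrite mulf_eq. Qed.

Lemma exceed_congr c :
  exceed e (fun i => X i 1) A c w <-> exceed e' (fun i => X' i 1) A c w.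
Proof. by split=> H i; have := H i; rewrite mulf_eq ee'. Qed.

End event_congruence.

Unset Implicit Arguments.
Set Strict Implicit.
Set Printing Implicit Defensive.

Theorem theorem2p3 (R : realType) (dsp : measure_display)
    (Omega : measurableType dsp) (P : probability Omega R)
    (d : nat) (A : 'M[R]_d) (B : 'I_d -> R -> {RV P >-> R})
    (eta : {RV P >-> d.-tuple R}) (K1 K2 a atil : 'cV[R]_d)
    (I : {set 'I_d}) :
  let W := linear_image A B in
  let etav := fun w => col_of_tuple (eta w) in
  let Sigma := A *m A^T in
  (2 <= d)%N ->
  A \in unitmx ->
  brownian_motion_indep B ->
  independent_of_process eta B ->
  P [set w | vle K1 (etav w) /\ vle (etav w) K2] = 1%E ->
  ~ vle a 0 ->
  qp_minimizer Sigma a atil ->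
  qp_index Sigma a atil I ->
  let lambda := invmx Sigma *m atil in
  let Ia := (\int[lebesgue_tuple #|I|]_x
    (P [set w | (exists2 t : R, 0 <= t &
          vlt (col_of_tuple x) (subv I (W t w) - t *: subv I a))%R] *
     (expR (dot (subv I lambda) (col_of_tuple x)))%:E))%E in
  (0 < Ia < +oo)%E /\
  asymp_equiv
    (fun u : R => fine (P [set w | exists2 t : R, 0 <= t <= 1 &
       vlt (u *: a) (W t w - t *: etav w)]))
    (fun u : R => (\prod_(i in I) lambda i 0) * fine Ia *
       fine (P [set w | vlt (u *: a + etav w) (W 1 w)])).
Proof.
move=> W etav Sigma _ unitA BB eta_indep eta_bounded a_npos [le_a _] index lambda Ia.
have [lam_gt0 lam_eq0 aI] := @qp_multiplier _ _ _ _ unitA _ _ index.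
have BM := @centered_brownian_model _ _ _ _ _ _ _ K1 K2 BB eta_indep.
have ae := @ae_model _ _ _ _ _ _ _ _ _ BB eta_bounded.
have unitS : Sigma \in unitmx by rewrite unitmx_mul unitmx_tr unitA.
pose lam i := lambda i 0.
(* b = A^T lambda is the shift used in the Gaussian estimates; A b = Sigma lambda = atil. *)
pose b j := \sum_i A i j * lam i.
pose X := centered B; pose e := drift eta K1 K2.
pose ai i := a i 0.
have WE t w i : W t w i 0 = mulf A (fun j => B j t w) i.
  by rewrite /W /linear_image mxE; apply: eq_bigr => j _; rewrite mxE.
have atE i : atil i 0 = mulf A b i.
  have <- : Sigma *m lambda = atil by rewrite mulKVmx.
  rewrite /Sigma -mulmxA mxE; apply: eq_bigr => j _; congr (_ * _).
  by rewrite mxE; apply: eq_bigr => k _; rewrite mxE.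
have lam_ge0 i : 0 <= lam i.
  by have [iI|iI] := boolP (i \in I); [exact/ltW/lam_gt0|rewrite /lam lam_eq0].
have slack i : lam i * (atil i 0 - ai i) = 0.
  have [iI|iI] := boolP (i \in I); first by rewrite aI// subrr mulr0.
  by rewrite /lam lam_eq0// mul0r.
have a_pos : exists i, 0 < ai i.
  apply: contrapT => H; apply: a_npos => i; rewrite mxE leNgt; apply/negP => ?.
  by apply: H; exists i.
have [V01 asym] := hitting_asymptotics BM (drift_ge eta K1 K2) (drift_le eta K1 K2)
  (fun j => erefl (b j)) atE le_a lam_ge0 slack unitA lam_gt0 lam_eq0 a_pos.
have [BMi _] := BB.
have cB i w : {within `[0, +oo[, continuous (B i ^~ w)} by have [_ _ _] := BMi i; apply.
have mB i t : measurable_fun setT (B i t) by exact: measurable_funP.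
have meta i : measurable_fun setT (fun w => tnth (eta w) i).
  by apply: (measurableT_comp (measurable_tnth i)); exact: measurable_funP.
have mX i t := bm_measurable BM i t.
have cX i w := bm_continuous BM (i := i) (w := w).
have me i := bm_measurable_drift BM i.
have IaE : Ia = crossing_volume P X A ai lam I.
  apply: eq_integral => x _; congr (_ * _)%E; last first.
    congr (expR _)%:E; apply: eq_bigr => k _.
    by rewrite [subv I lambda k 0]mxE [col_of_tuple x k 0]mxE.
  rewrite (_ : mkset _ = crossing (fun i t => B i t : Omega -> R) A ai (tnth x)); last first.
    have E t w k : (subv I (W t w) - t *: subv I a) k 0 =
        mulf A (fun j => B j t w) (enum_val k) - t * ai (enum_val k).
      rewrite mxE [subv I (W t w) k 0]mxE WE; congr (_ + _).
      by rewrite [LHS]mxE; congr (- _); rewrite [LHS]mxE [subv I a k 0]mxE.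
    by apply/seteqP; split=> w [t t0 H]; exists t => // k; have := H k;
      rewrite E [col_of_tuple x k 0]mxE.
  apply: ae_eq_probability; [exact: measurable_crossing_event..|].
  apply: filterS ae => w [XB _]; apply: crossing_congr => i t; exact: esym (XB i t).
have hitE u : P [set w | exists2 t : R, 0 <= t <= 1 &
    vlt (u *: a) (W t w - t *: etav w)] = P (hitting_event X A ai e u).
  rewrite (_ : mkset _ = hitting_event (fun i t => B i t : Omega -> R)
    A ai (fun i w => tnth (eta w) i) u); last first.
    have E t w i : ((u *: a) i 0 < (W t w - t *: etav w) i 0) =
        (u * ai i + t * tnth (eta w) i < mulf A (fun j => B j t w) i).
      rewrite [(u *: a) i 0]mxE [(W t w - _) i 0]mxE WE -ltrBrDr.
      congr (_ < _ + _); rewrite [LHS]mxE; congr (- _).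
      by rewrite [LHS]mxE [etav w i 0]mxE.
    apply/seteqP; split=> w [t t01 H]; exists t; [exact: t01| |exact: t01|] => i.
      exact: etrans (esym (E t w i)) (H i).
    exact: etrans (E t w i) (H i).
  apply: ae_eq_probability; [exact: measurable_hitting..|].
  apply: filterS ae => w [XB eE]; apply: hitting_event_congr => [i t|i].
    exact: esym (XB i t).
  exact: esym (eE i).
have tailE u : P [set w | vlt (u *: a + etav w) (W 1 w)] =
    P (exceed e (fun i => X i 1) A (fun i => u * ai i)).
  rewrite (_ : mkset _ = exceed (fun i w => tnth (eta w) i) (fun i => B i 1 : Omega -> R)
    A (fun i => u * ai i)); last first.
    have E w i : (u *: a + etav w) i 0 = u * ai i + tnth (eta w) i.
      by rewrite mxE [(u *: a) i 0]mxE [etav w i 0]mxE.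
    by apply/seteqP; split=> w H i; have := H i; rewrite E WE.
  apply: ae_eq_probability; [exact: measurable_exceed..|].
  apply: filterS ae => w [XB eE]; apply: (@exceed_congr R _ Omega d (fun i t => B i t) X) => [i t|i].
    exact: esym (XB i t).
  exact: esym (eE i).
split; first by rewrite IaE; exact: V01.
rewrite IaE; move: asym; rewrite /asymp_equiv /tail_prob.
by under eq_fun do rewrite -hitE -tailE.
Qed.
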